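(* Let $k$ be a field, let $Q$ be a finite connected quiver containing a cycle $Q_E\subseteq Q$ with $Q_E\cong\widetilde{A}_{n-1}$, $n\ge 1$, and let $q\in(k^\times)^{Q_0}$. Let $L=L_Q$, $r=\rho-q\in L$ and $B=kQ_0[t,(q+t)^{-1}]$. Then there exists a section $\sigma:\Lambda^q(Q)\to L$ of the quotient map $L\to\Lambda^q(Q)$ such that $(L,r,\sigma,B)$ satisfies the strong free product property. In more detail, $L_Q$ has a $k$-basis consisting of the idempotents $e_i$ ($i\in Q_0$) together with all concatenable alternating products of elements of the following three families (alternating meaning that consecutive factors come from different families, and the factors are not idempotents $e_i$): (1) the elements of positive length of the basis of $\Lambda^{q_E}(Q_E)$ given by $\mathfrak{B}$ (or, alternatively, by $\mathfrak{B}'$); (2) the elements of positive length of the basis of $\Lambda^{q'}(Q',\mathcal{W})$ given by the admissible words; (3) the elements $r^m$ and $(r')^m$ for $m\ge 1$ (multiplied by the idempotents $e_i$), where $r'=(q+r)^{-1}-q^{-1}$.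
   Context: Multiplicative preprojective algebra. For a finite quiver $Q$ with tail and head maps $t,h$, let $\overline{Q}$ be its double (a reverse arrow $a^*$ added for each $a\in Q_1$, $(a^* )^*=a$), $\epsilon(a)=1$ for $a\in Q_1$ and $-1$ otherwise. Paths are concatenated left to right, $kQ_0=\bigoplus_i ke_i$. Put $L_Q=k\overline{Q}[(1+aa^* )^{-1}]_{a\in\overline{Q}_1}$, and, for a fixed total order on $\overline{Q}_1$, $\rho=\prod_{a\in\overline{Q}_1}(1+aa^* )^{\epsilon(a)}$. With $q=\sum q_ie_i$, $\Lambda^q(Q)=L_Q/(\rho-q)$. The isomorphism class of $\Lambda^q(Q)$ is independent of orientation and ordering. For a set $\mathcal{W}\subseteq Q_0$ of white vertices, with black vertices $\mathcal{B}=Q_0\setminus\mathcal{W}$ and $1_{\mathcal{B}}=\sum_{j\in\mathcal{B}}e_j$, the partial multiplicative preprojective algebra is $\Lambda^q(Q,\mathcal{W})=L_Q/(1_{\mathcal{B}}(\rho-q)1_{\mathcal{B}})$; it depends only on $q|_{\mathcal{B}}$. Strong free product property. Here $B=kQ_0[t,(q+t)^{-1}]$ ($t$ commuting with the $e_i$), $\overline{B}=tB$, so $B=kQ_0\oplus\overline{B}$; $\overline{B}$ is spanned over $kQ_0$ by $t^m,(t')^m$, $m\ge1$, with $t'=(q+t)^{-1}-q^{-1}$. Let $\tau:B\to L$ be the $kQ_0$-algebra map with $\tau(t)=r$, and let $\sigma:\Lambda^q(Q)\to L$ be a $kQ_0$-bimodule section of the quotient map with $\sigma(1)=1$. Let $\sigma':\Lambda^q(Q)*_{kQ_0}B\to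 L$ be the linear map $a_0b_1a_1\cdots b_na_n\mapsto\sigma(a_0)\tau(b_1)\sigma(a_1)\cdots\tau(b_n)\sigma(a_n)$ for $a_i\in\Lambda^q(Q)$, $b_i\in\overline{B}$. The quadruple $(L,r,\sigma,B)$ satisfies the strong free product property if $\sigma'$ is a linear isomorphism. Notation for the cycle. $\mathcal{W}=(Q_E)_0$ is the set of vertices of the cycle, $\mathcal{B}=Q_0\setminus\mathcal{W}$, $Q'=Q\setminus Q_E$ is the quiver with vertex set $Q_0$ and arrows $Q_1\setminus(Q_E)_1$, $q_E=q|_{\mathcal{W}}$ and $q'=q|_{\mathcal{B}}$. Orient $Q_E$ cyclically, with vertices $0,\dots,n-1$ and arrows $a_i:i\to i+1$ (mod $n$). Put $a=\sum_ia_i$, $a^*=\sum_ia_i^*$, and let $x$ be the element $1+aa^*$ (with $1=1_{\mathcal{W}}$). The order on $\overline{Q}_1$ is chosen with the arrows of $\overline{Q_E}$ first, ordered $a_0<\dots<a_{n-1}<a_0^*<\dots<a_{n-1}^*$, followed by the arrows of $\overline{Q'}$ (so $\rho=\rho_{Q_E}\rho_{Q'}$). The basis $\mathfrak{B}$ of $\Lambda^{q_E}(Q_E)$ consists of the elements $e_ix^ma^\ell$, $e_ix^m(a^* )^\ell$ with $i\in\mathcal{W}$, $m\in\mathbb{Z}$, $\ell\ge0$. The alternative basis $\mathfrak{B}'$ consists of $e_i(x^{\pm1}-1)^ma^\ell$, $e_i(x^{\pm1}-1)^m(a^* )^\ell$ with $m,\ell\ge0$. The elements of positive length are those different from the $e_i$.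 Basis of $\Lambda^{q'}(Q',\mathcal{W})$. Choose a spanning forest $F$ of $Q'$ rooted in $\mathcal{W}$ (a disjoint union of trees, covering all vertices of $Q_0$, each containing exactly one vertex of $\mathcal{W}$, its root), with arrows oriented towards the roots, and orient $Q'$ so that $F_1\subseteq Q'_1$. For $a\in\overline{Q'}_1$ let $\overline{x_a^{\pm}}=e_{t(a)}((1+aa^* )^{\pm1}-1)$. The admissible words are the concatenable words (including the $e_i$) in the letters $a,\overline{x_a^+},\overline{x_a^-}$ ($a\in\overline{Q'}_1$) in which the following subwords do not occur: for $a\in\overline{Q'}_1$: $\overline{x_a^+}\,\overline{x_a^-}$, $\overline{x_a^-}\,\overline{x_a^+}$, $aa^*$, $a\overline{x_{a^*}^{\pm}}$; and for $a\in F_1$: $\overline{x_a^{\pm}}$, $\overline{x_{a^*}^-}$, $\overline{x_{a^*}^+}a^*$, $(\overline{x_{a^*}^+})^2$. They form a $k$-basis of $\Lambda^{q'}(Q',\mathcal{W})$. Words in the bases are regarded as elements of $L_Q$ by the same expressions. *)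

(* Defs.v *)
From HB Require Import structures.
From mathcomp Require Import all_boot all_order all_algebra.
From mathcomp Require Import boolp.
From mathcomp.multinomials Require Import monalg.

Set Implicit Arguments.
Unset Strict Implicit.
Unset Printing Implicit Defensive.

Import GRing.Theory.
Local Open Scope ring_scope.
Local Open Scope quotient_scope.

(* The library's [algType] excludes the zero ring, but an algebra given by
   generators and relations may collapse; hence a ring, possibly zero, with a
   central homomorphism from the ground field. *)

Record algebra (k : fieldType) := Algebra {
  alg_ring : pzRingType;
  alg_scalar : {rmorphism k -> alg_ring};
  alg_central : forall (c : k) (x : alg_ring),
    alg_scalar c * x = x * alg_scalar c
}.

Definition alg_sort (k : fieldType) (A : algebra k) : Type := alg_ring A.
Coercion alg_sort : algebra >-> Sortclass.

Section AlgebraStructure.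
Variables (k : fieldType) (A : algebra k).

HB.instance Definition _ := GRing.PzRing.on (alg_sort A).

Definition alg_scale (c : k) (x : A) : A := @alg_scalar k A c * x.

Fact alg_scaleA a b (x : A) :
  alg_scale a (alg_scale b x) = alg_scale (a * b) x.
Proof. by rewrite /alg_scale mulrA -rmorphM. Qed.

Fact alg_scale1 : left_id 1 alg_scale.
Proof. by move=> x; rewrite /alg_scale rmorph1 mul1r. Qed.

Fact alg_scaleDr : right_distributive alg_scale +%R.
Proof. by move=> c x y; rewrite /alg_scale mulrDr. Qed.

Fact alg_scaleDl (x : A) : {morph alg_scale^~ x : a b / a + b}.
Proof. by move=> a b; rewrite /alg_scale rmorphD mulrDl. Qed.

HB.instance Definition _ := GRing.Zmodule_isLmodule.Build k (alg_sort A)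
  alg_scaleA alg_scale1 alg_scaleDr alg_scaleDl.

Lemma alg_scalerAl (c : k) (x y : A) : c *: (x * y) = (c *: x) * y.
Proof. exact: mulrA. Qed.

Lemma alg_scalerAr (c : k) (x y : A) : c *: (x * y) = x * (c *: y).
Proof.
have cx := alg_central c (x : alg_ring A).
by rewrite [LHS]alg_scalerAl [c *: x]cx [RHS]mulrA.
Qed.

End AlgebraStructure.

Definition alg_hom (k : fieldType) (A B : algebra k) (f : A -> B) : Prop :=
  linear f /\ monoid_morphism f.

Section FreeAlgebra.
Variables (k : fieldType) (X : choiceType).

Fact free_central (c : k) (x : {malg k[{fmonom X}]}) :
  malgC c * x = x * malgC c.
Proof.
rewrite mul_malgC malgM_def fgmulgU [LHS](monalgEw (msuppZ_le c x)).
by apply: eq_bigr => w _; rewrite mcoeffZ mulm1 mulrC.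
Qed.

Definition free_alg : algebra k :=
  @Algebra k {malg k[{fmonom X}]} (@malgC {fmonom X} k) free_central.

Definition free_gen (x : X) : free_alg := << fmu x >>.

End FreeAlgebra.

Section QuotientAlgebra.
Variables (k : fieldType) (A : algebra k) (S : A -> Prop).

Inductive ideal_gen : A -> Prop :=
| ideal_gen_in x : S x -> ideal_gen x
| ideal_gen0 : ideal_gen 0
| ideal_genD x y : ideal_gen x -> ideal_gen y -> ideal_gen (x + y)
| ideal_genMl a x : ideal_gen x -> ideal_gen (a * x)
| ideal_genMr a x : ideal_gen x -> ideal_gen (x * a).

Definition ideal_pred (x : A) : bool := `[< ideal_gen x >].

Fact ideal_zmod_closed : zmod_closed ideal_pred.
Proof.
split=> [|x y /asboolP Ix /asboolP Iy]; apply/asboolP; first exact: ideal_gen0.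
by rewrite -mulN1r; apply: ideal_genD => //; apply: ideal_genMl.
Qed.

HB.instance Definition _ :=
  GRing.isZmodClosed.Build A ideal_pred ideal_zmod_closed.

Definition ideal : zmodClosed A := GRing.ZmodClosed.clone A ideal_pred _.

Definition quo_type : Type := Quotient.quot ideal.
HB.instance Definition _ := GRing.Zmodule.on quo_type.

Definition quo_pi (x : A) : quo_type := \pi_(Quotient.quot ideal) x.

Lemma quo_piP x y : quo_pi x = quo_pi y <-> ideal_gen (x - y).
Proof.
split=> [|Ixy]; last by apply/eqP; rewrite -Quotient.idealrBE; apply/asboolP.
by move/eqP; rewrite -Quotient.idealrBE => /asboolP.
Qed.

Fact quo_repr_sig (u : quo_type) : {x : A | quo_pi x = u}.
Proof. exists (repr (u : Quotient.quot ideal)); exact: reprK. Qed.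

Definition quo_repr (u : quo_type) : A := sval (quo_repr_sig u).

Fact quo_reprK u : quo_pi (quo_repr u) = u.
Proof. exact: svalP (quo_repr_sig u). Qed.

Fact quo_ind (P : quo_type -> Prop) : (forall x, P (quo_pi x)) -> forall u, P u.
Proof. by move=> Ppi u; rewrite -[u]quo_reprK. Qed.

Fact quo_piB x y : quo_pi (x - y) = quo_pi x - quo_pi y.
Proof. exact: raddfB. Qed.

Fact quo_piD x y : quo_pi (x + y) = quo_pi x + quo_pi y.
Proof. exact: raddfD. Qed.

Definition quo_mul u v : quo_type := quo_pi (quo_repr u * quo_repr v).

Fact quo_piM x y : quo_pi (x * y) = quo_mul (quo_pi x) (quo_pi y).
Proof.
set x' := quo_repr (quo_pi x); set y' := quo_repr (quo_pi y).
apply/quo_piP; have -> : x * y - x' * y' = (x - x') * y + x' * (y - y').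
  by rewrite mulrBl mulrBr addrA subrK.
by apply: ideal_genD; [apply: ideal_genMr | apply: ideal_genMl];
   apply/quo_piP; rewrite quo_reprK.
Qed.

Fact quo_mulA : associative quo_mul.
Proof.
by elim/quo_ind=> x; elim/quo_ind=> y; elim/quo_ind=> z; rewrite -!quo_piM mulrA.
Qed.

Fact quo_mul1l : left_id (quo_pi 1) quo_mul.
Proof. by elim/quo_ind=> x; rewrite -quo_piM mul1r. Qed.

Fact quo_mul1r : right_id (quo_pi 1) quo_mul.
Proof. by elim/quo_ind=> x; rewrite -quo_piM mulr1. Qed.

Fact quo_mulDl : left_distributive quo_mul +%R.
Proof.
elim/quo_ind=> x; elim/quo_ind=> y; elim/quo_ind=> z.
by rewrite -quo_piD -!quo_piM -quo_piD mulrDl.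
Qed.

Fact quo_mulDr : right_distributive quo_mul +%R.
Proof.
elim/quo_ind=> x; elim/quo_ind=> y; elim/quo_ind=> z.
by rewrite -quo_piD -!quo_piM -quo_piD mulrDr.
Qed.

HB.instance Definition _ := GRing.Zmodule_isPzRing.Build quo_type
  quo_mulA quo_mul1l quo_mul1r quo_mulDl quo_mulDr.

Definition quo_scalar (c : k) : quo_type := quo_pi (c *: (1 : A)).

Fact quo_scalar_zmod : zmod_morphism quo_scalar.
Proof. by move=> a b; rewrite /quo_scalar scalerBl quo_piB. Qed.

Fact quo_scalar_monoid : monoid_morphism quo_scalar.
Proof.
split=> [|a b]; first by rewrite /quo_scalar scale1r.
rewrite /quo_scalar -[LHS]/(quo_pi _) -[RHS]/(quo_mul _ _) -quo_piM.
by rewrite -alg_scalerAl mul1r scalerA.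
Qed.

HB.instance Definition _ := GRing.isZmodMorphism.Build k quo_type quo_scalar
  quo_scalar_zmod.
HB.instance Definition _ := GRing.isMonoidMorphism.Build k quo_type quo_scalar
  quo_scalar_monoid.

Fact quo_central (c : k) (u : quo_type) : quo_scalar c * u = u * quo_scalar c.
Proof.
elim/quo_ind: u => x; rewrite -[LHS]quo_piM -[RHS]quo_piM.
by rewrite -alg_scalerAl -alg_scalerAr mul1r mulr1.
Qed.

Definition quo_alg : algebra k := @Algebra k quo_type quo_scalar quo_central.

Definition quo_proj (x : A) : quo_alg := quo_pi x.

Lemma quo_projP x y : quo_proj x = quo_proj y <-> ideal_gen (x - y).
Proof. exact: quo_piP. Qed.

Lemma quo_projD x y : quo_proj (x + y) = quo_proj x + quo_proj y.
Proof. exact: quo_piD. Qed.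

Lemma quo_projM x y : quo_proj (x * y) = quo_proj x * quo_proj y.
Proof. exact: quo_piM. Qed.

Lemma quo_proj1 : quo_proj 1 = 1.
Proof. by []. Qed.

Lemma quo_proj_hom : alg_hom quo_proj.
Proof.
split=> [c x y|]; last by split=> // x y; exact: quo_piM.
rewrite [LHS]quo_piD; congr (_ + _).
by rewrite -{1}[x]mul1r alg_scalerAl; exact: quo_piM.
Qed.

Lemma quo_proj_surj (u : quo_alg) : exists x, quo_proj x = u.
Proof. by exists (quo_repr u); exact: quo_reprK. Qed.

End QuotientAlgebra.

Arguments quo_proj {k A} S x.

Definition presented (k : fieldType) (X : choiceType)
    (R : free_alg k X -> Prop) : algebra k := quo_alg R.

Definition presented_gen (k : fieldType) (X : choiceType)
    (R : free_alg k X -> Prop) (x : X) : presented R :=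
  quo_proj R (free_gen k x).

(* [e] is a complete family of orthogonal idempotents, that is, a homomorphism
   from [kQ_0] with [V = Q_0]. *)
Inductive idempotent_rel (k : fieldType) (A : algebra k) (V : finType)
    (e : V -> A) : A -> Prop :=
| idem_sqr i : idempotent_rel e (e i * e i - e i)
| idem_orth i j : i != j -> idempotent_rel e (e i * e j)
| idem_sum : idempotent_rel e (\sum_i e i - 1).

Section FreeProduct.
Variables (k : fieldType) (V : finType) (A B : algebra k).
Variables (eA : V -> A) (eB : V -> B).

Local Notation F := (free_alg k (alg_sort A + alg_sort B)%type).
Let gA (x : A) : F := free_gen k (inl x).
Let gB (y : B) : F := free_gen k (inr y).

Inductive free_prod_rel : F -> Prop :=
| fp_addA x y : free_prod_rel (gA (x + y) - (gA x + gA y))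
| fp_scaleA c x : free_prod_rel (gA (c *: x) - c *: gA x)
| fp_oneA : free_prod_rel (gA 1 - 1)
| fp_mulA x y : free_prod_rel (gA (x * y) - gA x * gA y)
| fp_addB x y : free_prod_rel (gB (x + y) - (gB x + gB y))
| fp_scaleB c x : free_prod_rel (gB (c *: x) - c *: gB x)
| fp_oneB : free_prod_rel (gB 1 - 1)
| fp_mulB x y : free_prod_rel (gB (x * y) - gB x * gB y)
| fp_base i : free_prod_rel (gA (eA i) - gB (eB i)).

Definition free_prod : algebra k := presented free_prod_rel.
Definition fp_inl (x : A) : free_prod := presented_gen free_prod_rel (inl x).
Definition fp_inr (y : B) : free_prod := presented_gen free_prod_rel (inr y).

End FreeProduct.

Section AlgebraB.
Variables (k : fieldType) (V : finType) (q : V -> k).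

Local Notation F := (free_alg k (V + bool)%type).
Let e (i : V) : F := free_gen k (inl i).
Let t : F := free_gen k (inr true).
Let u : F := free_gen k (inr false).
Let qt : F := \sum_i q i *: e i + t.

Inductive algB_rel : F -> Prop :=
| algB_idem z : idempotent_rel e z -> algB_rel z
| algB_comm i : algB_rel (t * e i - e i * t)
| algB_invr : algB_rel (qt * u - 1)
| algB_invl : algB_rel (u * qt - 1).

Definition algB : algebra k := presented algB_rel.
Definition algB_e (i : V) : algB := presented_gen algB_rel (inl i).
Definition algB_t : algB := presented_gen algB_rel (inr true).
Definition algB_bar (b : algB) : Prop := exists b', b = algB_t * b'.

End AlgebraB.

Section StrongFreeProduct.
Variables (k : fieldType) (V : finType) (q : V -> k).
Variables (L : algebra k) (e : V -> L) (r : L).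

Definition quo_by : algebra k := quo_alg (fun z : L => z = r).
Definition quo_by_proj (x : L) : quo_by := quo_proj (fun z : L => z = r) x.
Definition quo_by_e (i : V) : quo_by := quo_by_proj (e i).

Definition bimodule_section (sigma : quo_by -> L) : Prop :=
  [/\ linear sigma,
      forall i j x, sigma (quo_by_e i * x * quo_by_e j) = e i * sigma x * e j,
      sigma 1 = 1
    & forall x, quo_by_proj (sigma x) = x].

(* [tau] and [sigma'] are unique when they exist: [B] is generated by the [e_i],
   [t] and the inverse of [q + t], and the free product is spanned by the
   alternating products [a_0 b_1 a_1 ... b_n a_n]. *)
Definition strong_free_product (sigma : quo_by -> L) : Prop :=
  exists2 tau : algB q -> L,
    [/\ alg_hom tau, forall i, tau (algB_e q i) = e i & tau (algB_t q) = r]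
  & exists sigma' : free_prod quo_by_e (algB_e q) -> L,
    [/\ linear sigma',
        forall (a0 : quo_by) (w : seq (algB q * quo_by)),
          (forall i, (i < size w)%N -> algB_bar (nth (0, 0) w i).1) ->
          sigma' (fp_inl _ _ a0 * \prod_(p <- w) (fp_inr _ _ p.1 * fp_inl _ _ p.2))
          = sigma a0 * \prod_(p <- w) (tau p.1 * sigma p.2)
      & bijective sigma'].

End StrongFreeProduct.

Record quiver := Quiver {
  vertex : finType;
  arrow : finType;
  tail : arrow -> vertex;
  head : arrow -> vertex
}.

(* The arrows of the double: [(a, true)] is [a] and [(a, false)] is [a^*]. *)
Definition dart (Q : quiver) : Type := (arrow Q * bool)%type.

Section Double.
Variable Q : quiver.
Implicit Types (d : dart Q) (v w : vertex Q).

Definition star d : dart Q := (d.1, ~~ d.2).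
Definition dtail d : vertex Q := if d.2 then tail d.1 else head d.1.
Definition dhead d : vertex Q := if d.2 then head d.1 else tail d.1.

Definition adjacent v w : bool :=
  [exists d : dart Q, (dtail d == v) && (dhead d == w)].
Definition connected : Prop := forall v w, connect adjacent v w.

Definition path_from_to v (p : seq (dart Q)) w : bool :=
  if p is d :: p' then
    [&& dtail d == v, sorted (fun d1 d2 => dhead d1 == dtail d2) p
      & dhead (last d p') == w]
  else v == w.

(* An orientation of the underlying graph; [eps] selects the arrows of the
   oriented quiver among those of the double. *)
Definition orientation (eps : dart Q -> bool) : Prop :=
  forall d, eps (star d) = ~~ eps d.

(* A total order on the finite set of darts, listed increasingly. *)
Definition total_order (s : seq (dart Q)) : Prop :=
  perm_eq s (enum {: dart Q}).

(* A subquiver isomorphic to some orientation of the n-cycle, traversed once: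
   the i-th dart leads from the i-th vertex to the next. The condition on
   underlying arrows matters for n = 2 only. *)
Definition is_cycle n (c : 'I_n -> dart Q) : Prop :=
  [/\ injective (fun i => dtail (c i)),
      injective (fun i => (c i).1)
    & forall i, dhead (c i) = dtail (c (ordS i))].

Definition on_cycle n (c : 'I_n -> dart Q) v : bool :=
  [exists i, dtail (c i) == v].

Definition off_cycle n (c : 'I_n -> dart Q) d : bool :=
  [forall i, (c i).1 != d.1].

Definition cycle_order n (c : 'I_n -> dart Q) : seq (dart Q) :=
  [seq c i | i <- enum 'I_n] ++ [seq star (c i) | i <- enum 'I_n].

(* [F] consists of arrows outside the cycle, and each vertex is joined to the
   cycle by exactly one directed path in [F] (the empty one for the roots). *)
Definition spanning_forest n (c : 'I_n -> dart Q) (F : {set dart Q}) : Prop :=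
  {in F, forall d, off_cycle c d} /\
  forall v, exists! p : seq (dart Q),
    all (mem F) p /\ exists2 w, on_cycle c w & path_from_to v p w.

End Double.

Section AlgebraL.
Variables (k : fieldType) (Q : quiver).

(* Generators: the [e_i], the arrows of the double, and a formal inverse of
   [1 + a a^*] for each arrow [a] of the double. *)
Local Notation F := (free_alg k (vertex Q + (dart Q + dart Q))%type).
Let e (i : vertex Q) : F := free_gen k (inl i).
Let arr (d : dart Q) : F := free_gen k (inr (inl d)).
Let inv (d : dart Q) : F := free_gen k (inr (inr d)).

Inductive algL_rel : F -> Prop :=
| algL_idem z : idempotent_rel e z -> algL_rel z
| algL_tail d : algL_rel (e (dtail d) * arr d - arr d)
| algL_head d : algL_rel (arr d * e (dhead d) - arr d)
| algL_invr d : algL_rel ((1 + arr d * arr (star d)) * inv d - 1)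
| algL_invl d : algL_rel (inv d * (1 + arr d * arr (star d)) - 1).

Definition algL : algebra k := presented algL_rel.
Definition Le (i : vertex Q) : algL := presented_gen algL_rel (inl i).
Definition La (d : dart Q) : algL := presented_gen algL_rel (inr (inl d)).
Definition Linv (d : dart Q) : algL := presented_gen algL_rel (inr (inr d)).

(* [1 + a a^*] for [true], its inverse for [false]. *)
Definition Lx (d : dart Q) (s : bool) : algL :=
  if s then 1 + La d * La (star d) else Linv d.

Lemma LxK d s : Lx d s * Lx d (~~ s) = 1.
Proof.
have Lx1 : Lx d true = quo_proj algL_rel (1 + arr d * arr (star d)).
  by rewrite quo_projD quo_projM quo_proj1.
rewrite -(quo_proj1 algL_rel).
case: s; rewrite /= [1 + _]Lx1 -quo_projM; apply/quo_projP; apply: ideal_gen_in.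
  exact: algL_invr.
exact: algL_invl.
Qed.

Variables (eps : dart Q -> bool) (s : seq (dart Q)) (q : vertex Q -> k).

Definition Lq : algL := \sum_i q i *: Le i.
Definition Lqinv : algL := \sum_i (q i)^-1 *: Le i.

Definition rho : algL := \prod_(d <- s) Lx d (eps d).
Definition rho_inv : algL := \prod_(d <- rev s) Lx d (~~ eps d).

Lemma rho_mulV : rho * rho_inv = 1.
Proof.
rewrite /rho /rho_inv; elim: s => [|d s' IH]; first by rewrite !big_nil mulr1.
rewrite rev_cons big_rcons /= big_cons -mulrA [X in _ * X]mulrA IH mul1r.
exact: LxK.
Qed.

Lemma rho_mulVr : rho_inv * rho = 1.
Proof.
rewrite /rho /rho_inv; elim: s => [|d s' IH]; first by rewrite !big_nil mulr1.
rewrite rev_cons big_rcons /= big_cons -mulrA [X in _ * X]mulrA.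
by rewrite -{2}[eps d]negbK LxK mul1r IH.
Qed.

(* [r] and [r' = (q + r)^-1 - q^-1], where [q + r = rho]. *)
Definition Lr : algL := rho - Lq.
Definition Lr' : algL := rho_inv - Lqinv.

Definition mult_preproj : algebra k := quo_by Lr.

End AlgebraL.

(* [Arr a] is the letter [a]; [Xbar a true] and [Xbar a false] are the letters
   for [e_{t(a)} ((1 + a a^* )^{s} - 1)] with [s = 1] and [s = -1]. *)
Inductive letter (Q : quiver) : Type :=
| Arr of dart Q
| Xbar of dart Q & bool.

Section Words.
Variables (k : fieldType) (Q : quiver) (n : nat) (c : 'I_n -> dart Q).
Variable F : {set dart Q}.

Definition letter_dart (l : letter Q) : dart Q :=
  match l with Arr d => d | Xbar d _ => d end.

Definition letter_tail (l : letter Q) : vertex Q := dtail (letter_dart l).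

Definition letter_head (l : letter Q) : vertex Q :=
  match l with Arr d => dhead d | Xbar d _ => dtail d end.

Definition letter_val (l : letter Q) : algL k Q :=
  match l with
  | Arr d => La k d
  | Xbar d s => Le k (dtail d) * (Lx k d s - 1)
  end.

Inductive forbidden : seq (letter Q) -> Prop :=
| forb_xx d s : forbidden [:: Xbar d s; Xbar d (~~ s)]
| forb_aa d : forbidden [:: Arr d; Arr (star d)]
| forb_ax d s : forbidden [:: Arr d; Xbar (star d) s]
| forb_Fx d s : d \in F -> forbidden [:: Xbar d s]
| forb_Fxinv d : d \in F -> forbidden [:: Xbar (star d) false]
| forb_Fxa d : d \in F -> forbidden [:: Xbar (star d) true; Arr (star d)]
| forb_Fxx d : d \in F -> forbidden [:: Xbar (star d) true; Xbar (star d) true].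

(* The admissible words of positive length; those of length zero are the
   [e_i]. *)
Definition admissible (w : seq (letter Q)) : Prop :=
  [/\ w <> [::],
      all (fun l => off_cycle c (letter_dart l)) w,
      sorted (fun l1 l2 => letter_head l1 == letter_tail l2) w
    & forall u f v, w = u ++ f ++ v -> ~ forbidden f].

Definition La_cyc : algL k Q := \sum_i La k (c i).
Definition La_cyc_star : algL k Q := \sum_i La k (star (c i)).
Definition L1W : algL k Q := \sum_i Le k (dtail (c i)).
Definition Lxcyc : algL k Q := L1W + La_cyc * La_cyc_star.

(* The inverse of [x] in the corner [1_W L 1_W]. *)
Definition Lxcyc_inv : algL k Q := \sum_i Le k (dtail (c i)) * Linv k (c i).

(* [x^m] and [(x^{+-1} - 1)^{|m|}], up to the unit: the zeroth power is the
   unit of [L], to be multiplied by some [e_i] with [i] on the cycle. *)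
Definition xpow (m : int) : algL k Q :=
  match m with
  | Posz p => Lxcyc ^+ p
  | Negz p => Lxcyc_inv ^+ p.+1
  end.

Definition xpow' (m : int) : algL k Q :=
  match m with
  | Posz p => (Lxcyc - L1W) ^+ p
  | Negz p => (Lxcyc_inv - L1W) ^+ p.+1
  end.

(* [a^l] for [l >= 0] and [(a^* )^{-l}] for [l < 0]. *)
Definition apow (l : int) : algL k Q :=
  match l with
  | Posz p => La_cyc ^+ p
  | Negz p => La_cyc_star ^+ p.+1
  end.

Definition cyc_shift (i : 'I_n) (l : int) : 'I_n :=
  match l with
  | Posz p => iter p (@ordS n) i
  | Negz p => iter p.+1 (@ord_pred n) i
  end.

(* [FCyc i m l] stands for [e_i x^m a^l] (or its variant), with the above
   conventions for negative exponents; [FAdm w] for an admissible word; [FR i m]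
   for [e_i r^m] if [m > 0] and [e_i r'^{-m}] if [m < 0]. *)
Inductive factor : Type :=
| FCyc of 'I_n & int & int
| FAdm of letter Q & seq (letter Q)
| FR of vertex Q & int.

Definition factor_ok (f : factor) : Prop :=
  match f with
  | FCyc _ m l => ~ (m = 0 /\ l = 0)
  | FAdm d w => admissible (d :: w)
  | FR _ m => m <> 0
  end.

Definition factor_family (f : factor) : nat :=
  match f with
  | FCyc _ _ _ => 0%N
  | FAdm _ _ => 1%N
  | FR _ _ => 2%N
  end.

Definition factor_tail (f : factor) : vertex Q :=
  match f with
  | FCyc i _ _ => dtail (c i)
  | FAdm d _ => letter_tail d
  | FR v _ => v
  end.

Definition factor_head (f : factor) : vertex Q :=
  match f with
  | FCyc i _ l => dtail (c (cyc_shift i l))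
  | FAdm d w => letter_head (last d w)
  | FR v _ => v
  end.

Variables (xp : int -> algL k Q) (r r' : algL k Q).

Definition factor_val (f : factor) : algL k Q :=
  match f with
  | FCyc i m l => Le k (dtail (c i)) * xp m * apow l
  | FAdm d w => \prod_(d' <- d :: w) letter_val d'
  | FR v (Posz p) => Le k v * r ^+ p
  | FR v (Negz p) => Le k v * r' ^+ p.+1
  end.

Inductive basis_word : Type :=
| Idem of vertex Q
| Alt of seq factor.

Definition basis_word_ok (b : basis_word) : Prop :=
  match b with
  | Idem _ => True
  | Alt w =>
    [/\ w <> [::],
        forall u f v, w = u ++ f :: v -> factor_ok f,
        sorted (fun f1 f2 => factor_head f1 == factor_tail f2) w
      & sorted (fun f1 f2 => factor_family f1 != factor_family f2) w]
  end.

Definition basis_word_val (b : basis_word) : algL k Q :=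
  match b with
  | Idem v => Le k v
  | Alt w => \prod_(f <- w) factor_val f
  end.

End Words.

Definition is_basis (k : fieldType) (M : lmodType k) (I : Type)
    (P : I -> Prop) (v : I -> M) : Prop :=
  (forall x : M, exists m (f : 'I_m -> I) (a : 'I_m -> k),
     (forall j, P (f j)) /\ x = \sum_j a j *: v (f j)) /\
  (forall m (f : 'I_m -> I) (a : 'I_m -> k),
     injective f -> (forall j, P (f j)) ->
     \sum_j a j *: v (f j) = 0 -> forall j, a j = 0).

(* Main.v *)
(* Write the alternating products of the basis as words in single letters: the
   arrows, (1 + d d^* )^{+-1} - 1, x^{+-1} - delta on the cycle (delta = 0 or 1
   for the two bases), and r, r'. Such a word is normal if
   finitely many patterns of two adjacent letters do not occur in it. On the free
   module M on the normal words (with end point), L acts so that a letter in front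
   of a normal word is prepended whenever the result is normal: at a vertex off
   the cycle the unit 1 + a a^* of its forest arrow a is solved from the equation
   for rho, by recursion on the depth, and on the cycle the arrows are twisted so
   as to make x and its conjugate under a have the quotient prescribed by rho.
   Evaluating words, theta : M -> L intertwines this action with left
   multiplication, so theta is bijective; this is the basis.

   The same construction works with any prescribed action of rho. If rho acts by
   q, the action factors through Lambda^q; together with the action of
   B through L it makes M a module over the free product. The section and sigma'
   are a |-> theta(a 1) and g |-> theta(g 1), where 1 is the sum of the empty
   words, and the inverse of sigma' evaluates the words in the free product. Other
   orders and orientations are reached by automorphisms of L fixing the e_i. *)
Require Import Defs.
From HB Require Import structures.
From mathcomp Require Import all_boot all_order all_algebra.
From mathcomp Require Import boolp.
From mathcomp Require Import finmap.
From mathcomp.multinomials Require Import monalg.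

Set Implicit Arguments.
Unset Strict Implicit.
Unset Printing Implicit Defensive.

Import GRing.Theory.
Local Open Scope ring_scope.

(** * Homomorphisms, endomorphisms and presentations *)

(** Acting on normal words takes the place of a confluence check: the relations of [L] become
    identities between operators, each defined by recursion on words. The difficulty is that [rho]
    is a product of units and must nevertheless become a letter of its own. At a vertex off the
    cycle one unit is given up in exchange, which is why the arrows of the forest have patterns of
    their own. On the cycle [x] must keep its letters, and only the unit of [c_i^*] can be expressed
    by the others: at the head of [c_i] the product [rho] equals [x u^-1 rho'], where
    [u = 1 + c_i^* c_i] and [rho'] comes from the arrows off the cycle, so [u = rho' rho^-1 x]. The
    naive operators for the arrows yield [u = x]; they are corrected by an operator that turns [x]
    into [rho' rho^-1 x]. This operator can be inverted explicitly because [rho' rho^-1] is the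
    scalar [q^-1] up to terms that write no power of [x] in front of a word. Here the invertibility
    of [q] enters, and for this the letters of [rho] and [rho^-1] are shifted by [q] and [q^-1]. *)

Section LinearProp.
Variables (k : fieldType) (U V : lmodType k) (f : U -> V).
Hypothesis lf : linear f.

Let g : {linear U -> V} := HB.pack f (GRing.isLinear.Build k U V _ f lf).

Lemma lin0 : f 0 = 0. Proof. exact: (raddf0 g). Qed.
Lemma linD x y : f (x + y) = f x + f y. Proof. exact: (raddfD g). Qed.
Lemma linN x : f (- x) = - f x. Proof. exact: (raddfN g). Qed.
Lemma linB x y : f (x - y) = f x - f y. Proof. exact: (raddfB g). Qed.
Lemma linZ c x : f (c *: x) = c *: f x. Proof. exact: (linearZ_LR g). Qed.
Lemma lin_sum I (r : seq I) (P : pred I) F :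
  f (\sum_(i <- r | P i) F i) = \sum_(i <- r | P i) f (F i).
Proof. exact: (raddf_sum g). Qed.
End LinearProp.

Lemma linear_comp (k : fieldType) (U V W : lmodType k) (f : V -> W) (g : U -> V) :
  linear f -> linear g -> linear (fun x => f (g x)).
Proof. by move=> lf lg c x y; rewrite lg lf. Qed.

Section AlgHom.
Variables (k : fieldType) (A B : algebra k) (f : A -> B).
Hypothesis hf : alg_hom f.

Lemma hom_lin : linear f. Proof. by case: hf. Qed.
Lemma hom1 : f 1 = 1. Proof. by case: hf => _ []. Qed.
Lemma homM x y : f (x * y) = f x * f y. Proof. by case: hf => _ []. Qed.
Lemma hom0 : f 0 = 0. Proof. exact: (lin0 hom_lin). Qed.
Lemma homD x y : f (x + y) = f x + f y. Proof. exact: (linD hom_lin). Qed.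
Lemma homB x y : f (x - y) = f x - f y. Proof. exact: (linB hom_lin). Qed.
Lemma homN x : f (- x) = - f x. Proof. exact: (linN hom_lin). Qed.
Lemma homZ c x : f (c *: x) = c *: f x. Proof. exact: (linZ hom_lin). Qed.
Lemma hom_sum I (r : seq I) (P : pred I) F :
  f (\sum_(i <- r | P i) F i) = \sum_(i <- r | P i) f (F i).
Proof. exact: (lin_sum hom_lin). Qed.
Lemma hom_prod I (r : seq I) (P : pred I) F :
  f (\prod_(i <- r | P i) F i) = \prod_(i <- r | P i) f (F i).
Proof. by apply: big_morph; [exact: homM | exact: hom1]. Qed.
End AlgHom.

Lemma alg_hom_comp (k : fieldType) (A B C : algebra k) (f : B -> C) (g : A -> B) :
  alg_hom f -> alg_hom g -> alg_hom (fun x => f (g x)).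
Proof.
move=> hf hg; split; first exact: linear_comp (hom_lin hf) (hom_lin hg).
by split=> [|x y]; rewrite ?(hom1 hg) ?(hom1 hf) // (homM hg) (homM hf).
Qed.

Section FreeModule.
Variables (k : fieldType) (K : choiceType) (V : lmodType k).
Implicit Types (f : K -> V) (g : {malg k[K]}).

Definition mlin f g : V := \sum_(w <- msupp g) g@_w *: f w.

Lemma mlinEw f g (d : {fset K}) : (msupp g `<=` d)%fset ->
  mlin f g = \sum_(w <- d) g@_w *: f w.
Proof.
move=> le; rewrite [LHS](big_fset_incl _ le) => //= x xd /mcoeff_outdom ->.
by rewrite scale0r.
Qed.

Lemma mlin_linear f : linear (mlin f).
Proof.
move=> c g1 g2.
pose d := (msupp g1 `|` msupp g2)%fset.
have le1 : (msupp g1 `<=` d)%fset by exact: fsubsetUl.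
have le2 : (msupp g2 `<=` d)%fset by exact: fsubsetUr.
rewrite (mlinEw _ le1) (mlinEw _ le2) (@mlinEw _ _ d); last first.
  apply: (fsubset_trans (msuppD_le _ _)); rewrite fsubUset le2 andbT.
  exact: fsubset_trans (msuppZ_le _ _) le1.
rewrite scaler_sumr -big_split /=; apply: eq_bigr => w _.
by rewrite mcoeffD mcoeffZ scalerDl scalerA.
Qed.

Lemma mlinU f w : mlin f << w >> = f w.
Proof. by rewrite (mlinEw _ msuppU_le) big_seq_fset1 mcoeffUU scale1r. Qed.

Lemma malg_ext (f1 f2 : {malg k[K]} -> V) : linear f1 -> linear f2 ->
  (forall w, f1 << w >> = f2 << w >>) -> f1 =1 f2.
Proof.
move=> l1 l2 e g; rewrite (monalgE g) (lin_sum l1) (lin_sum l2).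
apply: eq_bigr => w _.
have -> : << g@_w *g w >> = g@_w *: << w >> :> {malg k[K]}.
  by apply/malgP=> u; rewrite mcoeffZ !mcoeffU mulrnAr mulr1.
by rewrite (linZ l1) (linZ l2) e.
Qed.
End FreeModule.

Section EndAlgebra.
Variables (k : fieldType) (M : lmodType k).

Record endo := Endo { eapp :> M -> M; eapp_linear : linear eapp }.

Lemma endoP (f g : endo) : f =1 g -> f = g.
Proof.
case: f g => [f lf] [g lg] /= /funext e; rewrite e in lf *.
by rewrite (Prop_irrelevance lf lg).
Qed.

HB.instance Definition _ := gen_eqMixin endo.
HB.instance Definition _ := gen_choiceMixin endo.

Fact endo_add_subproof (f g : endo) : linear (fun x => f x + g x).
Proof.
by move=> c x y; rewrite !(eapp_linear _ c) scalerDr addrACA.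
Qed.
Fact endo_opp_subproof (f : endo) : linear (fun x => - f x).
Proof. by move=> c x y; rewrite (eapp_linear _ c) opprD scalerN. Qed.
Fact endo_zero_subproof : linear (fun _ : M => 0 : M).
Proof. by move=> c x y; rewrite scaler0 addr0. Qed.
Fact endo_one_subproof : linear (fun x : M => x).
Proof. by []. Qed.
Fact endo_scale_subproof (c : k) : linear (fun x : M => c *: x).
Proof. by move=> d x y; rewrite scalerDr !scalerA mulrC. Qed.

Definition endo_add f g := Endo (endo_add_subproof f g).
Definition endo_opp f := Endo (endo_opp_subproof f).
Definition endo_zero := Endo endo_zero_subproof.
Definition endo_one := Endo endo_one_subproof.
Definition endo_mul (f g : endo) :=
  Endo (linear_comp (eapp_linear f) (eapp_linear g)).
Definition endo_scale (c : k) := Endo (endo_scale_subproof c).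

Fact endo_addA : associative endo_add.
Proof. by move=> f g h; apply: endoP => x /=; rewrite addrA. Qed.
Fact endo_addC : commutative endo_add.
Proof. by move=> f g; apply: endoP => x /=; rewrite addrC. Qed.
Fact endo_add0 : left_id endo_zero endo_add.
Proof. by move=> f; apply: endoP => x /=; rewrite add0r. Qed.
Fact endo_addN : left_inverse endo_zero endo_opp endo_add.
Proof. by move=> f; apply: endoP => x /=; rewrite addNr. Qed.
HB.instance Definition _ := GRing.isZmodule.Build endo
  endo_addA endo_addC endo_add0 endo_addN.

Fact endo_mulA : associative endo_mul.
Proof. by move=> f g h; apply: endoP. Qed.
Fact endo_mul1l : left_id endo_one endo_mul.
Proof. by move=> f; apply: endoP. Qed.
Fact endo_mul1r : right_id endo_one endo_mul.
Proof. by move=> f; apply: endoP. Qed.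
Fact endo_mulDl : left_distributive endo_mul +%R.
Proof. by move=> f g h; apply: endoP. Qed.
Fact endo_mulDr : right_distributive endo_mul +%R.
Proof.
by move=> f g h; apply: endoP => x /=; rewrite (linD (eapp_linear f)).
Qed.
HB.instance Definition _ := GRing.Zmodule_isPzRing.Build endo
  endo_mulA endo_mul1l endo_mul1r endo_mulDl endo_mulDr.

Fact endo_scale_zmod : zmod_morphism endo_scale.
Proof. by move=> a b; apply: endoP => x /=; rewrite scalerBl. Qed.
Fact endo_scale_monoid : monoid_morphism endo_scale.
Proof.
split; first by apply: endoP => x /=; rewrite scale1r.
by move=> a b; apply: endoP => x /=; rewrite scalerA.
Qed.
HB.instance Definition _ := GRing.isZmodMorphism.Build k endo endo_scale
  endo_scale_zmod.
HB.instance Definition _ := GRing.isMonoidMorphism.Build k endo endo_scale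
  endo_scale_monoid.

Fact endo_central (c : k) (f : endo) : endo_scale c * f = f * endo_scale c.
Proof. by apply: endoP => x /=; rewrite (linZ (eapp_linear f)). Qed.

Definition End : algebra k := @Algebra k endo endo_scale endo_central.

Definition ap (f : End) : M -> M := eapp f.

Lemma End_ext (f g : End) : ap f =1 ap g -> f = g. Proof. exact: endoP. Qed.
Lemma ap_linear f : linear (ap f). Proof. exact: eapp_linear. Qed.
Lemma apM (f g : End) x : ap (f * g) x = ap f (ap g x). Proof. by []. Qed.
Lemma apD (f g : End) x : ap (f + g) x = ap f x + ap g x. Proof. by []. Qed.
Lemma apB (f g : End) x : ap (f - g) x = ap f x - ap g x. Proof. by []. Qed.
Lemma ap1 x : ap 1 x = x. Proof. by []. Qed.
Lemma ap0 x : ap 0 x = 0. Proof. by []. Qed.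
Lemma apZ (c : k) f x : ap (c *: f) x = c *: ap f x. Proof. by []. Qed.
Lemma ap_sum I (r : seq I) (P : pred I) (F : I -> End) x :
  ap (\sum_(i <- r | P i) F i) x = \sum_(i <- r | P i) ap (F i) x.
Proof. by elim/big_rec2: _ => // i y1 y2 _ <-. Qed.

Definition mkEnd (f : M -> M) (lf : linear f) : End := Endo lf.
End EndAlgebra.

#[global] Arguments ap : simpl never.

Lemma ap_in0 (k : fieldType) (M : lmodType k) (f : End M) : ap f 0 = 0.
Proof. exact: (lin0 (ap_linear f)). Qed.
Lemma ap_inD (k : fieldType) (M : lmodType k) (f : End M) x y :
  ap f (x + y) = ap f x + ap f y.
Proof. exact: (linD (ap_linear f)). Qed.
Lemma ap_inB (k : fieldType) (M : lmodType k) (f : End M) x y :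
  ap f (x - y) = ap f x - ap f y.
Proof. exact: (linB (ap_linear f)). Qed.
Lemma ap_inZ (k : fieldType) (M : lmodType k) (f : End M) c x :
  ap f (c *: x) = c *: ap f x.
Proof. exact: (linZ (ap_linear f)). Qed.

Section Presented.
Variables (k : fieldType) (X : choiceType).

(** The scaling of an [algebra] is multiplication by a central scalar; [mlin] is linear for the
    native scaling of the monoid algebra, and the two agree. *)
Lemma free_scaleE (c : k) (x : free_alg k X) :
  c *: x = (c *: (x : {malg k[{fmonom X}]}) : {malg k[{fmonom X}]}).
Proof. exact: mul_malgC. Qed.

Variable A : algebra k.

Definition free_lift (g : X -> A) : free_alg k X -> A :=
  mlin (fun w : {fmonom X} => \prod_(i <- (w : seq X)) g i).

Lemma free_lift_linear g : linear (free_lift g).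
Proof.
by move=> c x y; rewrite free_scaleE; exact: mlin_linear.
Qed.

Lemma free_liftU g (w : {fmonom X}) :
  free_lift g << w >> = \prod_(i <- (w : seq X)) g i.
Proof. exact: mlinU. Qed.

Lemma malg_lin_free (V : lmodType k) (f : free_alg k X -> V) :
  linear f -> linear (f : {malg k[{fmonom X}]} -> V).
Proof. by move=> lf c x y; rewrite -lf free_scaleE. Qed.

(** By linearity in each argument, multiplicativity is reduced to monomials, where it is
    concatenation of words. *)
Lemma free_lift_hom g : alg_hom (free_lift g).
Proof.
split; first exact: free_lift_linear.
split; first by rewrite [LHS]free_liftU fm1 big_nil.
have L := free_lift_linear g.
move=> x y.
suff : (fun y => free_lift g (x * y)) =1 (fun y => free_lift g x * free_lift g y).
  exact.
apply: malg_ext; try apply: malg_lin_free.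
- move=> c u v; rewrite mulrDr (linD L); congr (_ + _).
  by rewrite -(linZ L) alg_scalerAr.
- by move=> c u v; rewrite L mulrDr alg_scalerAr.
move=> w; suff : (fun x => free_lift g (x * << w >>)) =1
  (fun x => free_lift g x * free_lift g << w >>) by exact.
apply: malg_ext; try apply: malg_lin_free.
- move=> c u v; rewrite mulrDl (linD L); congr (_ + _).
  by rewrite -(linZ L) alg_scalerAl.
- by move=> c u v; rewrite L mulrDl alg_scalerAl.
move=> v.
have -> : << v >> * << w >> = << mmul v w >> :> {malg k[{fmonom X}]}.
  by rewrite malgM_def fgmulUU mulr1.
by rewrite !free_liftU fmM big_cat.
Qed.

Lemma free_lift_gen g x : free_lift g (free_gen k x) = g x.
Proof. by rewrite [LHS]free_liftU fmU big_seq1. Qed.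

Variable R : free_alg k X -> Prop.

Lemma ideal_hom0 (B C : algebra k) (S : B -> Prop) (f : B -> C) : alg_hom f ->
  (forall z, S z -> f z = 0) -> forall z, ideal_gen S z -> f z = 0.
Proof.
move=> hf fS z; elim=> {z} [z /fS //||x y _ ex _ ey|a x _ ex|a x _ ex].
- exact: (hom0 hf).
- by rewrite (homD hf) ex ey addr0.
- by rewrite (homM hf) ex mulr0.
- by rewrite (homM hf) ex mul0r.
Qed.

Section QuoLift.
Variables (B C : algebra k) (S : B -> Prop) (f : B -> C).
Hypotheses (hf : alg_hom f) (fS : forall z, S z -> f z = 0).

(** Defined through a chosen representative; [quo_lift_proj] shows that the choice does not
    matter. *)
Definition quo_lift (x : quo_alg S) : C := f (quo_repr x).

Lemma quo_lift_proj x : quo_lift (quo_proj S x) = f x.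
Proof.
apply/eqP; rewrite -subr_eq0 -(homB hf); apply/eqP/(ideal_hom0 hf fS).
by apply/quo_projP; exact: quo_reprK.
Qed.

Lemma quo_lift_hom : alg_hom quo_lift.
Proof.
have [lp [p1 pM]] := quo_proj_hom S.
split=> [c x y|].
  have [u <-] := quo_proj_surj x; have [v <-] := quo_proj_surj y.
  by rewrite -lp !quo_lift_proj (hom_lin hf).
split; first by rewrite -p1 quo_lift_proj (hom1 hf).
move=> x y; have [u <-] := quo_proj_surj x; have [v <-] := quo_proj_surj y.
by rewrite -pM !quo_lift_proj (homM hf).
Qed.
End QuoLift.

End Presented.

Section PresentedInd.
Variables (k : fieldType) (X : choiceType) (R : free_alg k X -> Prop).

Lemma presented_ind (P : presented R -> Prop) :
  (forall c x y, P x -> P y -> P (c *: x + y)) -> P 1 ->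
  (forall x y, P x -> P y -> P (x * y)) ->
  (forall x, P (presented_gen R x)) -> forall z, P z.
Proof.
move=> PL P1 PM Pg z; have [x <-] := quo_proj_surj z.
have [lp [p1 pM]] := quo_proj_hom R.
have P0 : P 0 by have := PL (-1) _ _ P1 P1; rewrite scaleN1r addNr.
have lq : linear (quo_proj R : {malg k[{fmonom X}]} -> presented R).
  exact: malg_lin_free.
rewrite (monalgE x) (lin_sum lq); elim/big_rec: _ => // w y _ Py.
have -> : << x@_w *g w >> = x@_w *: << w >> :> {malg k[{fmonom X}]}.
  by apply/malgP=> u; rewrite mcoeffZ !mcoeffU mulrnAr mulr1.
rewrite (linZ lq); apply: PL => //.
case: w => s; elim: s => [|i s IH].
  have -> : << FMonom [::] >> = 1 :> free_alg k X by rewrite -fmoneE.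
  by rewrite p1.
have -> : << FMonom (i :: s) >> = free_gen k i * << FMonom s >> :> free_alg k X.
  rewrite [RHS]malgM_def fgmulUU mulr1; congr << _ >>.
  by apply/eqP; rewrite fmP fmM fmU.
by rewrite pM; apply: PM => //; exact: Pg.
Qed.

End PresentedInd.

(** * Normal words and the module on them *)

Lemma starK (Q : quiver) : involutive (@star Q).
Proof. by case=> a b; rewrite /star /= negbK. Qed.

Lemma dtail_star (Q : quiver) (d : dart Q) : dtail (star d) = dhead d.
Proof. by case: d => a []. Qed.

Lemma dhead_star (Q : quiver) (d : dart Q) : dhead (star d) = dtail d.
Proof. by case: d => a []. Qed.

Lemma star_neq (Q : quiver) (d : dart Q) : (star d == d) = false.
Proof. by case: d => a []; rewrite /star /eq_op /= andbF. Qed.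

Lemma star_eq (Q : quiver) (d b : dart Q) : (star d == b) = (d == star b).
Proof. by rewrite -{1}[b]starK (inj_eq (inv_inj (@starK Q))). Qed.

#[global] Arguments dtail : simpl never.
#[global] Arguments dhead : simpl never.
#[global] Arguments star : simpl never.

Section Letters.
Variable Q : quiver.

(* [KR v], [KX d], [KC v] index the units [rho] at [v], [1 + d d^*], and [x] at
   the vertex [v] of the cycle; [LU kappa s] stands for the unit (or, if [s] is
   [false], its inverse) minus the constant [cst kappa s] below. *)
Inductive kind : Type := KR of vertex Q | KX of dart Q | KC of vertex Q.

Definition kind_code (x : kind) : (vertex Q + dart Q) + vertex Q :=
  match x with KR v => inl (inl v) | KX d => inl (inr d) | KC v => inr v end.
Definition kind_decode (x : (vertex Q + dart Q) + vertex Q) : kind :=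
  match x with inl (inl v) => KR v | inl (inr d) => KX d | inr v => KC v end.
Fact kind_codeK : cancel kind_code kind_decode. Proof. by case. Qed.
HB.instance Definition _ := Choice.copy kind (can_type kind_codeK).

Inductive lett : Type := LA of dart Q | LU of kind & bool.

Definition lett_code (x : lett) : dart Q + kind * bool :=
  match x with LA d => inl d | LU kp s => inr (kp, s) end.
Definition lett_decode (x : dart Q + kind * bool) : lett :=
  match x with inl d => LA d | inr (kp, s) => LU kp s end.
Fact lett_codeK : cancel lett_code lett_decode. Proof. by case. Qed.
HB.instance Definition _ := Choice.copy lett (can_type lett_codeK).

Lemma eq_KX d d' : (KX d == KX d') = (d == d').
Proof. by []. Qed.
Definition kvert (kp : kind) : vertex Q :=
  match kp with KR v => v | KX d => dtail d | KC v => v end.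
Definition ltl (l : lett) : vertex Q :=
  match l with LA d => dtail d | LU kp _ => kvert kp end.
Definition lhd (l : lett) : vertex Q :=
  match l with LA d => dhead d | LU kp _ => kvert kp end.

Definition st (j : vertex Q) (w : seq lett) : vertex Q :=
  if w is l :: _ then ltl l else j.

End Letters.

Section Words.
Variables (k : fieldType) (Q : quiver) (n : nat) (c : 'I_n -> dart Q).
Variables (F : {set dart Q}) (q : vertex Q -> k) (dlt : k).

Local Notation V := (vertex Q).
Local Notation word := (seq (lett Q)).
Implicit Types (j v : V) (w : word) (s : bool) (d : dart Q) (l : lett Q).
Implicit Types (kp : kind Q).

(** The letter to which the unit of [d] belongs. At a vertex of the cycle the two darts of the cycle
    that start there share the letter of [x]. *)
Definition kap d : kind Q := if off_cycle c d then KX d else KC (dtail d).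

Lemma kapE d : kap d = if off_cycle c d then KX d else KC (dtail d).
Proof. by []. Qed.

Lemma kvert_kap d : kvert (kap d) = dtail d.
Proof. by rewrite /kap; case: ifP. Qed.

(* The conditions on letters and on adjacent letters which define admissible words
   and, for [KR] and [KC], exclude the product of a unit and its inverse. *)
Definition lokU kp s : bool :=
  match kp with
  | KR _ => true
  | KX d => [&& off_cycle c d, d \notin F & (star d \in F) ==> s]
  | KC v => on_cycle c v
  end.
Definition lok l : bool := if l is LU kp s then lokU kp s else true.

(** Singles out the duals of forest arrows, for which a repeated letter and a letter followed by its
    arrow are patterns too. *)
Definition kF kp : bool := if kp is KX d then star d \in F else false.

(** On the cycle, [kap] turns the pattern [a x_{a^*}] into an arrow followed by a letter of [x].
    This drives all powers of [x] to the front, as in [e_i x^m a^l]. *)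
Definition bad l1 l2 : bool :=
  match l1, l2 with
  | LU kp s, LU kp' s' => (kp == kp') && ((s' != s) || kF kp)
  | LA d, LA d' => d' == star d
  | LA d, LU kp _ => kp == kap (star d)
  | LU kp _, LA d => (kp == KX d) && kF kp
  end.

Definition compat j l w : bool :=
  (lhd l == st j w) && (if w is l' :: _ then ~~ bad l l' else true).

Fixpoint nf j w : bool :=
  if w is l :: w' then [&& lok l, compat j l w' & nf j w'] else true.

(** The end point is recorded because an empty word does not determine a vertex; for other words
    [nf] forces it to be the head of the last letter. *)
Definition windex : Type := {p : word * V | nf p.2 p.1}.
HB.instance Definition _ := SubChoice.on windex.

Record wmodule := WModule {
  wm_mod : lmodType k;
  wm_bv : V -> word -> wm_mod;
  wm_lift : forall V' : lmodType k, (V -> word -> V') -> wm_mod -> V';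
  wm_linear : forall (V' : lmodType k) (f : V -> word -> V'), linear (wm_lift f);
  wm_liftE : forall (V' : lmodType k) (f : V -> word -> V') j w,
    nf j w -> wm_lift f (wm_bv j w) = f j w;
  wm_ind : forall P : wm_mod -> Prop,
    (forall a x y, P x -> P y -> P (a *: x + y)) -> P 0 ->
    (forall j w, nf j w -> P (wm_bv j w)) -> forall x, P x
}.

(* Kept opaque, as unification would otherwise compute in the free module. *)
Fact word_module : wmodule.
Proof.
pose b j w : {malg k[windex]} :=
  if insub (w, j) is Some x then << (x : windex) >> else 0.
have bE j w (h : nf j w) : b j w = << (exist _ (w, j) h : windex) >>.
  by rewrite /b insubT.
pose L (V' : lmodType k) (f : V -> word -> V') :=
  mlin (fun x : windex => f (val x).2 (val x).1).
apply: (@WModule {malg k[windex]} b L).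
- by move=> V' f; exact: mlin_linear.
- by move=> V' f j w h; rewrite (bE _ _ h) [LHS]mlinU.
move=> P PL P0 Pb x; rewrite (monalgE x).
elim/big_rec: _ => // -[[w j] h] y _ Py.
set z : windex := exist _ _ _.
have -> : << x@_z *g z >> = x@_z *: << z >> :> {malg k[windex]}.
  by apply/malgP=> u; rewrite mcoeffZ !mcoeffU mulrnAr mulr1.
by apply: PL => //; rewrite -(bE j w h); exact: Pb.
Qed.

Definition M : lmodType k := wm_mod word_module.
Definition bv : V -> word -> M := @wm_bv word_module.

Definition wlin (V' : lmodType k) (f : V -> word -> V') : M -> V' := wm_lift f.

Lemma wlin_linear (V' : lmodType k) (f : V -> word -> V') : linear (wlin f).
Proof. exact: wm_linear. Qed.

Lemma wlin_bv (V' : lmodType k) (f : V -> word -> V') j w :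
  nf j w -> wlin f (bv j w) = f j w.
Proof. exact: wm_liftE. Qed.

Lemma M_ind (P : M -> Prop) :
  (forall a x y, P x -> P y -> P (a *: x + y)) -> P 0 ->
  (forall j w, nf j w -> P (bv j w)) -> forall x, P x.
Proof. exact: wm_ind. Qed.

Lemma M_ext (V' : lmodType k) (f g : M -> V') : linear f -> linear g ->
  (forall j w, nf j w -> f (bv j w) = g (bv j w)) -> f =1 g.
Proof.
move=> lf lg e; apply: M_ind => [a x y ex ey||//].
  by rewrite lf lg ex ey.
by rewrite (lin0 lf) (lin0 lg).
Qed.

Definition lin (f : V -> word -> M) : End M := mkEnd (wlin_linear f).

Lemma lin_bv f j w : nf j w -> ap (lin f) (bv j w) = f j w.
Proof. exact: wlin_bv. Qed.

Lemma E_ext (f g : End M) :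
  (forall j w, nf j w -> ap f (bv j w) = ap g (bv j w)) -> f = g.
Proof. by move=> e; apply/End_ext/M_ext => //; exact: ap_linear. Qed.

Definition eE v : End M := lin (fun j w => if st j w == v then bv j w else 0).

Lemma eE_bv v j w : nf j w -> ap (eE v) (bv j w) = if st j w == v then bv j w else 0.
Proof. by move=> h; rewrite lin_bv. Qed.

Lemma eE_bvT j w : nf j w -> ap (eE (st j w)) (bv j w) = bv j w.
Proof. by move=> h; rewrite eE_bv // eqxx. Qed.

Lemma eEE v : eE v * eE v = eE v.
Proof.
apply: E_ext => j w h; rewrite apM eE_bv //; case: ifP => e; last exact: ap_in0.
by rewrite eE_bv // e.
Qed.

Lemma eE_orth u v : u != v -> eE u * eE v = 0.
Proof.
move=> uv; apply: E_ext => j w h; rewrite apM eE_bv // ap0.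
case: ifP => e; last exact: ap_in0.
by rewrite eE_bv // (eqP e) eq_sym (negbTE uv).
Qed.

Lemma eE_sum : \sum_v eE v = 1.
Proof.
apply: E_ext => j w h; rewrite ap_sum ap1 (bigD1 (st j w)) // eE_bvT // big1 => [|v ne].
  exact: addr0.
by rewrite eE_bv // eq_sym (negbTE ne).
Qed.

(** For [q] nonzero the two constants of [KR] are inverse to each other, as [U_tE] requires. The
    constant of [KC] is free; its values 0 and 1 lead to the two bases. *)
Definition cst kp s : k :=
  match kp with KR v => if s then q v else (q v)^-1 | KX _ => 1 | KC _ => dlt end.

(** The action of the unit [u] whose letter is [u - c]. In front of the opposite letter the rule is
    [u (u^-1 - c') = 1 - c' u]. At other vertices [u] acts as the identity, so that it is invertible
    on all of [M]. *)
Fixpoint Uf kp s j w : M :=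
  if st j w != kvert kp then bv j w else
  let u := cst kp s *: bv j w + bv j (LU kp s :: w) in
  if w is l :: w' then
    if l == LU kp (~~ s) then bv j w' - cst kp (~~ s) *: Uf kp s j w' else u
  else u.

Definition U kp s : End M := lin (Uf kp s).

Definition full_kind kp : bool := lokU kp true && lokU kp false.

Lemma full_lok kp s : full_kind kp -> lokU kp s.
Proof. by case/andP; case: s. Qed.

Lemma full_kF kp : full_kind kp -> kF kp = false.
Proof.
by case: kp => //= d /andP[_ /and3P[_ _]]; rewrite implybF => /negbTE.
Qed.

Lemma nf_behead j l w : nf j (l :: w) -> nf j w.
Proof. by case/and3P. Qed.

Lemma nf_st j l w : nf j (l :: w) -> st j w = lhd l.
Proof. by case/and3P=> _ /andP[/eqP]. Qed.

Lemma nf_LU kp s j w : full_kind kp -> nf j w -> st j w = kvert kp ->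
  (forall w', w <> LU kp (~~ s) :: w') -> nf j (LU kp s :: w).
Proof.
move=> fk h e ne /=; rewrite h (full_lok s fk) /= andbT /compat /= e eqxx /=.
case: w h e ne => //= -[d|kp' s'] w _ e ne.
  by rewrite (full_kF fk) andbF.
rewrite (full_kF fk) orbF; apply: contra_notN (ne w) => /andP[/eqP <-].
by case: s' s {e ne} => -[].
Qed.

Variant U_case kp s j w : M -> Type :=
| U_off of st j w <> kvert kp : U_case kp s j w (bv j w)
| U_red w' of w = LU kp (~~ s) :: w' & nf j w' & st j w' = kvert kp :
    U_case kp s j w (bv j w' - cst kp (~~ s) *: ap (U kp s) (bv j w'))
| U_add of st j w = kvert kp & nf j (LU kp s :: w)
    & (forall w', w <> LU kp (~~ s) :: w') :
    U_case kp s j w (cst kp s *: bv j w + bv j (LU kp s :: w)).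

Lemma UP kp s j w : full_kind kp -> nf j w ->
  U_case kp s j w (ap (U kp s) (bv j w)).
Proof.
move=> fk h; rewrite lin_bv //.
case: w h => [|l w] h /=.
  case: eqP => [e|ne] /=; last exact: U_off.
  by apply: U_add => //; apply: nf_LU.
case: eqP => [e|ne] /=; last exact: U_off.
case: eqP => [ll|ne].
  have e' := nf_st h; rewrite ll /= in e'.
  rewrite -[Uf kp s j w]lin_bv ?(nf_behead h) //.
  by apply: (U_red (w' := w)) => //; [rewrite ll | exact: nf_behead h].
have ne' w' : l :: w <> LU kp (~~ s) :: w' by case.
by apply: U_add => //; apply: nf_LU.
Qed.

Lemma U_cons kp s j w : full_kind kp -> nf j (LU kp s :: w) ->
  ap (U kp s) (bv j w) = cst kp s *: bv j w + bv j (LU kp s :: w).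
Proof.
move=> fk h; case: (UP s fk (nf_behead h)) => [ne|w' ew|//].
  by case: ne; rewrite (nf_st h).
by case/and3P: h => _ /andP[_]; rewrite ew /= eqxx /=; case: s {ew}.
Qed.

Lemma U_consV kp s j w : full_kind kp -> nf j (LU kp (~~ s) :: w) ->
  ap (U kp s) (bv j (LU kp (~~ s) :: w)) =
  bv j w - cst kp (~~ s) *: ap (U kp s) (bv j w).
Proof.
move=> fk h; case: (UP s fk h) => [ne|w' [->] //|_ _ /(_ w) //].
by case: ne.
Qed.

Lemma UK kp s : full_kind kp -> U kp s * U kp (~~ s) = 1.
Proof.
move=> fk; apply: E_ext => j w; rewrite apM ap1.
elim: w => [|l w IH] h.
  case: UP => // [ne|e hn _]; first by case: UP => //= e; case: ne.
  by rewrite ap_inD ap_inZ U_consV // addrC subrK.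
case: UP => // [ne|w' ew hw' e|e hn _].
- by case: UP => // w' ew; case: ne; rewrite ew.
- rewrite negbK in ew *; case: ew h hw' e IH => -> <- h hw' e IH.
  by rewrite ap_inB ap_inZ IH // U_cons // addrC addKr.
- by rewrite ap_inD ap_inZ U_consV // addrC subrK.
Qed.

Lemma U_eE kp s v : full_kind kp -> U kp s * eE v = eE v * U kp s.
Proof.
move=> fk; apply: E_ext => j w h; rewrite !apM [ap (eE v) (bv j w)]eE_bv //.
have P w' (h' : nf j w') b :
    ap (U kp s) (if b then bv j w' else 0) = if b then ap (U kp s) (bv j w') else 0.
  by case: b; rewrite ?ap_in0.
rewrite P; elim: w h => [|l w IH] h; case: (UP s fk h) => //.
- by move=> ne; rewrite eE_bv.
- move=> e hn _; rewrite ap_inD ap_inZ !eE_bv // [st j (LU _ _ :: _)]/= e.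
  by case: ifP; rewrite ?scaler0 ?addr0.
- by move=> ne; rewrite eE_bv.
- move=> w' ew hw' e; case: ew h IH hw' e => -> <- h IH hw' e.
  rewrite ap_inB ap_inZ -IH //.
  rewrite eE_bv // !e /=.
  by case: ifP; rewrite ?scaler0 ?subr0.
- move=> e hn _; rewrite ap_inD ap_inZ !eE_bv // [st j (LU _ _ :: _)]/= e.
  by case: ifP; rewrite ?scaler0 ?addr0.
Qed.

Lemma U_offE kp s v : full_kind kp -> v != kvert kp -> U kp s * eE v = eE v.
Proof.
move=> fk ne; apply: E_ext => j w h; rewrite !apM eE_bv //.
case: ifP => e; rewrite ?ap_in0 //.
case: UP => // [w' ew|e']; case/eqP: ne; last by rewrite -(eqP e).
by rewrite -(eqP e) ew.
Qed.

Definition isKC l : bool := if l is LU (KC _) _ then true else false.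
Definition startKC w : bool := if w is l :: _ then isKC l else false.

(* The projection onto the words which do not start with a letter [KC]. *)
Definition tE : End M := lin (fun j w => if startKC w then 0 else bv j w).

Lemma tE_bv j w : nf j w -> ~~ startKC w -> ap tE (bv j w) = bv j w.
Proof. by move=> h /negbTE e; rewrite lin_bv // e. Qed.

(** In front of the opposite letter, [c c' = 1] gives [(u - c) (u^-1 - c') = - c' (u - c) - c (u^-1
    - c')], so by recursion all words that occur start with a letter of kind [kp]. *)
Lemma U_tE kp s : full_kind kp -> (forall v, kp <> KC v) ->
  cst kp s * cst kp (~~ s) = 1 ->
  tE * ((U kp s - cst kp s *: (1 : End M)) * eE (kvert kp)) =
  (U kp s - cst kp s *: (1 : End M)) * eE (kvert kp).
Proof.
move=> fk nC cc; apply: E_ext => j w h; rewrite !apM.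
rewrite eE_bv //; case: ifP => [/eqP e|_]; last by rewrite !ap_in0.
have nKC s' w' : ~~ startKC (LU kp s' :: w').
  by case: (kp) nC => //= v' /(_ v').
rewrite !apB !apZ !ap1.
elim: w h e => [|l w IH] h e; case: (UP s fk h) => //.
- by move=> _ hn _; rewrite addrAC subrr add0r tE_bv.
- move=> w' ew hw' e'; case: ew h IH hw' e' e => -> <- h IH hw' e' e.
  have := IH hw' e'; set a := ap (U _ _) _ => IHa.
  have -> : bv j w - cst kp (~~ s) *: a - cst kp s *: bv j (LU kp (~~ s) :: w) =
    - cst kp (~~ s) *: (a - cst kp s *: bv j w) - cst kp s *: bv j (LU kp (~~ s) :: w).
    rewrite scalerBr scalerA mulNr [cst kp _ * _]mulrC cc.
    by rewrite !scaleNr scale1r opprK [_ + bv j w]addrC.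
  by rewrite ap_inB !ap_inZ IHa tE_bv.
- by move=> _ hn _; rewrite addrAC subrr add0r tE_bv.
Qed.
End Words.

(** * The action of the arrows *)

Section DartOps.
Variables (k : fieldType) (Q : quiver) (n : nat) (c : 'I_n -> dart Q).
Variables (F : {set dart Q}) (q : vertex Q -> k) (dlt : k).

Local Notation V := (vertex Q).
Local Notation word := (seq (lett Q)).
Implicit Types (j v : V) (w : word) (s : bool) (d : dart Q) (l : lett Q).
Implicit Types (kp : kind Q).
Local Notation M := (M k c F).
Local Notation nf := (nf c F).
Local Notation bv := (bv k c F).
Local Notation U := (U c F q dlt).
Local Notation eE := (eE k c F).
Local Notation cst := (cst q dlt).
Local Notation kap := (kap c).
Local Notation full := (full_kind c F).

Lemma off_star d : off_cycle c (star d) = off_cycle c d.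
Proof. by []. Qed.

Lemma cst_kap_star d s : cst (kap (star d)) s = cst (kap d) s.
Proof. by rewrite !kapE off_star; case: ifP. Qed.

Lemma UC kp s s' : full kp -> U kp s * U kp s' = U kp s' * U kp s.
Proof.
move=> fk; case: (eqVneq s s') => [-> //|ne].
have -> : s' = ~~ s by case: s s' ne => -[].
by rewrite (UK q dlt s fk) -{2}[s]negbK (UK q dlt _ fk).
Qed.

Lemma LU_U kp s j w : full kp -> nf j (LU kp s :: w) ->
  bv j (LU kp s :: w) = ap (U kp s - cst kp s *: (1 : End M)) (bv j w).
Proof. by move=> fk h; rewrite apB (U_cons _ _ fk h) apZ ap1 addrC addKr. Qed.

(* Prepends [d], rewriting by [d d^* = (1 + d d^* ) - 1] and
   [d (1 + d^* d)^{+-1} = (1 + d d^* )^{+-1} d] if this is not normal. *)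
Fixpoint A0f d j w : M :=
  if st j w != dhead d then 0 else
  match w with
  | LA d' :: w' =>
    if d' == star d then ap (U (kap d) true - 1) (bv j w') else bv j (LA d :: w)
  | LU kp s :: w' =>
    if kp == kap (star d) then ap (U (kap d) s - cst (kap d) s *: (1 : End M)) (A0f d j w')
    else bv j (LA d :: w)
  | [::] => bv j [:: LA d]
  end.

Definition A0 d : End M := lin (A0f d).

Variant A0_case d j w : M -> Type :=
| A0_off of st j w <> dhead d : A0_case d j w 0
| A0_star w' of w = LA (star d) :: w' & nf j w' & st j w' = dtail d :
    A0_case d j w (ap (U (kap d) true - 1) (bv j w'))
| A0_unit s w' of w = LU (kap (star d)) s :: w' & nf j w' & st j w' = dhead d :
    A0_case d j w (ap (U (kap d) s - cst (kap d) s *: (1 : End M)) (ap (A0 d) (bv j w')))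
| A0_add of st j w = dhead d & nf j (LA d :: w) & (forall w', w <> LA (star d) :: w')
    & (forall s w', w <> LU (kap (star d)) s :: w') :
    A0_case d j w (bv j (LA d :: w)).

Lemma A0P d j w : nf j w -> A0_case d j w (ap (A0 d) (bv j w)).
Proof.
move=> h; rewrite lin_bv //.
case: w h => [|[d'|kp s] w] h; rewrite /A0f -/A0f.
- case: eqP => [e|ne] /=; last exact: A0_off.
  by apply: A0_add; rewrite //= /compat /= (e : j = _) eqxx.
- case: eqP => [e|ne] /=; last exact: A0_off.
  case: eqP => [dd|ne].
    apply: (A0_star (w' := w)); rewrite ?dd ?(nf_behead h) // (nf_st h) dd /=.
    exact: dhead_star.
  apply: A0_add => //; last by move=> w' [].
  by rewrite /= /compat [st _ _]/= (e : dtail d' = _) eqxx /= (introF eqP ne).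
- case: eqP => [e|ne] /=; last exact: A0_off.
  case: eqP => [kk|ne].
    rewrite -[A0f d j w](lin_bv (A0f d)) ?(nf_behead h) //.
    apply: (A0_unit (w' := w)); rewrite ?kk ?(nf_behead h) // (nf_st h) /=.
    exact: e.
  apply: A0_add => //; last by move=> s' w' [].
  by rewrite /= /compat [st _ _]/= (e : kvert kp = _) eqxx /= (introF eqP ne).
Qed.

Lemma A0_cons d j w : nf j (LA d :: w) -> ap (A0 d) (bv j w) = bv j (LA d :: w).
Proof.
move=> h; case: (A0P d (nf_behead h)) => //.
- by case; rewrite (nf_st h).
- by move=> w' ew; case/and3P: h => _ /andP[_]; rewrite ew /= eqxx.
- by move=> s w' ew; case/and3P: h => _ /andP[_]; rewrite ew /= eqxx.
Qed.

Lemma A0_consV d j w : nf j (LA (star d) :: w) ->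
  ap (A0 d) (bv j (LA (star d) :: w)) = ap (U (kap d) true - 1) (bv j w).
Proof.
move=> h; case: (A0P d h) => //; last by move=> _ _ /(_ w).
- by case; exact: dtail_star.
- by move=> w' [->].
Qed.

Lemma A0_consU d s j w : nf j (LU (kap (star d)) s :: w) ->
  ap (A0 d) (bv j (LU (kap (star d)) s :: w)) =
  ap (U (kap d) s - cst (kap d) s *: (1 : End M)) (ap (A0 d) (bv j w)).
Proof.
move=> h; case: (A0P d h) => [ne|w' ew|s' w' ew _ _|_ _ _ ne].
- by case: ne; rewrite /= kvert_kap dtail_star.
- by [].
- by case: ew => -> ->.
- by case: (ne s w).
Qed.

Lemma A0_src d j w : nf j w -> st j w != dhead d -> ap (A0 d) (bv j w) = 0.
Proof.
move=> h /eqP ne; case: (A0P d h) => [//|w' ew|s w' ew|e]; case: ne => //.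
- by rewrite ew /= dtail_star.
- by rewrite ew /= kvert_kap dtail_star.
Qed.

Lemma A0_eE d v : A0 d * eE v = if v == dhead d then A0 d else 0.
Proof.
apply: E_ext => j w h; rewrite apM eE_bv //.
have [<-|ne] := eqVneq (st j w) v.
  by case: eqP => [//|/eqP e]; rewrite A0_src // ap0.
rewrite ap_in0; case: eqP => [e|_]; last by rewrite ap0.
by rewrite A0_src // -e.
Qed.

Section Tame.
Variable d : dart Q.
Hypotheses (fd : full (kap d)) (fs : full (kap (star d))).

Lemma eE_A0 v : eE v * A0 d = if v == dtail d then A0 d else 0.
Proof.
have E1 v' : eE v' * (U (kap d) true - 1) = (U (kap d) true - 1) * eE v'.
  by rewrite mulrBr mulrBl mul1r mulr1 (U_eE _ _ _ _ fd).
have E2 v' s : eE v' * (U (kap d) s - cst (kap d) s *: (1 : End M)) =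
    (U (kap d) s - cst (kap d) s *: (1 : End M)) * eE v'.
  by rewrite mulrBr mulrBl -alg_scalerAl -alg_scalerAr mul1r mulr1 (U_eE _ _ _ _ fd).
apply: E_ext => j w h; rewrite apM [v == _]eq_sym.
elim: w h => [|l w IH] h; case: (A0P d h).
- by move=> ne; rewrite ap_in0; case: ifP => _; rewrite ?ap0 // (A0_src h) //; apply/eqP.
- by [].
- by [].
- by move=> e hn _ _; rewrite eE_bv //=; case: ifP => _; rewrite ?ap0 // A0_cons.
- by move=> ne; rewrite ap_in0; case: ifP => _; rewrite ?ap0 // (A0_src h) //; apply/eqP.
- move=> w' ew hw' e; case: ew h IH hw' e => -> <- h IH hw' e.
  rewrite -apM E1 apM eE_bv // e; case: ifP => _; rewrite ?ap_in0 ?ap0 //.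
  by rewrite A0_consV.
- move=> s w' ew hw' e; case: ew h IH hw' e => -> <- h IH hw' e.
  rewrite -apM E2 apM IH //; case: ifP => _; rewrite ?ap0 ?ap_in0 //.
  by rewrite A0_consU.
- move=> e hn _ _; rewrite eE_bv // [st _ _]/=; case: ifP => _; rewrite ?ap0 //.
  by rewrite A0_cons.
Qed.

Lemma A0U s : A0 d * U (kap (star d)) s = U (kap d) s * A0 d.
Proof.
apply: E_ext => j w; rewrite !apM.
elim: w => [|l w IH] h; case: (UP q dlt s fs h).
- by rewrite kvert_kap dtail_star => /eqP ne; rewrite (A0_src h ne) ap_in0.
- by move=> w' ew; discriminate ew.
- move=> e hn _; rewrite ap_inD ap_inZ A0_consU // apB apZ ap1 cst_kap_star.
  by rewrite addrC subrK.
- by rewrite kvert_kap dtail_star => /eqP ne; rewrite (A0_src h ne) ap_in0.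
- move=> w' ew hw' e; case: ew h IH hw' e => -> <- h IH hw' e.
  rewrite A0_consU // ap_inB ap_inZ IH // apB apZ ap1 ap_inB ap_inZ.
  by rewrite -[in RHS]apM (UK q dlt _ fd) ap1 cst_kap_star.
- move=> e hn _; rewrite ap_inD ap_inZ A0_consU // apB apZ ap1 cst_kap_star.
  by rewrite addrC subrK.
Qed.
End Tame.

(** For an arrow [c_i] of the cycle this also says that the unit of its dual is [x] at the head of
    [c_i], which disagrees with [rho] in general; hence the twists [Phi] and [Psi] later. *)
Lemma A0A d : full (kap d) -> full (kap (star d)) ->
  A0 d * A0 (star d) = (U (kap d) true - 1) * eE (dtail d).
Proof.
move=> fd fs; apply: E_ext => j w h; rewrite !apM eE_bv //.
case: ifP => [/eqP e|ne]; last first.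
  by rewrite ap_in0 (A0_src h) ?ap_in0 // dhead_star ne.
elim: w h e => [|l w IH] h e; case: (A0P (star d) h); rewrite ?starK //.
- by rewrite dhead_star e.
- by move=> _ hn _ _; rewrite A0_consV.
- by rewrite dhead_star e.
- move=> w' ew hw' _; case: ew h IH hw' e => -> <- h IH hw' _.
  rewrite -apM mulrBr mulr1 A0U // -{2}[A0 d]mul1r -mulrBl apM.
  by rewrite A0_cons.
- move=> s w' ew hw'; case: ew h IH hw' e => -> <- h IH hw' _ e.
  rewrite dhead_star in e.
  have sA : A0 d * (U (kap (star d)) s - cst (kap (star d)) s *: (1 : End M)) =
      (U (kap d) s - cst (kap d) s *: (1 : End M)) * A0 d.
    rewrite mulrBr mulrBl A0U // -alg_scalerAl -alg_scalerAr mul1r mulr1.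
    by rewrite cst_kap_star.
  rewrite -apM sA apM IH // LU_U // -!apM; congr (ap _ _).
  rewrite !mulrBl !mulrBr !mul1r !mulr1 -alg_scalerAl -alg_scalerAr mul1r mulr1.
  by rewrite [U _ s * _]UC // !opprB addrACA [RHS]addrACA [- _ + - _]addrC.
- by move=> _ hn _ _; rewrite A0_consV.
Qed.
End DartOps.

(** * Forest arrows and their duals *)

Section Forest.
Variables (k : fieldType) (Q : quiver) (n : nat) (c : 'I_n -> dart Q).
Variables (F : {set dart Q}) (q : vertex Q -> k) (dlt : k).

Local Notation V := (vertex Q).
Local Notation word := (seq (lett Q)).
Implicit Types (j v : V) (w : word) (s : bool) (d : dart Q) (l : lett Q).
Implicit Types (kp : kind Q).
Local Notation M := (M k c F).
Local Notation nf := (nf c F).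
Local Notation bv := (bv k c F).
Local Notation eE := (eE k c F).
Local Notation tE := (tE k c F).
Local Notation kap := (kap c).

Hypothesis F_off : {in F, forall d, off_cycle c d}.
Hypothesis F_star : {in F, forall d, star d \notin F}.

Section OneArrow.
Variables (a : dart Q) (X : bool -> End M).
Hypothesis aF : a \in F.

Let kap_a : kap (star a) = KX (star a).
Proof. by rewrite !kapE off_star F_off. Qed.

(** [X] is the action prescribed for [1 + a a^*], which has no letter. The rules are [a a^* = X - 1]
    and [a (a^* a) = (X - 1) a]. *)
Definition AFf j w : M :=
  if st j w != dhead a then 0 else
  match w with
  | LA d' :: w' =>
    if d' == star a then ap (X true - 1) (bv j w') else bv j (LA a :: w)
  | LU kp s :: w' =>
    if kp == KX (star a) then ap (X true - 1) (bv j (LA a :: w'))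
    else bv j (LA a :: w)
  | [::] => bv j [:: LA a]
  end.

(** The only rewriting is that of [a^* a] into the letter [(1 + a^* a) - 1]. *)
Definition ASf j w : M :=
  if st j w != dtail a then 0 else
  match w with
  | LA d' :: w' =>
    if d' == a then bv j (LU (KX (star a)) true :: w') else bv j (LA (star a) :: w)
  | _ => bv j (LA (star a) :: w)
  end.

Definition AF : End M := lin AFf.
Definition AS : End M := lin ASf.

Variant AF_case j w : M -> Type :=
| AF_off of st j w <> dhead a : AF_case j w 0
| AF_star w' of w = LA (star a) :: w' & nf j w' & st j w' = dtail a :
    AF_case j w (ap (X true - 1) (bv j w'))
| AF_unit w' of w = LU (KX (star a)) true :: w' & nf j (LA a :: w') & st j w' = dhead a :
    AF_case j w (ap (X true - 1) (bv j (LA a :: w')))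
| AF_add of st j w = dhead a & nf j (LA a :: w) & (forall w', w <> LA (star a) :: w')
    & (forall s w', w <> LU (KX (star a)) s :: w') :
    AF_case j w (bv j (LA a :: w)).

(** The letter [a^* a] and the arrow [a] may precede the same words. This is what makes [ASf] and
    the unit rule of [AFf] stay within normal words. *)
Lemma compat_FX s j w : compat c F j (LU (KX (star a)) s) w = compat c F j (LA a) w.
Proof.
rewrite /compat /= dtail_star; congr (_ && _).
case: w => // -[d|kp s'] w /=; rewrite starK aF ?orbT andbT.
  by rewrite eq_KX eq_sym.
by rewrite kap_a eq_sym.
Qed.

Lemma nf_FX s j w : nf j (LU (KX (star a)) s :: w) -> s = true /\ nf j (LA a :: w).
Proof.
case/and3P; rewrite compat_FX => /and3P[_ _ /implyP]; rewrite starK => /(_ aF) -> b h.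
by split=> //; apply/and3P.
Qed.

Lemma nf_FXV j w : nf j (LA a :: w) -> nf j (LU (KX (star a)) true :: w).
Proof.
case/and3P=> _ b h; apply/and3P; split=> //; last by rewrite compat_FX.
by rewrite /= off_star F_off //= F_star //= implybT.
Qed.

Lemma AFP j w : nf j w -> AF_case j w (ap AF (bv j w)).
Proof.
move=> h; rewrite lin_bv //.
case: w h => [|[d'|kp s] w] h; rewrite /AFf.
- case: eqP => [e|ne] /=; last exact: AF_off.
  by apply: AF_add; rewrite //= /compat /= (e : j = _) eqxx.
- case: eqP => [e|ne] /=; last exact: AF_off.
  case: eqP => [dd|ne].
    apply: (AF_star (w' := w)); rewrite ?dd ?(nf_behead h) // (nf_st h) dd /=.
    exact: dhead_star.
  apply: AF_add => //; last by move=> w' [].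
  by rewrite /= /compat [st _ _]/= (e : dtail d' = _) eqxx /= (introF eqP ne).
- case: eqP => [e|ne] /=; last exact: AF_off.
  case: eqP => [kk|ne].
    rewrite kk in h *; have [-> h'] := nf_FX h.
    apply: (AF_unit (w' := w)) => //.
    by rewrite (nf_st h) /= dtail_star.
  apply: AF_add => //; last by move=> s' w' [].
  by rewrite /= /compat [st _ _]/= (e : kvert kp = _) eqxx /= kap_a (introF eqP ne).
Qed.

Variant AS_case j w : M -> Type :=
| AS_off of st j w <> dtail a : AS_case j w 0
| AS_red w' of w = LA a :: w' & nf j (LU (KX (star a)) true :: w') :
    AS_case j w (bv j (LU (KX (star a)) true :: w'))
| AS_add of st j w = dtail a & nf j (LA (star a) :: w) & (forall w', w <> LA a :: w') :
    AS_case j w (bv j (LA (star a) :: w)).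

Lemma ASP j w : nf j w -> AS_case j w (ap AS (bv j w)).
Proof.
move=> h; rewrite lin_bv //.
have kap_ss : kap (star (star a)) = KX a by rewrite starK !kapE F_off.
case: w h => [|[d'|kp s] w] h; rewrite /ASf.
- case: eqP => [e|ne] /=; last exact: AS_off.
  by apply: AS_add; rewrite //= /compat /= dhead_star (e : j = _) eqxx.
- case: eqP => [e|ne] /=; last exact: AS_off.
  case: eqP => [dd|ne].
    rewrite dd in h *; apply: (AS_red (w' := w)) => //; exact: nf_FXV.
  apply: AS_add => //; last by move=> w' [].
  apply/and3P; split=> //; rewrite /compat [lhd _]/= dhead_star e eqxx.
  by rewrite [bad _ _ _ _]/= starK (introF eqP ne).
- case: eqP => [e|ne] /=; last exact: AS_off.
  apply: AS_add => //.
  apply/and3P; split=> //; rewrite /compat [lhd _]/= dhead_star e eqxx.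
  rewrite [bad _ _ _ _]/= kap_ss; case/and3P: h => + _ _ /=.
  by case: (kp) => //= d /and3P[_ dF _]; rewrite eq_KX; apply: contra dF => /eqP ->.
Qed.

Lemma AF_cons j w : nf j (LA a :: w) -> ap AF (bv j w) = bv j (LA a :: w).
Proof.
move=> h; case: (AFP (nf_behead h)) => //.
- by case; rewrite (nf_st h).
- by move=> w' ew; case/and3P: h => _ /andP[_]; rewrite ew /= eqxx.
- by move=> w' ew; case/and3P: h => _ /andP[_]; rewrite ew /= kap_a eqxx.
Qed.

Lemma AF_consV j w : nf j (LA (star a) :: w) ->
  ap AF (bv j (LA (star a) :: w)) = ap (X true - 1) (bv j w).
Proof.
move=> h; case: (AFP h) => //; last by move=> _ _ /(_ w).
- by case; exact: dtail_star.
- by move=> w' [->].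
Qed.

Lemma AF_consX j w : nf j (LU (KX (star a)) true :: w) ->
  ap AF (bv j (LU (KX (star a)) true :: w)) = ap (X true - 1) (bv j (LA a :: w)).
Proof.
move=> h; case: (AFP h) => //; last by move=> _ _ _ /(_ true w).
- by case; exact: dtail_star.
- by move=> w' [->].
Qed.

Lemma AS_cons j w : nf j (LA (star a) :: w) -> ap AS (bv j w) = bv j (LA (star a) :: w).
Proof.
move=> h; case: (ASP (nf_behead h)) => //.
- by case; rewrite (nf_st h) /= dhead_star.
- by move=> w' ew; case/and3P: h => _ /andP[_]; rewrite ew /= starK eqxx.
Qed.

Lemma AS_consX j w : nf j (LA a :: w) ->
  ap AS (bv j (LA a :: w)) = bv j (LU (KX (star a)) true :: w).
Proof.
move=> h; case: (ASP h) => //; last by move=> _ _ /(_ w).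
by move=> w' [->].
Qed.

Lemma AF_AS : AF * AS = (X true - 1) * eE (dtail a).
Proof.
apply: E_ext => j w h; rewrite !apM eE_bv //.
case: (ASP h) => [ne|w' ew h'|e h' _].
- by rewrite (introF eqP ne) !ap_in0.
- by rewrite AF_consX // ew /= eqxx.
- by rewrite AF_consV // e eqxx.
Qed.

Lemma AF_src j w : nf j w -> st j w != dhead a -> ap AF (bv j w) = 0.
Proof.
move=> h /eqP ne; case: (AFP h) => [//|w' ew|w' ew|e]; case: ne => //.
- by rewrite ew /= dtail_star.
- by rewrite ew /= dtail_star.
Qed.

Lemma AF_eE v : AF * eE v = if v == dhead a then AF else 0.
Proof.
apply: E_ext => j w h; rewrite apM eE_bv //.
have [<-|ne] := eqVneq (st j w) v.
  by case: eqP => [//|/eqP e]; rewrite AF_src // ap0.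
rewrite ap_in0; case: eqP => [e|_]; last by rewrite ap0.
by rewrite AF_src // -e.
Qed.

Lemma AS_src j w : nf j w -> st j w != dtail a -> ap AS (bv j w) = 0.
Proof.
move=> h /eqP ne; case: (ASP h) => [//|w' ew|e]; case: ne => //.
by rewrite ew.
Qed.

Lemma AS_eE v : AS * eE v = if v == dtail a then AS else 0.
Proof.
apply: E_ext => j w h; rewrite apM eE_bv //.
have [<-|ne] := eqVneq (st j w) v.
  by case: eqP => [//|/eqP e]; rewrite AS_src // ap0.
rewrite ap_in0; case: eqP => [e|_]; last by rewrite ap0.
by rewrite AS_src // -e.
Qed.

Lemma eE_AS v : eE v * AS = if v == dhead a then AS else 0.
Proof.
apply: E_ext => j w h; rewrite apM [v == _]eq_sym.
case: (ASP h) => [ne|w' ew h'|e h' _].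
- by rewrite ap_in0; case: ifP; rewrite ?ap0 // AS_src //; apply/eqP.
- rewrite eE_bv //= dtail_star; case: ifP => _; rewrite ?ap0 //.
  by rewrite ew AS_consX //; case: (nf_FX h').
- by rewrite eE_bv //= dtail_star; case: ifP => _; rewrite ?ap0 // AS_cons.
Qed.

Hypothesis X_eE : forall v, X true * eE v = eE v * X true.

Lemma eE_AF v : eE v * AF = if v == dtail a then AF else 0.
Proof.
have E1 : eE v * (X true - 1) = (X true - 1) * eE v.
  by rewrite mulrBr mulrBl mul1r mulr1 X_eE.
apply: E_ext => j w h; rewrite apM [v == _]eq_sym.
case: (AFP h) => [ne|w' ew h' e|w' ew h' e|e h' _ _].
- by rewrite ap_in0; case: ifP => _; rewrite ?ap0 // AF_src //; apply/eqP.
- rewrite -apM E1 apM eE_bv // e; case: ifP => _; rewrite ?ap_in0 ?ap0 //.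
  by rewrite ew AF_consV // -ew.
- rewrite -apM E1 apM eE_bv //=; case: ifP => _; rewrite ?ap_in0 ?ap0 //.
  by rewrite ew AF_consX // -ew.
- by rewrite eE_bv //=; case: ifP => _; rewrite ?ap0 // AF_cons.
Qed.

Lemma tE_AS : tE * AS = AS.
Proof.
apply: E_ext => j w h; rewrite apM.
by case: (ASP h) => [_|w' _ h'|_ h' _]; rewrite ?ap_in0 // tE_bv.
Qed.
End OneArrow.
End Forest.

(** * Solving for the units along the forest *)

Section Tree.
Variables (k : fieldType) (Q : quiver) (n : nat) (c : 'I_n -> dart Q).
Variables (F : {set dart Q}) (q : vertex Q -> k) (dlt : k).

Local Notation V := (vertex Q).
Local Notation word := (seq (lett Q)).
Implicit Types (j v : V) (w : word) (s : bool) (d : dart Q) (l : lett Q).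
Implicit Types (kp : kind Q).
Local Notation M := (M k c F).
Local Notation U := (U c F q dlt).
Local Notation eE := (eE k c F).
Local Notation tE := (tE k c F).
Local Notation full := (full_kind c F).

Hypothesis F_off : {in F, forall d, off_cycle c d}.
Hypothesis F_star : {in F, forall d, star d \notin F}.

Lemma tE_black v : ~~ on_cycle c v -> tE * eE v = eE v.
Proof.
move=> nv; apply: E_ext => j w h; rewrite apM eE_bv //.
case: ifP => [/eqP e|_]; last by rewrite ap_in0.
rewrite tE_bv //; case: w h e => [|[d|[u|d|u] s] w] //= /and3P[/= ku _ _] e.
by rewrite e (negbTE nv) in ku.
Qed.

(** A unit of the corner at [v] and its inverse, extended by the identity at all other vertices, as
    [1 + d d^*] behaves for [d] starting at [v]. *)
Definition gunit (f : bool -> End M) v :=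
  [/\ forall s, f s * f (~~ s) = 1,
      forall s u, f s * eE u = eE u * f s
    & forall s u, u != v -> f s * eE u = eE u].

Lemma gunit_at f v s : gunit f v -> f s - 1 = (f s - 1) * eE v.
Proof.
case=> _ _ fo; rewrite -[LHS]mulr1 -[X in _ * X](eE_sum k c F) mulr_sumr (bigD1 v) //=.
by rewrite big1 ?addr0 // => u /(fo s) e; rewrite mulrBl e mul1r subrr.
Qed.

Lemma gunit_atl f v s : gunit f v -> f s - 1 = eE v * (f s - 1).
Proof.
move=> g; rewrite {1}(gunit_at s g) mulrBl mulrBr; case: g => _ -> _.
by rewrite mul1r mulr1.
Qed.

Lemma gunit_tE f v s : ~~ on_cycle c v -> gunit f v -> tE * (f s - 1) = f s - 1.
Proof. by move=> nv g; rewrite (gunit_atl s g) mulrA tE_black. Qed.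

Lemma gunit1 v : gunit (fun=> 1) v.
Proof. by split=> *; rewrite ?mul1r ?mulr1. Qed.

Lemma U_gunit kp : full kp -> gunit (U kp) (kvert kp).
Proof.
move=> fk; split=> [s|s u|s u ne]; first exact: UK.
  exact: U_eE.
exact: U_offE.
Qed.

Section Family.
Variable X : V -> bool -> End M.

(** [X v] stands for the unit of the forest arrow that starts at [v]. The dual of a forest arrow has
    no inverse letter; its inverse unit is [1 - a^* (1 + a a^* )^-1 a]. *)
Definition off_unit d s : End M :=
  if d \in F then X (dtail d) s else
  if star d \in F then
    let a := star d in let B := AS k c F a in let A := AF a (X (dtail a)) in
    if s then 1 + B * A else 1 - B * X (dtail a) false * A
  else U (KX d) s.

Hypothesis X_gunit : forall v, gunit (X v) v.

Lemma Xoff_gunit d : off_cycle c d -> gunit (off_unit d) (dtail d).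
Proof.
move=> od; rewrite /off_unit; case: (boolP (d \in F)) => dF; first exact: X_gunit.
case: (boolP (star d \in F)) => sF; last first.
  by apply: (@U_gunit (KX d)); rewrite /full_kind /= od dF (negbTE sF).
have [XK XC XO] := X_gunit (dtail (star d)).
set a := star d in sF XK XC XO *; set B := AS k c F a.
set Y := X (dtail a); set A := AF a Y.
have eA u := eE_AF F_off sF (XC true) u.
have Ae u : A * eE u = if u == dhead a then A else 0 by exact: AF_eE.
have eB u : eE u * B = if u == dhead a then B else 0 by exact: eE_AS.
have Be u : B * eE u = if u == dtail a then B else 0 by exact: AS_eE.
have AB : A * B = (Y true - 1) * eE (dtail a) by exact: AF_AS.
have td : dtail d = dhead a by rewrite /a dhead_star.
have Bt : B * eE (dtail a) = B by rewrite Be eqxx.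
have tA : eE (dtail a) * A = A by rewrite eA eqxx.
have eYA : eE (dtail a) * (Y false * A) = Y false * A.
  by rewrite mulrA -XC -mulrA tA.
(* Since [A B] is [Y - 1] at the tail of [a], these two identities show that [1 - B Y^-1 A] is a
   two-sided inverse of [1 + B A]. *)
have E0 : B * (A * B) * (Y false * A) = B * A - B * Y false * A.
  rewrite AB -mulrA -[(Y true - 1) * _ * _]mulrA eYA mulrBl mul1r.
  by rewrite [Y true * _]mulrA (XK true) mul1r mulrBr mulrA.
have E1 : B * Y false * (A * B) * A = B * A - B * Y false * A.
  rewrite AB -!mulrA tA mulrBl mul1r mulrBr [Y false * (Y true * _)]mulrA.
  by rewrite (XK false) mul1r mulrBr.
split=> [[] /=|[] u /=|[] u /=].
- rewrite mulrDl mul1r mulrBr mulr1.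
  have -> : B * A * (B * Y false * A) = B * (A * B) * (Y false * A) by rewrite !mulrA.
  by rewrite E0 subKr subrK.
- rewrite mulrBl mul1r mulrDr mulr1.
  have -> : B * Y false * A * (B * A) = B * Y false * (A * B) * A by rewrite !mulrA.
  by rewrite E1 [_ + (_ - _)]addrC subrK addrK.
- rewrite mulrDl mulrDr mul1r mulr1 [eE u * _]mulrA eB -[B * A * _]mulrA Ae.
  by case: eqP; rewrite ?mulr0 ?mul0r.
- rewrite mulrBl mulrBr mul1r mulr1 -!mulrA Ae [eE u * _]mulrA eB.
  by case: eqP; rewrite ?mulr0 ?mul0r.
- by rewrite td => ne; rewrite mulrDl mul1r -[B * A * _]mulrA Ae (negbTE ne) mulr0 addr0.
- by rewrite td => ne; rewrite mulrBl mul1r -[_ * A * _]mulrA Ae (negbTE ne) mulr0 subr0.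
Qed.

(** No normal word at a vertex off the cycle starts with [KC]. This settles forest arrows; in the
    other cases the unit minus 1 writes a letter [KX] or the dual of a forest arrow in front. *)
Lemma Xoff_tE d s : {in F, forall a, ~~ on_cycle c (dtail a)} -> off_cycle c d ->
  tE * (off_unit d s - 1) = off_unit d s - 1.
Proof.
move=> F_tail od; have := Xoff_gunit od; rewrite /off_unit.
case: (boolP (d \in F)) => dF; first by apply: gunit_tE; exact: F_tail.
case: (boolP (star d \in F)) => sF g.
  have Bt := tE_AS k F_off F_star sF.
  case: s; first by rewrite [1 + _]addrC addrK mulrA Bt.
  by rewrite [1 - _]addrC addrK mulrN !mulrA Bt.
rewrite (gunit_at s g).
have := @U_tE k Q n c F q dlt (KX d) s; rewrite /= scale1r; apply=> //.
  by rewrite /full_kind /= od dF (negbTE sF).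
exact: mulr1.
Qed.

Variable eps : dart Q -> bool.

Definition Xprod v (ds : seq (dart Q)) (b : bool) : End M :=
  if b then \prod_(d <- ds | dtail d == v) off_unit d (eps d)
  else \prod_(d <- rev ds | dtail d == v) off_unit d (~~ eps d).

Lemma Xprod_eE v ds b u :
  all (off_cycle c) ds -> Xprod v ds b * eE u = eE u * Xprod v ds b.
Proof.
have P (l' : seq (dart Q)) (f : dart Q -> bool) : all (off_cycle c) l' ->
  (\prod_(d <- l' | dtail d == v) off_unit d (f d)) * eE u =
  eE u * (\prod_(d <- l' | dtail d == v) off_unit d (f d)).
  elim: l' => [|d l' IH] /=; first by rewrite big_nil mul1r mulr1.
  case/andP=> od ol; rewrite big_cons; case: ifP => _; last exact: IH.
  have [_ XC _] := Xoff_gunit od.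
  by rewrite -mulrA IH // mulrA XC mulrA.
by case: b => od; rewrite /Xprod; apply: P; rewrite ?all_rev.
Qed.

Lemma XprodK v ds b :
  all (off_cycle c) ds -> Xprod v ds b * Xprod v ds (~~ b) = 1.
Proof.
have P1 : all (off_cycle c) ds -> Xprod v ds true * Xprod v ds false = 1.
  rewrite /Xprod; elim: ds => [|d l' IH] /=; first by rewrite !big_nil mul1r.
  case/andP=> od /IH{}IH; rewrite big_cons rev_cons big_rcons; case: ifP => _ /=; last by rewrite mulr1 IH.
  have [XK _ _] := Xoff_gunit od.
  by rewrite -mulrA [_ * (_ * off_unit _ _)]mulrA IH mul1r XK.
have P2 : all (off_cycle c) ds -> Xprod v ds false * Xprod v ds true = 1.
  rewrite /Xprod; elim: ds {P1} => [|d l' IH] /=; first by rewrite !big_nil mul1r.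
  case/andP=> od /IH{}IH; rewrite big_cons rev_cons big_rcons; case: ifP => _ /=; last by rewrite mulr1 IH.
  have [XK _ _] := Xoff_gunit od.
  rewrite -mulrA [off_unit _ _ * (_ * _)]mulrA -{2}[eps d]negbK XK mul1r.
  exact: IH.
by case: b.
Qed.
End Family.

Variables (eps : dart Q -> bool) (par : V -> dart Q) (sQ : seq (dart Q)).
Variables (dep : V -> nat) (Rho : bool -> End M).

Hypothesis sQ_mem : forall d, (d \in sQ) = off_cycle c d.
Hypothesis sQ_uniq : uniq sQ.
Hypothesis F_par : {in F, forall a, par (dtail a) = a}.
Hypothesis par_F : forall v, ~~ on_cycle c v -> par v \in F /\ dtail (par v) = v.
Hypothesis F_dep : {in F, forall a, (dep (dhead a) < dep (dtail a))%N}.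
Hypothesis RhoK : forall s, Rho s * Rho (~~ s) = 1.
Hypothesis Rho_eE : forall s v, Rho s * eE v = eE v * Rho s.

Let pre v := take (index (par v) sQ) sQ.
Let post v := drop (index (par v) sQ).+1 sQ.

Lemma pre_post v : ~~ on_cycle c v -> sQ = pre v ++ par v :: post v.
Proof.
move=> nv; have [pF _] := par_F nv; rewrite /pre /post.
have ps : par v \in sQ by rewrite sQ_mem F_off.
rewrite -{1}[sQ](cat_take_drop (index (par v) sQ)); congr (_ ++ _).
by rewrite (drop_nth (par v)) ?index_mem // nth_index.
Qed.

Lemma sQ_off : all (off_cycle c) sQ.
Proof. by apply/allP => d; rewrite sQ_mem. Qed.

Lemma pre_off v : all (off_cycle c) (pre v).
Proof. by apply/allP => d /mem_take; exact: (allP sQ_off). Qed.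

Lemma post_off v : all (off_cycle c) (post v).
Proof. by apply/allP => d /mem_drop; exact: (allP sQ_off). Qed.

Definition Xcore X v (b : bool) : End M :=
  if b then Xprod X eps v (pre v) false * Rho true * Xprod X eps v (post v) false
  else Xprod X eps v (post v) true * Rho false * Xprod X eps v (pre v) true.

(* Solves [rho = pre * (1 + a a^* )^(eps a) * post] at a vertex [v] off the
   cycle for the unit of its arrow [a = par v] of the forest. *)
Definition Xstep X v s : End M :=
  if on_cycle c v then 1 else Xcore X v (s == eps (par v)) * eE v + (1 - eE v).

Lemma corner_inv (R : pzRingType) (e x y : R) : e * e = e -> x * e = e * x ->
  y * e = e * y -> x * y = 1 -> (x * e + (1 - e)) * (y * e + (1 - e)) = 1.
Proof.
move=> ee xe ye xy.
have z1 : e * (1 - e) = 0 by rewrite mulrBr mulr1 ee subrr.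
have z2 : (1 - e) * e = 0 by rewrite mulrBl mul1r ee subrr.
have z3 : (1 - e) * (1 - e) = 1 - e by rewrite mulrBl mul1r z1 subr0.
have z4 : x * e * (y * e) = e.
  by rewrite ye -mulrA (mulrA e) ee -ye mulrA xy mul1r.
have z5 : e + (1 - e) = 1 by rewrite addrC subrK.
move: (1 - e) z1 z2 z3 z5 => f z1 z2 z3 z5.
rewrite mulrDl !mulrDr z3 z4 -[x * e * f]mulrA z1 mulr0 addr0.
by rewrite ye mulrA z2 mul0r add0r.
Qed.

Section Step.
Variable X : V -> bool -> End M.
Hypothesis X_gunit : forall v, gunit (X v) v.

Lemma Xcore_eE v b u : Xcore X v b * eE u = eE u * Xcore X v b.
Proof.
have pE b' := Xprod_eE X_gunit eps v b' u (pre_off v).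
have qE b' := Xprod_eE X_gunit eps v b' u (post_off v).
rewrite /Xcore; case: b.
  by rewrite -!mulrA qE (mulrA (Rho _)) Rho_eE !mulrA pE.
by rewrite -!mulrA pE (mulrA (Rho _)) Rho_eE !mulrA qE.
Qed.

Lemma XcoreK v b : Xcore X v b * Xcore X v (~~ b) = 1.
Proof.
have pK b' := XprodK X_gunit eps v b' (pre_off v).
have qK b' := XprodK X_gunit eps v b' (post_off v).
rewrite /Xcore; case: b => /=.
  rewrite -!mulrA (mulrA (Xprod _ _ _ _ false) (Xprod _ _ _ _ true)) (qK false).
  by rewrite mul1r (mulrA (Rho _) (Rho _)) (RhoK true) mul1r (pK false).
rewrite -!mulrA (mulrA (Xprod _ _ _ _ true) (Xprod _ _ _ _ false)) (pK true).
by rewrite mul1r (mulrA (Rho _) (Rho _)) (RhoK false) mul1r (qK true).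
Qed.

Lemma Xstep_gunit v : gunit (Xstep X v) v.
Proof.
rewrite /Xstep; case: (boolP (on_cycle c v)) => nv; first exact: gunit1.
split=> [s|s u|s u ne].
- have -> : (~~ s == eps (par v)) = ~~ (s == eps (par v)).
    by case: s (eps _) => -[].
  apply: corner_inv; rewrite ?eEE ?XcoreK //; exact: Xcore_eE.
- have eC : eE v * eE u = eE u * eE v.
    by case: (eqVneq u v) => [->//|ne]; rewrite !eE_orth // eq_sym.
  rewrite mulrDl mulrDr mulrBl mulrBr mul1r mulr1 -mulrA eC; congr (_ + _).
  by rewrite mulrA Xcore_eE mulrA.
- rewrite mulrDl mulrBl mul1r -mulrA eE_orth; last by rewrite eq_sym.
  by rewrite mulr0 add0r subr0.
Qed.
End Step.

Lemma par_notin v d : ~~ on_cycle c v -> d \in pre v ++ post v -> d <> par v.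
Proof.
move=> nv + e; move: sQ_uniq; rewrite (pre_post nv) cat_uniq /= e mem_cat.
by case/and3P=> _ /norP[/negbTE-> _] /andP[/negbTE-> _].
Qed.

(** The step at [v] involves the units of the darts starting at [v] other than [par v]. Among these,
    [X] enters only through duals of forest arrows, that is, through arrows of the forest that end
    at [v]. *)
Lemma Xstep_local X X' v : (forall a, a \in F -> dhead a = v -> X (dtail a) = X' (dtail a)) ->
  Xstep X v = Xstep X' v.
Proof.
move=> e; apply/funext => s; rewrite /Xstep; case: (boolP (on_cycle c v)) => // nv.
have P d s' : d \in pre v ++ post v -> dtail d == v -> off_unit X d s' = off_unit X' d s'.
  move=> dp /eqP dv; rewrite /off_unit; case: ifP => dF.
    by case: (par_notin nv dp); rewrite -dv F_par.
  case: ifP => // sF; rewrite e //; rewrite dhead_star; exact: dv.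
have Q1 ds b : {subset ds <= pre v ++ post v} -> Xprod X eps v ds b = Xprod X' eps v ds b.
  rewrite /Xprod => sub; case: b; rewrite big_seq_cond [RHS]big_seq_cond;
    apply: eq_bigr => d /andP[dd dv]; apply: P => //; apply: sub => //.
  by rewrite mem_rev in dd.
rewrite /Xcore !Q1 // => d; rewrite mem_cat => ->; rewrite ?orbT //.
Qed.

Definition Xit m : V -> bool -> End M := iter m Xstep (fun _ _ => 1).

Lemma Xit_gunit m v : gunit (Xit m v) v.
Proof.
elim: m v => [|m IH] v /=; first exact: gunit1.
by apply: Xstep_gunit => u; exact: IH.
Qed.

(** A vertex of depth [d] is stable after [max - d + 1] steps, so this number of iterations reaches
    a fixed point everywhere. *)
Definition XX := Xit (\max_v dep v).+1.

Lemma XX_gunit v : gunit (XX v) v.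
Proof. exact: Xit_gunit. Qed.

Lemma XX_fix v : XX v = Xstep XX v.
Proof.
have P m u : (\max_v dep v < m + dep u)%N -> Xit m u = Xit m.+1 u.
  elim: m u => [|m IH] u lt /=; first by rewrite ltnNge leq_bigmax in lt.
  apply: Xstep_local => a aF au; rewrite -/(Xit m.+1); apply: IH.
  have := F_dep aF; rewrite au; move: lt; rewrite addSn ltnS => le lt.
  by apply: leq_ltn_trans le _; rewrite ltn_add2l.
by rewrite {1}/XX P // addSn ltnS leq_addr.
Qed.

Lemma XX_rho v : ~~ on_cycle c v -> Xprod XX eps v sQ true * eE v = Rho true * eE v.
Proof.
move=> nv; have [pF pv] := par_F nv.
have -> : Xprod XX eps v sQ true =
    Xprod XX eps v (pre v) true * (off_unit XX (par v) (eps (par v)) * Xprod XX eps v (post v) true).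
  by rewrite {1}(pre_post nv) /Xprod big_cat big_cons pv eqxx.
set Y := off_unit XX (par v) (eps (par v)).
have YE : Y * eE v = Xcore XX v true * eE v.
  rewrite /Y /off_unit pF pv XX_fix /Xstep (negbTE nv) eqxx mulrDl mulrBl mul1r.
  by rewrite -mulrA eEE subrr addr0.
have qE := Xprod_eE XX_gunit eps v true v (post_off v).
rewrite -!mulrA qE (mulrA Y) YE -mulrA -qE mulrA /Xcore !mulrA.
rewrite (XprodK XX_gunit eps v true (pre_off v)) mul1r.
by rewrite -[Rho true * _ * _]mulrA (XprodK XX_gunit eps v false (post_off v)) mulr1.
Qed.
End Tree.

Lemma intertwineV (R : pzRingType) (p x xi y yi e : R) :
  p * y * e = x * p * e -> yi * e = e * yi -> y * yi = 1 -> xi * x = 1 ->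
  p * yi * e = xi * p * e.
Proof.
move=> h ce yK xK; rewrite -[LHS]mul1r -xK -!mulrA; congr (_ * _).
by rewrite ce !mulrA -h -!mulrA -ce (mulrA y) yK mul1r.
Qed.

(** * The cycle *)

Section Cycle.
Variables (k : fieldType) (Q : quiver) (n : nat) (c : 'I_n -> dart Q).
Variables (F : {set dart Q}) (q : vertex Q -> k) (dlt : k).

Local Notation V := (vertex Q).
Local Notation word := (seq (lett Q)).
Implicit Types (j v : V) (w : word) (s : bool) (d : dart Q) (l : lett Q).
Implicit Types (kp : kind Q).
Local Notation M := (M k c F).
Local Notation nf := (nf c F).
Local Notation bv := (bv k c F).
Local Notation U := (U c F q dlt).
Local Notation eE := (eE k c F).
Local Notation tE := (tE k c F).
Local Notation cst := (cst q dlt).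
Local Notation full := (full_kind c F).

Hypothesis F_off : {in F, forall d, off_cycle c d}.
Hypothesis F_star : {in F, forall d, star d \notin F}.
Hypothesis F_tail : {in F, forall a, ~~ on_cycle c (dtail a)}.
Hypothesis q_neq0 : forall v, q v != 0.

(** The action of [q], or of [q^-1] for [false]: the scalar part of [Rho s], and itself one of the
    two choices for [Rho]. *)
Definition QE s : End M := \sum_v cst (KR v) s *: eE v.

Lemma QE_eE s v : QE s * eE v = cst (KR v) s *: eE v.
Proof.
rewrite /QE mulr_suml (bigD1 v) //= -alg_scalerAl eEE big1 ?addr0 // => u ne.
by rewrite -alg_scalerAl eE_orth // scaler0.
Qed.

Variables (X : V -> bool -> End M) (eps : dart Q -> bool) (sQ : seq (dart Q)).
Variable Rho : bool -> End M.
Hypothesis X_gunit : forall v, gunit (X v) v.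
Hypothesis sQ_mem : forall d, (d \in sQ) = off_cycle c d.
Hypothesis RhoK : forall s, Rho s * Rho (~~ s) = 1.
Hypothesis Rho_eE : forall s v, Rho s * eE v = eE v * Rho s.
Hypothesis Rho_tE : forall s, tE * (Rho s - QE s) = Rho s - QE s.

Local Notation Xoff := (off_unit q dlt X).

Definition rhoQ b : End M :=
  if b then \prod_(d <- sQ) Xoff d (eps d) else \prod_(d <- rev sQ) Xoff d (~~ eps d).

Let sQ_off : all (off_cycle c) sQ.
Proof. by apply/allP => d; rewrite sQ_mem. Qed.

Lemma rhoQK b : rhoQ b * rhoQ (~~ b) = 1.
Proof.
have P1 ds : all (off_cycle c) ds ->
  (\prod_(d <- ds) Xoff d (eps d)) * (\prod_(d <- rev ds) Xoff d (~~ eps d)) = 1.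
  elim: ds => [|d ds IH] /=; first by rewrite !big_nil mul1r.
  case/andP=> od /IH{}IH; rewrite big_cons rev_cons big_rcons /=.
  have [XK _ _] := Xoff_gunit q dlt F_off F_star X_gunit od.
  by rewrite -mulrA [_ * (_ * Xoff _ _)]mulrA IH mul1r XK.
have P2 ds : all (off_cycle c) ds ->
  (\prod_(d <- rev ds) Xoff d (~~ eps d)) * (\prod_(d <- ds) Xoff d (eps d)) = 1.
  elim: ds => [|d ds IH] /=; first by rewrite !big_nil mul1r.
  case/andP=> od /IH{}IH; rewrite big_cons rev_cons big_rcons /=.
  have [XK _ _] := Xoff_gunit q dlt F_off F_star X_gunit od.
  by rewrite -mulrA [Xoff _ _ * (_ * _)]mulrA -{2}[eps d]negbK XK mul1r.
by case: b; [exact: P1 | exact: P2].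
Qed.

Lemma rhoQ_eE b v : rhoQ b * eE v = eE v * rhoQ b.
Proof.
have P (ds : seq (dart Q)) (f : dart Q -> bool) : all (off_cycle c) ds ->
  (\prod_(d <- ds) Xoff d (f d)) * eE v = eE v * (\prod_(d <- ds) Xoff d (f d)).
  elim: ds => [|d ds IH] /=; first by rewrite big_nil mul1r mulr1.
  case/andP=> od ol; rewrite big_cons.
  have [_ XC _] := Xoff_gunit q dlt F_off F_star X_gunit od.
  by rewrite -mulrA IH // mulrA XC mulrA.
by case: b; rewrite /rhoQ; apply: P; rewrite ?all_rev.
Qed.

Lemma rhoQ_tE : tE * (rhoQ true - 1) = rhoQ true - 1.
Proof.
rewrite /rhoQ; move: sQ_off; elim: sQ => [|d ds IH] /=.
  by rewrite big_nil subrr mulr0.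
case/andP=> od /IH{}IH; rewrite big_cons; set P := \big[_/_]_(_ <- _) _ in IH *.
have -> : Xoff d (eps d) * P - 1 = (Xoff d (eps d) - 1) * P + (P - 1).
  by rewrite mulrBl mul1r addrA subrK.
by rewrite mulrDr mulrA (Xoff_tE q dlt F_off F_star X_gunit (eps d) F_tail od) IH.
Qed.

Definition uu : End M := rhoQ true * Rho false.
Definition ui : End M := Rho true * rhoQ false.
Definition nn : End M := uu - QE false.

Lemma uuK : uu * ui = 1.
Proof. by rewrite /uu /ui -mulrA (mulrA (Rho _)) (RhoK false) mul1r (rhoQK true). Qed.

Lemma uiK : ui * uu = 1.
Proof. by rewrite /uu /ui -mulrA (mulrA (rhoQ _)) (rhoQK false) mul1r (RhoK true). Qed.

Lemma uu_eE v : uu * eE v = eE v * uu.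
Proof. by rewrite /uu -mulrA Rho_eE mulrA rhoQ_eE mulrA. Qed.

Lemma ui_eE v : ui * eE v = eE v * ui.
Proof. by rewrite /ui -mulrA rhoQ_eE mulrA Rho_eE mulrA. Qed.

(** [uu - q^-1] splits into [(rho_{Q'} - 1) rho^-1] and [rho^-1 - q^-1], and neither summand writes
    a letter [KC] in front. *)
Lemma nn_tE : tE * nn = nn.
Proof.
have -> : nn = (rhoQ true - 1) * Rho false + (Rho false - QE false).
  by rewrite mulrBl mul1r addrA subrK.
by rewrite mulrDr mulrA rhoQ_tE Rho_tE.
Qed.

Lemma uu_at v : uu * eE v = (q v)^-1 *: eE v + nn * eE v.
Proof. by rewrite /nn mulrBl QE_eE /= addrC subrK. Qed.

Lemma nn_eE v : nn * eE v = eE v * nn.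
Proof.
rewrite /nn mulrBl mulrBr uu_eE; congr (_ - _).
rewrite QE_eE /QE mulr_sumr (bigD1 v) //= -alg_scalerAr eEE big1 ?addr0 // => u ne.
by rewrite -alg_scalerAr eE_orth ?scaler0 // eq_sym.
Qed.

(** The unit [uu x] and its inverse [x^-1 uu^-1]: at the head [v] of [c_i] this is what
    [1 + c_i^* c_i] has to be. *)
Definition yy v s : End M :=
  if s then uu * U (KC v) true else U (KC v) false * ui.

Fixpoint Phif j w : M :=
  match w with
  | LU (KC v) s :: w' => ap (yy v s - dlt *: (1 : End M)) (Phif j w')
  | _ => bv j w
  end.

(** Dictated by [Psi (uu x) = x Psi]. With [uu = q^-1 + nn] and [Psi nn = nn] this becomes
    [q^-1 Psi x + nn x = x Psi], which is solved for [Psi x]. The rule for [x^-1] comes from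
    [x^-1 = (uu x)^-1 (q^-1 + nn)]. *)
Fixpoint Psif j w : M :=
  match w with
  | LU (KC v) true :: w' =>
    q v *: (ap (U (KC v) true) (Psif j w') - ap (nn * U (KC v) true) (bv j w'))
    - dlt *: Psif j w'
  | LU (KC v) false :: w' =>
    ap (U (KC v) false) ((q v)^-1 *: Psif j w' + ap nn (bv j w')) - dlt *: Psif j w'
  | _ => bv j w
  end.

(* At the head of [c i], the units [x_{i+1}] and [1 + c_i^* c_i] differ by the
   factor [uu = rho_{Q'} rho^-1]. Hence [c_i] and [c_i^*] act by [A0 Psi] and
   [Phi A0], where [Phi] turns the action of [x] into that of [uu * x]. Its
   inverse is computable since [uu] is a scalar up to [nn], which maps to words
   that [Phi] fixes. *)
Definition Phi : End M := lin Phif.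
Definition Psi : End M := lin Psif.

Lemma Phi_id j w : nf j w -> ~~ startKC w -> ap Phi (bv j w) = bv j w.
Proof. by move=> h; rewrite lin_bv //; case: w {h} => [|[d|[v|d|v] s] w]. Qed.

Lemma Psi_id j w : nf j w -> ~~ startKC w -> ap Psi (bv j w) = bv j w.
Proof. by move=> h; rewrite lin_bv //; case: w {h} => [|[d|[v|d|v] [|]] w]. Qed.

Lemma Phi_cons v s j w : nf j (LU (KC v) s :: w) ->
  ap Phi (bv j (LU (KC v) s :: w)) = ap (yy v s - dlt *: (1 : End M)) (ap Phi (bv j w)).
Proof. by move=> h; rewrite [LHS]lin_bv // lin_bv ?(nf_behead h). Qed.

Lemma Psi_consT v j w : nf j (LU (KC v) true :: w) ->
  ap Psi (bv j (LU (KC v) true :: w)) =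
  q v *: (ap (U (KC v) true) (ap Psi (bv j w)) - ap (nn * U (KC v) true) (bv j w))
  - dlt *: ap Psi (bv j w).
Proof. by move=> h; rewrite [LHS]lin_bv // lin_bv ?(nf_behead h). Qed.

Lemma Psi_consF v j w : nf j (LU (KC v) false :: w) ->
  ap Psi (bv j (LU (KC v) false :: w)) =
  ap (U (KC v) false) ((q v)^-1 *: ap Psi (bv j w) + ap nn (bv j w)) - dlt *: ap Psi (bv j w).
Proof. by move=> h; rewrite [LHS]lin_bv // lin_bv ?(nf_behead h). Qed.

Lemma PhitE : Phi * tE = tE.
Proof.
apply: E_ext => j w h; rewrite apM; case: (boolP (startKC w)) => e; last first.
  by rewrite tE_bv // Phi_id.
by rewrite [ap tE _]lin_bv // e ap_in0.
Qed.

Lemma PsitE : Psi * tE = tE.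
Proof.
apply: E_ext => j w h; rewrite apM; case: (boolP (startKC w)) => e; last first.
  by rewrite tE_bv // Psi_id.
by rewrite [ap tE _]lin_bv // e ap_in0.
Qed.

Lemma Phi_nn : Phi * nn = nn. Proof. by rewrite -nn_tE mulrA PhitE. Qed.
Lemma Psi_nn : Psi * nn = nn. Proof. by rewrite -nn_tE mulrA PsitE. Qed.

Lemma nf_KC v s j w : nf j (LU (KC v) s :: w) -> full (KC v) /\ st j w = v.
Proof.
move=> h; have := nf_st h => /= ->; split=> //.
by case/and3P: h => /= kv _ _; rewrite /full_kind /= kv.
Qed.

Lemma KC_ind (P : V -> word -> Prop) :
  (forall j w, nf j w -> ~~ startKC w -> P j w) ->
  (forall v s j w, nf j (LU (KC v) s :: w) -> full (KC v) -> st j w = v ->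
     nf j w -> P j w -> P j (LU (KC v) s :: w)) ->
  forall j w, nf j w -> P j w.
Proof.
move=> P0 P1 j; elim=> [|l w IH] h; first exact: P0.
case: l h => [d|[u|d|v] s] h; try exact: P0.
have [fk e] := nf_KC h; have h' := nf_behead h.
by apply: P1 => //; exact: IH.
Qed.

Lemma yy_eE v s u : full (KC v) -> yy v s * eE u = eE u * yy v s.
Proof.
move=> fk; rewrite /yy; case: s.
  by rewrite -mulrA U_eE // mulrA uu_eE mulrA.
by rewrite -mulrA ui_eE mulrA U_eE // mulrA.
Qed.

Lemma yyK v s : full (KC v) -> yy v s * yy v (~~ s) = 1.
Proof.
move=> fk; rewrite /yy; case: s => /=.
  by rewrite -mulrA (mulrA (U _ _)) (UK q dlt true fk) mul1r uuK.
by rewrite -mulrA (mulrA ui) uiK mul1r (UK q dlt false fk).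
Qed.

Lemma lin_comb_eE (f : End M) (a : k) u : f * eE u = eE u * f ->
  (f - a *: (1 : End M)) * eE u = eE u * (f - a *: (1 : End M)).
Proof.
by move=> e; rewrite mulrBl mulrBr e -alg_scalerAl -alg_scalerAr mul1r mulr1.
Qed.

Lemma ap_if (f : End M) b x y : ap f (if b then x else y) = if b then ap f x else ap f y.
Proof. by case: b. Qed.

Lemma ap_comm (f g : End M) m : f * g = g * f -> ap f (ap g m) = ap g (ap f m).
Proof. by move=> e; rewrite -apM e. Qed.

Lemma Phi_eE u : Phi * eE u = eE u * Phi.
Proof.
apply: E_ext => j w h; rewrite !apM eE_bv // ap_if ap_in0.
elim/KC_ind: j w / h => [j w h nk|v s j w h fk e h' IH].
  by rewrite Phi_id // eE_bv.
rewrite Phi_cons // -[RHS]apM -lin_comb_eE ?yy_eE // apM -IH e [st _ _]/=.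
by rewrite ap_if ap_in0.
Qed.

Lemma Psi_eE u : Psi * eE u = eE u * Psi.
Proof.
apply: E_ext => j w h; rewrite !apM eE_bv // ap_if ap_in0.
have fin (g : M) : (if st j w == u then g else 0) = (st j w == u)%:R *: g.
  by case: eqP; rewrite ?scale1r ?scale0r.
rewrite fin; elim/KC_ind: j w / h {fin} => [j w h nk|v s j w h fk e h' IH].
  by rewrite Psi_id // eE_bv //; case: eqP; rewrite ?scale1r ?scale0r.
have IH2 : ap (eE u) (bv j w) = (v == u)%:R *: bv j w.
  by rewrite eE_bv // e; case: eqP; rewrite ?scale1r ?scale0r.
rewrite e in IH; rewrite [st _ _]/=; case: s h => h.
  rewrite Psi_consT // ap_inB !ap_inZ ap_inB -IH !apM.
  rewrite -(ap_comm (ap Psi _) (U_eE q dlt true u fk)) -IH.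
  rewrite -(ap_comm (ap _ (bv j w)) (nn_eE u)) -(ap_comm (bv j w) (U_eE q dlt true u fk)).
  by rewrite IH2 !ap_inZ !scalerBr !scalerA ![_%:R * _]mulrC.
rewrite Psi_consF // ap_inB !ap_inZ -IH.
rewrite -(ap_comm _ (U_eE q dlt false u fk)) [ap (eE u) (_ + _)]ap_inD ap_inZ -IH.
rewrite -(ap_comm _ (nn_eE u)) IH2 !(ap_inZ, ap_inD) !scalerBr !scalerDr !scalerA.
by rewrite ![_%:R * _]mulrC.
Qed.

Section AtVertex.
Variable v : V.
Hypothesis fk : full (KC v).
Local Notation x := (U (KC v) true).
Local Notation xi := (U (KC v) false).

Lemma PhiU s : Phi * U (KC v) s * eE v = yy v s * Phi * eE v.
Proof.
apply: E_ext => j w h; rewrite !apM eE_bv // !ap_if !ap_in0.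
case: eqP => // e; rewrite -!apM; move: e.
elim/KC_ind: j w / h => [j w h nk|v' s' j w h fk' e' h' IH] e; rewrite !apM.
  case: (UP q dlt s fk h) => [ne|w' ew|_ hn _]; first by case: ne.
    by rewrite ew in nk.
  by rewrite ap_inD ap_inZ (Phi_cons hn) apB apZ ap1 addrC subrK.
rewrite /= in e; rewrite e in h fk' e' *.
case: (UP q dlt s fk h) => [ne|w' ew hw' ew'|_ hn _]; first by case: ne.
  case: ew h hw' ew' IH => -> <- h hw' ew' IH; have := IH e'; rewrite !apM => {}IH.
  rewrite ap_inB ap_inZ IH // Phi_cons // apB apZ ap1 ap_inB ap_inZ.
  by rewrite -[ap _ (ap (yy v (~~ s)) _)]apM yyK // ap1.
by rewrite ap_inD ap_inZ (Phi_cons hn) apB apZ ap1 addrC subrK.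
Qed.

Let ap_xxi m : ap x (ap xi m) = m.
Proof. by rewrite -apM (UK q dlt true fk). Qed.

Lemma Psi_x : Psi * x * eE v = q v *: ((x * Psi - nn * x) * eE v).
Proof.
apply: E_ext => j w h; rewrite apZ !apM eE_bv // !ap_if !ap_in0.
case: eqP => [|_]; last by rewrite scaler0.
elim/KC_ind: j w / h => [j w h nk|v' s' j w h fk' e' h' IH] e.
  case: (UP q dlt true fk h) => [ne|w' ew|_ hn _]; first by case: ne.
    by rewrite ew in nk.
  by rewrite ap_inD ap_inZ Psi_consT // addrC subrK apB !apM.
rewrite /= in e; rewrite e in h fk' e' IH *.
case: (UP q dlt true fk h) => [ne|w' ew hw' ew'|_ hn _]; first by case: ne.
  case: ew h hw' ew' IH => -> <- h hw' ew' IH; have {}IH := IH e'.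
  rewrite ap_inB ap_inZ IH !apB !apM [ap x (bv j (_ :: _))](U_consV q dlt (s := true) fk h).
  rewrite [ap Psi (bv j (_ :: _))](Psi_consF h) !ap_inB !ap_inZ ap_xxi.
  set A := ap Psi _; set C := ap nn (bv j w); set B := ap x A; set D := ap nn _.
  (* The term in [nn] from the rule for [x^-1] cancels against the one that [nn x] produces. *)
  have zE (a b1 c1 d1 : M) : a + c1 - b1 - (c1 - d1) = a - (b1 - d1).
    by rewrite [a + c1 - _]addrAC !opprB addrACA subrr addr0 -addrA [- _ + _]addrC.
  rewrite [cst _ _]/= zE -scalerBr.
  by rewrite [RHS]scalerBr !scalerA mulfV ?q_neq0 // scale1r [dlt * _]mulrC.
rewrite ap_inD ap_inZ (Psi_consT hn) apB !apM addrC.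
by rewrite [cst _ _]/= subrK.
Qed.

Lemma yy_at : yy v true * eE v = (q v)^-1 *: (x * eE v) + nn * (x * eE v).
Proof.
rewrite /yy -mulrA U_eE // mulrA uu_at mulrDl -alg_scalerAl.
by rewrite -mulrA.
Qed.

Lemma Psi_yy s : Psi * yy v s * eE v = U (KC v) s * Psi * eE v.
Proof.
have Y1 : Psi * yy v true * eE v = x * Psi * eE v.
  rewrite -mulrA yy_at mulrDr -alg_scalerAr !mulrA Psi_nn Psi_x scalerA.
  by rewrite mulVf ?q_neq0 // scale1r mulrBl subrK.
case: s => //; apply: intertwineV Y1 _ (yyK true fk) (UK q dlt false fk).
exact: yy_eE.
Qed.
End AtVertex.

Lemma LU_full v s j w : nf j (LU (KC v) s :: w) ->
  bv j (LU (KC v) s :: w) = ap ((U (KC v) s - dlt *: (1 : End M)) * eE v) (bv j w).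
Proof.
move=> h; have [fk e] := nf_KC h.
by rewrite apM eE_bv ?(nf_behead h) // e eqxx (LU_U q dlt fk h).
Qed.

Lemma PhiPsi_yy v s : full (KC v) ->
  Phi * Psi * yy v s * eE v = yy v s * (Phi * Psi) * eE v.
Proof.
move=> fk; rewrite -!(mulrA Phi) Psi_yy // -[_ * _ * eE v]mulrA Psi_eE !mulrA.
by rewrite PhiU // -!mulrA -Psi_eE.
Qed.

Lemma xi_at v : full (KC v) -> U (KC v) false * eE v = yy v false * ((q v)^-1 *: eE v + nn * eE v).
Proof. by move=> fk; rewrite -uu_at /yy -mulrA (mulrA ui) uiK mul1r. Qed.

(** [Phi Psi] fixes the words without leading [KC], in particular the values of [nn], and commutes
    with [yy]; and a leading [x] or [x^-1] can be expressed by [yy] and [nn]. *)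
Lemma PhiPsi : Phi * Psi = 1.
Proof.
apply: E_ext => j w h; rewrite ap1.
elim/KC_ind: j w / h => [j w h nk|v s j w h fk e h' IH].
  by rewrite apM Psi_id // Phi_id.
have ew : ap (eE v) (bv j w) = bv j w by rewrite eE_bv // e eqxx.
have Gn m : ap (Phi * Psi) (ap nn m) = ap nn m.
  by rewrite -apM -mulrA Psi_nn Phi_nn.
have Gy s' m : ap (eE v) m = m ->
    ap (Phi * Psi) (ap (yy v s') m) = ap (yy v s') (ap (Phi * Psi) m).
  by move=> <-; rewrite -apM -[RHS]apM -[RHS]apM -apM mulrA PhiPsi_yy.
have e2 m : ap (eE v) m = m -> ap (eE v) (ap nn m) = ap nn m.
  by move=> em; rewrite -(ap_comm m (nn_eE v)) em.
have -> : bv j (LU (KC v) s :: w) = ap (U (KC v) s) (bv j w) - dlt *: bv j w.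
  by rewrite LU_full // apM ew apB apZ ap1.
rewrite ap_inB ap_inZ IH; congr (_ - _).
case: s h => h.
  have -> : ap (U (KC v) true) (bv j w) =
      q v *: (ap (yy v true) (bv j w) - ap nn (ap (U (KC v) true) (bv j w))).
    have := congr1 (fun f => ap f (bv j w)) (yy_at fk).
    rewrite apD apZ !apM ew => ->; rewrite addrK scalerA mulfV ?q_neq0 //.
    by rewrite scale1r.
  by rewrite ap_inZ ap_inB Gn Gy // IH.
have -> : ap (U (KC v) false) (bv j w) =
    ap (yy v false) ((q v)^-1 *: bv j w + ap nn (bv j w)).
  have := congr1 (fun f => ap f (bv j w)) (xi_at fk).
  by rewrite !apM apD apZ apM ew.
rewrite Gy; first by rewrite ap_inD ap_inZ IH Gn.
by rewrite ap_inD ap_inZ ew e2.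
Qed.

Lemma PsiPhi : Psi * Phi = 1.
Proof.
apply: E_ext => j w h; rewrite ap1.
elim/KC_ind: j w / h => [j w h nk|v s j w h fk e h' IH].
  by rewrite apM Phi_id // Psi_id.
have ew : ap (eE v) (bv j w) = bv j w by rewrite eE_bv // e eqxx.
have ep : ap (eE v) (ap Phi (bv j w)) = ap Phi (bv j w).
  by rewrite -(ap_comm _ (Phi_eE v)) ew.
rewrite apM Phi_cons // apB apZ ap1 ap_inB ap_inZ -[ap Psi (ap Phi _)]apM IH.
rewrite -{1}ep -[ap Psi _]apM -[ap _ (ap (eE v) _)]apM Psi_yy // !apM ep -[ap Psi _]apM IH.
by rewrite LU_full // apM ew apB apZ ap1.
Qed.
End Cycle.

(** * The generators of [L] *)

Section PLift.
Variables (k : fieldType) (X : choiceType) (R : free_alg k X -> Prop) (A : algebra k).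
Variable g : X -> A.
Hypothesis gR : forall z, R z -> free_lift g z = 0.

Definition plift : presented R -> A := quo_lift (S := R) (free_lift g).

Lemma plift_hom : alg_hom plift.
Proof. exact: quo_lift_hom (free_lift_hom g) gR. Qed.

Lemma plift_gen x : plift (presented_gen R x) = g x.
Proof. by rewrite /plift quo_lift_proj ?free_lift_gen //; exact: free_lift_hom. Qed.
End PLift.

Section Idempotents.
Variables (k : fieldType) (A : algebra k) (V : finType) (e : V -> A).
Definition idempotents : Prop :=
  [/\ forall i, e i * e i = e i, forall i j, i != j -> e i * e j = 0 & \sum_i e i = 1].

Lemma idempotents_hom (B : algebra k) (f : B -> A) (eB : V -> B) z :
  alg_hom f -> (forall i, f (eB i) = e i) -> idempotents ->
  idempotent_rel eB z -> f z = 0.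
Proof.
move=> hf fe [e1 e2 e3] [i|i j ne|].
- by rewrite (homB hf) (homM hf) fe e1 subrr.
- by rewrite (homM hf) !fe e2.
- rewrite (homB hf) (hom_sum hf) (hom1 hf) -e3; apply/eqP; rewrite subr_eq0; apply/eqP.
  by apply: eq_bigr => i _; rewrite fe.
Qed.
End Idempotents.

(* Besides [L], which is universal for these relations, [End M] and the free
   product carry such families. *)
Record Lrel (k : fieldType) (Q : quiver) (A : algebra k)
    (e : vertex Q -> A) (a y : dart Q -> A) : Prop := LRel {
  Lrel_idem : idempotents e;
  Lrel_tail : forall d, e (dtail d) * a d = a d;
  Lrel_head : forall d, a d * e (dhead d) = a d;
  Lrel_xy : forall d, (1 + a d * a (star d)) * y d = 1;
  Lrel_yx : forall d, y d * (1 + a d * a (star d)) = 1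
}.

Section LModel.
Variables (k : fieldType) (Q : quiver) (A : algebra k).
Variables (e : vertex Q -> A) (a y : dart Q -> A).
Hypothesis H : Lrel e a y.
Implicit Types (d : dart Q) (v : vertex Q).

Definition Lunit d (s : bool) : A := if s then 1 + a d * a (star d) else y d.
Local Notation X := Lunit.

Lemma eK v : e v * e v = e v. Proof. by case: H => -[]. Qed.
Lemma e_orth u v : u != v -> e u * e v = 0.
Proof. by case: H => -[_ h _] *; exact: h. Qed.
Lemma e_sum : \sum_v e v = 1. Proof. by case: H => -[]. Qed.

Lemma e_a v d : e v * a d = if v == dtail d then a d else 0.
Proof.
case: eqP => [->|/eqP ne]; first exact: (Lrel_tail H).
by rewrite -(Lrel_tail H) mulrA e_orth // mul0r.
Qed.

Lemma a_e v d : a d * e v = if v == dhead d then a d else 0.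
Proof.
case: eqP => [->|/eqP ne]; first exact: (Lrel_head H).
by rewrite -(Lrel_head H) -mulrA e_orth ?mulr0 // eq_sym.
Qed.

Lemma XK d s : X d s * X d (~~ s) = 1.
Proof. by case: s; [exact: (Lrel_xy H) | exact: (Lrel_yx H)]. Qed.

Lemma X_aa d : a d * a (star d) = X d true - 1.
Proof. by rewrite /X addrC addKr. Qed.

Lemma comm_inv (R : pzRingType) (x x' z : R) : x * x' = 1 -> x' * x = 1 ->
  x * z = z * x -> x' * z = z * x'.
Proof.
by move=> xy yx xe; rewrite -[LHS]mulr1 -xy mulrA -(mulrA x') -xe mulrA yx mul1r.
Qed.

Lemma X_e d s v : X d s * e v = e v * X d s.
Proof.
have E : X d true * e v = e v * X d true.
  rewrite /X mulrDl mulrDr mul1r mulr1 -mulrA a_e mulrA e_a dhead_star.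
  by case: eqP; rewrite ?mulr0 ?mul0r.
by case: s => //; exact: comm_inv (XK d true) (XK d false) E.
Qed.

Lemma X_off d s v : v != dtail d -> X d s * e v = e v.
Proof.
move=> ne; have E : X d true * e v = e v.
  by rewrite /X mulrDl mul1r -mulrA a_e dhead_star (negbTE ne) mulr0 addr0.
by case: s => //; rewrite -{1}E mulrA (XK d false) mul1r.
Qed.

Lemma a_X d s : a d * X (star d) s = X d s * a d.
Proof.
have E : a d * X (star d) true = X d true * a d.
  by rewrite /X starK mulrDl mulrDr mul1r mulr1 mulrA.
case: s => //; rewrite -[LHS]mul1r -(XK d false) -!mulrA; congr (_ * _).
by rewrite mulrA -E -mulrA (XK (star d) true) mulr1.
Qed.

Lemma X_inv_uniq d z : X d true * z = 1 -> z = X d false.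
Proof. by move=> h; rewrite -[LHS]mul1r -(XK d false) -mulrA h mulr1. Qed.

Lemma X_starF d : X (star d) false = 1 - a (star d) * X d false * a d.
Proof.
symmetry; apply: X_inv_uniq.
have -> : X (star d) true = 1 + a (star d) * a d by rewrite /X starK.
rewrite mulrDl mul1r mulrBr mulr1.
have -> : a (star d) * a d * (a (star d) * X d false * a d) =
    a (star d) * (a d * a (star d) * X d false) * a d by rewrite !mulrA.
rewrite X_aa mulrBl (XK d true) mul1r mulrBr mulr1 mulrBl subKr.
by rewrite subrK.
Qed.
End LModel.

Section LAlg.
Variables (k : fieldType) (Q : quiver).
Local Notation L := (algL k Q).

Lemma L_Lrel : Lrel (@Le k Q) (@La k Q) (@Linv k Q).
Proof.
pose pr := quo_proj (@algL_rel k Q).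
have hpr : alg_hom pr by exact: quo_proj_hom.
have pr0 z : @algL_rel k Q z -> pr z = 0.
  move=> h; rewrite -(hom0 hpr); apply/quo_projP; rewrite subr0.
  exact: ideal_gen_in.
have prB x z : @algL_rel k Q (x - z) -> pr x = pr z.
  by move=> /pr0; rewrite (homB hpr) => /eqP; rewrite subr_eq0 => /eqP.
have prM := homM hpr; have prD := homD hpr; have pr1 := hom1 hpr.
split; first split.
- by move=> i; have := prB _ _ (algL_idem (idem_sqr _ i)); rewrite prM.
- by move=> i j ne; have := pr0 _ (algL_idem (idem_orth _ ne)); rewrite prM.
- by have := prB _ _ (algL_idem (idem_sum _)); rewrite (hom_sum hpr) pr1.
- by move=> d; have := prB _ _ (algL_tail _ d); rewrite prM.
- by move=> d; have := prB _ _ (algL_head _ d); rewrite prM.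
- by move=> d; have := prB _ _ (algL_invr _ d); rewrite prM prD pr1 prM.
- by move=> d; have := prB _ _ (algL_invl _ d); rewrite prM prD pr1 prM.
Qed.

Lemma L_ind (P : L -> Prop) :
  (forall c x y, P x -> P y -> P (c *: x + y)) -> P 1 ->
  (forall x y, P x -> P y -> P (x * y)) ->
  (forall v, P (Le k v)) -> (forall d, P (La k d)) -> (forall d, P (Linv k d)) ->
  forall z, P z.
Proof.
move=> PL P1 PM Pe Pa Px; apply: presented_ind => // -[v|[d|d]]; [exact: Pe | exact: Pa |].
exact: Px.
Qed.

Variables (A : algebra k) (e : vertex Q -> A) (a y : dart Q -> A).
Hypothesis H : Lrel e a y.

Definition Lgens (x : vertex Q + (dart Q + dart Q)) : A :=
  match x with inl v => e v | inr (inl d) => a d | inr (inr d) => y d end.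

Definition Llift : L -> A := @plift k _ (@algL_rel k Q) A Lgens.

Lemma Llift_rel z : @algL_rel k Q z -> free_lift Lgens z = 0.
Proof.
have hf := free_lift_hom Lgens; have gE := free_lift_gen Lgens.
case: H => e_idem a_tail a_head ay ya.
case=> {z} [z iz|d|d|d|d].
- by apply: (idempotents_hom (e := e) hf _ e_idem iz) => i; exact: gE.
- by rewrite (homB hf) (homM hf) !gE a_tail subrr.
- by rewrite (homB hf) (homM hf) !gE a_head subrr.
- by rewrite (homB hf) (homM hf) (homD hf) (homM hf) (hom1 hf) !gE ay subrr.
- by rewrite (homB hf) (homM hf) (homD hf) (homM hf) (hom1 hf) !gE ya subrr.
Qed.

Lemma Llift_hom : alg_hom Llift. Proof. exact: plift_hom Llift_rel. Qed.
Lemma Llift_e v : Llift (Le k v) = e v. Proof. exact: plift_gen Llift_rel _. Qed.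
Lemma Llift_a d : Llift (La k d) = a d. Proof. exact: plift_gen Llift_rel _. Qed.
Lemma Llift_y d : Llift (Linv k d) = y d. Proof. exact: plift_gen Llift_rel _. Qed.
Lemma Llift_x d s : Llift (Lx k d s) = Lunit a y d s.
Proof.
case: s; last exact: Llift_y.
by rewrite (homD Llift_hom) (hom1 Llift_hom) (homM Llift_hom) !Llift_a.
Qed.
End LAlg.

Section CycleFacts.
Variables (Q : quiver) (n : nat) (c : 'I_n -> dart Q).
Implicit Types (d : dart Q).
Hypothesis c_cyc : is_cycle c.

Definition fwd d : bool := [exists i, c i == d].

Lemma c_inj i i' : dtail (c i) = dtail (c i') -> i = i'.
Proof. by case: c_cyc => h _ _ /h. Qed.

Lemma c_next i : dhead (c i) = dtail (c (ordS i)). Proof. by case: c_cyc. Qed.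

Lemma fwd_c i : fwd (c i). Proof. by apply/existsP; exists i. Qed.

Lemma fwd_cs i : fwd (star (c i)) = false.
Proof.
case: c_cyc => _ inj _; apply/existsP => -[i' /eqP e].
have ii : i' = i by apply: inj; rewrite e.
by move: e; rewrite ii => /eqP; rewrite eq_sym star_neq.
Qed.

Lemma off_c i : off_cycle c (c i) = false.
Proof. by apply/forallP => /(_ i); rewrite eqxx. Qed.

Lemma on_c i : on_cycle c (dtail (c i)).
Proof. by apply/existsP; exists i. Qed.

Lemma cyc_dartP d : ~~ off_cycle c d -> (exists i, d = c i) \/ (exists i, d = star (c i)).
Proof.
rewrite negb_forall => /existsP[i]; rewrite negbK => /eqP e.
have [e2|ne] := eqVneq d.2 (c i).2; [left | right]; exists i.
  by rewrite [d]surjective_pairing [c i]surjective_pairing e e2.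
rewrite [d]surjective_pairing /star e; congr (_, _).
by move: ne; case: d.2 (c i).2 => -[].
Qed.

Lemma on_cyc_dart d : ~~ off_cycle c d -> on_cycle c (dtail d).
Proof.
by case/cyc_dartP=> -[i ->]; rewrite ?dtail_star ?c_next on_c.
Qed.

Lemma fwd_star d : ~~ off_cycle c d -> fwd (star d) = ~~ fwd d.
Proof.
by case/cyc_dartP=> -[i ->]; rewrite ?starK ?fwd_c ?fwd_cs ?fwd_c.
Qed.
(** Exactly two darts of the cycle start at a given vertex of it, the arrow leaving it and the dual
    of the arrow arriving there, and the order lists them in this way. *)
Lemma cycle_order_at (R : pzRingType) (f : dart Q -> R) i :
  \prod_(d <- cycle_order c | dtail d == dtail (c i)) f d =
  f (c i) * f (star (c (ord_pred i))).
Proof.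
have one (P : pred 'I_n) (g : 'I_n -> R) i0 : P =1 pred1 i0 ->
    \prod_(i <- enum 'I_n | P i) g i = g i0.
  move=> Pi; rewrite -big_filter (eq_filter Pi).
  by rewrite filter_pred1_uniq ?enum_uniq ?mem_enum // big_seq1.
rewrite /cycle_order big_cat !big_map; congr (_ * _).
  rewrite -enumT; apply: (one (fun i' => dtail (c i') == _) (fun i' => f (c i')) i) => i' /=.
  by apply/eqP/eqP => [e|->//]; exact: c_inj.
rewrite -enumT; apply: (one (fun i' => dtail (star (c i')) == _)
  (fun i' => f (star (c i'))) (ord_pred i)) => i' /=.
rewrite dtail_star c_next; apply/eqP/eqP => [e|->].
  by rewrite -(c_inj e) ordSK.
by rewrite ord_predK.
Qed.

Lemma cycle_order_off (R : pzRingType) (f : dart Q -> R) v : ~~ on_cycle c v ->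
  \prod_(d <- cycle_order c | dtail d == v) f d = 1.
Proof.
move=> nv; rewrite big_seq_cond big_pred0 // => d.
apply/negP => /andP[dc /eqP dv]; case/negP: nv; rewrite -dv; apply: on_cyc_dart.
by move: dc; rewrite mem_cat => /orP[] /mapP[i _ ->]; rewrite ?off_star off_c.
Qed.
End CycleFacts.

(** * The action of [L] for a prescribed action of [rho] *)

Section Act.
Variables (k : fieldType) (Q : quiver) (n : nat) (c : 'I_n -> dart Q).
Variables (F : {set dart Q}) (q : vertex Q -> k) (dlt : k).

Local Notation V := (vertex Q).
Local Notation word := (seq (lett Q)).
Implicit Types (j v : V) (w : word) (s : bool) (d : dart Q) (l : lett Q).
Implicit Types (kp : kind Q).
Local Notation M := (M k c F).
Local Notation U := (U c F q dlt).
Local Notation eE := (eE k c F).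
Local Notation tE := (tE k c F).
Local Notation kap := (kap c).
Local Notation full := (full_kind c F).
Local Notation A0 := (A0 c F q dlt).
Local Notation QE := (QE c F q dlt).

Hypothesis c_cyc : is_cycle c.
Hypothesis F_off : {in F, forall d, off_cycle c d}.
Hypothesis F_star : {in F, forall d, star d \notin F}.
Hypothesis F_tail : {in F, forall a, ~~ on_cycle c (dtail a)}.
Hypothesis q_neq0 : forall v, q v != 0.

Variables (eps : dart Q -> bool) (par : V -> dart Q) (sQ : seq (dart Q)).
Variables (dep : V -> nat) (Rho : bool -> End M).

Hypothesis eps_c : forall i, eps (c i) = true.
Hypothesis eps_cs : forall i, eps (star (c i)) = false.
Hypothesis sQ_mem : forall d, (d \in sQ) = off_cycle c d.
Hypothesis sQ_uniq : uniq sQ.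
Hypothesis F_par : {in F, forall a, par (dtail a) = a}.
Hypothesis par_F : forall v, ~~ on_cycle c v -> par v \in F /\ dtail (par v) = v.
Hypothesis F_dep : {in F, forall a, (dep (dhead a) < dep (dtail a))%N}.
Hypothesis RhoK : forall s, Rho s * Rho (~~ s) = 1.
Hypothesis Rho_eE : forall s v, Rho s * eE v = eE v * Rho s.
Hypothesis Rho_tE : forall s, tE * (Rho s - QE s) = Rho s - QE s.

Local Notation X := (XX q dlt eps par sQ dep Rho).
Let Xg := XX_gunit q dlt F_off F_star eps par dep sQ_mem RhoK Rho_eE.
Local Notation Xoff := (off_unit q dlt X).
Local Notation Phi := (Phi q dlt X eps sQ Rho).
Local Notation Psi := (Psi q dlt X eps sQ Rho).

(** [A0 (c i)] takes words at the head of [c i] and the operator of its dual produces words there,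
    so in both cases the twist happens at the head. The units at the tail stay [x]. *)
Definition arrowE d : End M :=
  if off_cycle c d then
    if d \in F then AF d (X (dtail d))
    else if star d \in F then AS k c F (star d) else A0 d
  else if fwd c d then A0 d * Psi else Phi * A0 d.

Definition unitE d s : End M :=
  if off_cycle c d then Xoff d s
  else if fwd c d then U (KC (dtail d)) s else Phi * U (KC (dtail d)) s * Psi.

Lemma full_plain d : off_cycle c d -> d \notin F -> star d \notin F -> full (kap d).
Proof. by move=> od dF sF; rewrite /full_kind kapE od /= od dF (negbTE sF). Qed.

Lemma full_cyc d : ~~ off_cycle c d -> full (kap d).
Proof.
by move=> od; rewrite /full_kind kapE (negbTE od) /= (on_cyc_dart c_cyc od).
Qed.

Let PsiPhi1 : Psi * Phi = 1 :=
  PsiPhi F_off F_star F_tail q_neq0 eps Xg sQ_mem RhoK Rho_eE Rho_tE.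
Let PhiPsi1 : Phi * Psi = 1 :=
  PhiPsi F_off F_star F_tail q_neq0 eps Xg sQ_mem RhoK Rho_eE Rho_tE.
Let PhiE u : Phi * eE u = eE u * Phi :=
  Phi_eE q dlt F_off F_star eps Xg sQ_mem Rho_eE u.
Let PsiE u : Psi * eE u = eE u * Psi :=
  Psi_eE q dlt F_off F_star eps Xg sQ_mem Rho_eE u.

Let kap_cyc d : ~~ off_cycle c d -> kap d = KC (dtail d).
Proof. by move=> od; rewrite kapE (negbTE od). Qed.

Lemma full_KC d : ~~ off_cycle c d -> full (KC (dtail d)).
Proof. by move=> od; rewrite -kap_cyc ?full_cyc. Qed.

Lemma XE_gunit d : gunit (unitE d) (dtail d).
Proof.
rewrite /unitE; case: (boolP (off_cycle c d)) => od; first exact: (Xoff_gunit q dlt F_off F_star Xg).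
have fk := full_KC od; have [UK1 UC1 UO] := U_gunit q dlt fk.
case: (fwd c d); first exact: (U_gunit q dlt fk).
split=> [s|s u|s u ne].
- rewrite -!mulrA (mulrA Psi) PsiPhi1 mul1r (mulrA (U _ _)) UK1 mul1r.
  exact: PhiPsi1.
- by rewrite -!mulrA PsiE (mulrA (U _ _)) UC1 !mulrA PhiE.
- by rewrite -!mulrA PsiE (mulrA (U _ _)) UO // mulrA PhiE -mulrA PhiPsi1 mulr1.
Qed.

Let full2 d : d \notin F -> star d \notin F -> full (kap d) /\ full (kap (star d)).
Proof.
move=> dF sF; case: (boolP (off_cycle c d)) => od.
  by split; apply: full_plain; rewrite ?starK.
by split; apply: full_cyc.
Qed.

Let cyc_notF d : ~~ off_cycle c d -> d \notin F /\ star d \notin F.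
Proof.
move=> od; split; apply: contra od => /F_off //.
Qed.

Lemma AE_eE d v : arrowE d * eE v = if v == dhead d then arrowE d else 0.
Proof.
rewrite /arrowE; case: (boolP (off_cycle c d)) => od.
  case: (boolP (d \in F)) => dF; first exact: AF_eE.
  case: (boolP (star d \in F)) => sF; last exact: A0_eE.
  by rewrite AS_eE ?dtail_star //.
case: (fwd c d).
  by rewrite -mulrA PsiE mulrA A0_eE; case: eqP; rewrite ?mul0r.
by rewrite -mulrA A0_eE; case: eqP; rewrite ?mulr0.
Qed.

Lemma eE_AE d v : eE v * arrowE d = if v == dtail d then arrowE d else 0.
Proof.
rewrite /arrowE; case: (boolP (off_cycle c d)) => od.
  case: (boolP (d \in F)) => dF.
    by apply: eE_AF => // u; case: (Xg (dtail d)) => _ -> _.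
  case: (boolP (star d \in F)) => sF; first by rewrite eE_AS ?dhead_star.
  by have [fd fs] := full2 dF sF; apply: eE_A0.
have [dF sF] := cyc_notF od; have [fd fs] := full2 dF sF.
case: (fwd c d).
  by rewrite mulrA eE_A0 //; case: eqP; rewrite ?mul0r.
by rewrite mulrA -PhiE -mulrA eE_A0 //; case: eqP; rewrite ?mulr0.
Qed.

Lemma AE_AE d : arrowE d * arrowE (star d) = unitE d true - 1.
Proof.
have g := XE_gunit d; rewrite (gunit_at true g); move: {g} (g).
rewrite /arrowE /unitE off_star starK; case: (boolP (off_cycle c d)) => od g.
  case: (boolP (d \in F)) => dF.
    by rewrite (negbTE (F_star dF)) AF_AS // /off_unit dF.
  case: (boolP (star d \in F)) => sF.
    rewrite -(gunit_at true g) /off_unit (negbTE dF) sF.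
    by rewrite addrC addKr.
  have [fd fs] := full2 dF sF; rewrite A0A // /off_unit (negbTE dF) (negbTE sF).
  by rewrite kapE od.
have [dF sF] := cyc_notF od; have [fd fs] := full2 dF sF.
rewrite fwd_star //; case: (boolP (fwd c d)) g => fw g /=.
  by rewrite -mulrA (mulrA Psi) PsiPhi1 mul1r A0A // kap_cyc.
rewrite -mulrA (mulrA (A0 d)) A0A // kap_cyc // -(mulrA (U _ _ - 1)) -PsiE !mulrA.
by congr (_ * _); rewrite mulrBr mulr1 mulrBl PhiPsi1.
Qed.

Lemma Act_Lrel : Lrel eE arrowE (unitE^~ false).
Proof.
have XT d : 1 + arrowE d * arrowE (star d) = unitE d true by rewrite AE_AE addrC subrK.
split=> [|d|d|d|d].
- split; [exact: eEE | exact: eE_orth | exact: eE_sum].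
- by rewrite eE_AE eqxx.
- by rewrite AE_eE eqxx.
- by rewrite XT; case: (XE_gunit d) => h _ _; exact: (h true).
- by rewrite XT; case: (XE_gunit d) => h _ _; exact: (h false).
Qed.

Lemma Act_Lunit d s : Lunit arrowE (unitE^~ false) d s = unitE d s.
Proof. by case: s; rewrite /Lunit // AE_AE addrC subrK. Qed.

Lemma gunit_prod_at (f : dart Q -> bool -> End M) (g : dart Q -> bool) ds v :
  (forall d, gunit (f d) (dtail d)) ->
  (\prod_(d <- ds) f d (g d)) * eE v = (\prod_(d <- ds | dtail d == v) f d (g d)) * eE v.
Proof.
move=> fg; elim: ds => [|d ds IH]; first by rewrite !big_nil.
have [_ fC fo] := fg d; rewrite !big_cons -mulrA IH; case: eqP => [e|/eqP ne].
  by rewrite mulrA.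
have PC : (\prod_(d <- ds | dtail d == v) f d (g d)) * eE v =
    eE v * (\prod_(d <- ds | dtail d == v) f d (g d)).
  elim: (ds) => [|b bs IHb]; first by rewrite big_nil mul1r mulr1.
  rewrite big_cons; case: ifP => // _; have [_ bC _] := fg b.
  by rewrite -mulrA IHb mulrA bC mulrA.
by rewrite PC mulrA fo // eq_sym.
Qed.

Lemma eE_ext (f g : End M) : (forall v, f * eE v = g * eE v) -> f = g.
Proof.
move=> h; rewrite -[f]mulr1 -[g]mulr1 -(eE_sum k c F) !mulr_sumr.
by apply: eq_bigr => v _.
Qed.

(** Off the cycle this is the equation that [XX] solves. On the cycle the two units of the cycle
    contribute [x x^-1 uu^-1 = rho rho_{Q'}^-1], and the remaining arrows contribute [rho_{Q'}]. *)
Lemma Act_rho : \prod_(d <- cycle_order c ++ sQ) unitE d (eps d) = Rho true.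
Proof.
apply: eE_ext => v.
rewrite (gunit_prod_at _ _ _ XE_gunit) big_cat /=.
have Qp : \prod_(d <- sQ | dtail d == v) unitE d (eps d) = Xprod q dlt X eps v sQ true.
  rewrite /Xprod big_seq_cond [RHS]big_seq_cond; apply: eq_bigr => d /andP[ds _].
  by rewrite /unitE -sQ_mem ds.
rewrite Qp; case: (boolP (on_cycle c v)) => [/existsP[i /eqP iv]|nv]; last first.
  rewrite cycle_order_off // mul1r.
  exact: (XX_rho q dlt F_off F_star eps sQ_mem sQ_uniq F_par par_F F_dep RhoK Rho_eE nv).
have od : ~~ off_cycle c (c i) by rewrite off_c.
have fk : full (KC v) by rewrite -iv; exact: full_KC.
have -> : \prod_(d <- cycle_order c | dtail d == v) unitE d (eps d) =
    U (KC v) true * (Phi * U (KC v) false * Psi).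
  rewrite -iv (cycle_order_at c_cyc (fun d => unitE d (eps d))) iv.
  rewrite eps_c eps_cs /unitE off_star !off_c fwd_c fwd_cs // iv dtail_star (c_next c_cyc).
  by rewrite ord_predK iv.
have Qv : Xprod q dlt X eps v sQ true * eE v = rhoQ q dlt X eps sQ true * eE v.
  rewrite -Qp -(gunit_prod_at _ _ _ XE_gunit) /rhoQ; congr (_ * _).
  by apply: eq_big_seq => d ds; rewrite /unitE -sQ_mem ds.
have rC := rhoQ_eE q dlt F_off F_star eps Xg sQ_mem.
have rK := rhoQK q dlt F_off F_star eps Xg sQ_mem.
have PU := PhiU q dlt F_off F_star eps Xg sQ_mem RhoK fk.
have xE : Phi * U (KC v) false * Psi * eE v = yy q dlt X eps sQ Rho v false * eE v.
  rewrite -mulrA PsiE mulrA PU -mulrA -PsiE mulrA -(mulrA _ Phi) PhiPsi1.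
  by rewrite mulr1.
have yE : U (KC v) true * (Phi * U (KC v) false * Psi) * eE v =
    Rho true * rhoQ q dlt X eps sQ false * eE v.
  rewrite -mulrA xE /yy /ui -(mulrA (U (KC v) false)) (mulrA (U (KC v) true)).
  by rewrite (UK q dlt true fk) mul1r.
rewrite -mulrA Qv rC mulrA yE -(mulrA _ (eE v)) -rC mulrA -(mulrA (Rho true)).
by rewrite (rK false) mulr1.
Qed.

Lemma Act_rhoV : \prod_(d <- rev (cycle_order c ++ sQ)) unitE d (~~ eps d) = Rho false.
Proof.
have XK' ds : (\prod_(d <- rev ds) unitE d (~~ eps d)) * (\prod_(d <- ds) unitE d (eps d)) = 1.
  elim: ds => [|d ds IH] /=; first by rewrite !big_nil mul1r.
  rewrite big_cons rev_cons big_rcons /=; have [XK1 _ _] := XE_gunit d.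
  by rewrite -mulrA [unitE _ _ * (_ * _)]mulrA -{2}[eps d]negbK XK1 mul1r.
have := XK' (cycle_order c ++ sQ); rewrite Act_rho.
set P := \big[_/_]_(_ <- _) _ => h.
by rewrite -[P]mulr1 -{1}(RhoK true) mulrA h mul1r.
Qed.
End Act.

Section UnitProducts.
Variables (k : fieldType) (Q : quiver) (A : algebra k).
Variables (e : vertex Q -> A) (a y : dart Q -> A).
Hypothesis H : Lrel e a y.
Local Notation X := (Lunit a y).
Implicit Types (d : dart Q) (v : vertex Q) (ds : seq (dart Q)) (g : dart Q -> bool).

Lemma prod_X_e g ds (P : pred (dart Q)) v :
  (\prod_(d <- ds | P d) X d (g d)) * e v = e v * (\prod_(d <- ds | P d) X d (g d)).
Proof.
elim: ds => [|d ds IH]; first by rewrite big_nil mul1r mulr1.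
by rewrite big_cons; case: ifP => // _; rewrite -mulrA IH mulrA (X_e H) mulrA.
Qed.

Lemma prod_X_at g ds v :
  (\prod_(d <- ds) X d (g d)) * e v = (\prod_(d <- ds | dtail d == v) X d (g d)) * e v.
Proof.
elim: ds => [|d ds IH]; first by rewrite !big_nil.
rewrite !big_cons -mulrA IH; case: eqP => [_|/eqP ne]; first by rewrite mulrA.
by rewrite prod_X_e mulrA (X_off H) // eq_sym.
Qed.

Lemma prod_XK g ds (P : pred (dart Q)) :
  (\prod_(d <- ds | P d) X d (g d)) * (\prod_(d <- rev ds | P d) X d (~~ g d)) = 1.
Proof.
elim: ds => [|d ds IH] /=; first by rewrite !big_nil mul1r.
rewrite big_cons rev_cons big_rcons; case: ifP => _ /=; last by rewrite mulr1 IH.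
by rewrite -mulrA [_ * (_ * X _ _)]mulrA IH mul1r (XK H).
Qed.

Lemma prod_XKV g ds (P : pred (dart Q)) :
  (\prod_(d <- rev ds | P d) X d (~~ g d)) * (\prod_(d <- ds | P d) X d (g d)) = 1.
Proof.
elim: ds => [|d ds IH] /=; first by rewrite !big_nil mul1r.
rewrite big_cons rev_cons big_rcons; case: ifP => _ /=; last by rewrite mulr1 IH.
by rewrite -mulrA [X _ _ * (_ * _)]mulrA -{2}[g d]negbK (XK H) mul1r.
Qed.
End UnitProducts.

Section LetterValues.
Variables (k : fieldType) (Q : quiver) (n : nat) (c : 'I_n -> dart Q).
Variables (q : vertex Q -> k) (dlt : k) (A : algebra k).
Variables (e : vertex Q -> A) (a y : dart Q -> A) (rh : bool -> A).
Local Notation X := (Lunit a y).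

(** The default 1 keeps this a unit at the vertices off the cycle. *)
Definition xC v s : A := if [pick i | dtail (c i) == v] is Some i then X (c i) s else 1.

Definition gU (kp : kind Q) s : A :=
  match kp with KR _ => rh s | KX d => X d s | KC v => xC v s end.

Definition lval (l : lett Q) : A :=
  match l with
  | LA d => a d
  | LU kp s => e (kvert kp) * (gU kp s - cst q dlt kp s *: (1 : A))
  end.

Definition word_val (w : seq (lett Q)) : A := \prod_(l <- w) lval l.

Lemma xC_c i s : is_cycle c -> xC (dtail (c i)) s = X (c i) s.
Proof.
move=> cyc; rewrite /xC; case: pickP => [i' /eqP /(c_inj cyc) -> //|].
by move/(_ i); rewrite eqxx.
Qed.
End LetterValues.

Section LetterHom.
Variables (k : fieldType) (Q : quiver) (n : nat) (c : 'I_n -> dart Q).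
Variables (q : vertex Q -> k) (dlt : k) (A B : algebra k).
Variables (e : vertex Q -> A) (a y : dart Q -> A) (rh : bool -> A).
Variables (e' : vertex Q -> B) (a' y' : dart Q -> B) (rh' : bool -> B).
Variable f : A -> B.
Hypothesis hf : alg_hom f.
Hypothesis fe : forall v, f (e v) = e' v.
Hypothesis fa : forall d, f (a d) = a' d.
Hypothesis fy : forall d, f (y d) = y' d.

Lemma hom_Lunit d s : f (Lunit a y d s) = Lunit a' y' d s.
Proof. by case: s; rewrite /Lunit ?fy // (homD hf) (hom1 hf) (homM hf) !fa. Qed.

Lemma hom_lval l : (forall s, f (rh s) = rh' s) ->
  f (lval c q dlt e a y rh l) = lval c q dlt e' a' y' rh' l.
Proof.
move=> fr; case: l => [d|kp s] /=; first exact: fa.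
rewrite (homM hf) (homB hf) (homZ hf) (hom1 hf) fe; congr (_ * (_ - _)).
case: kp => [v|d|v] /=; [exact: fr | exact: hom_Lunit |].
by rewrite /xC; case: pickP => *; rewrite ?(hom1 hf) ?hom_Lunit.
Qed.
End LetterHom.

Section EndWords.
Variables (k : fieldType) (Q : quiver) (n : nat) (c : 'I_n -> dart Q).
Variables (F : {set dart Q}) (q : vertex Q -> k) (dlt : k).
Local Notation V := (vertex Q).
Implicit Types (j v : V) (s : bool) (d : dart Q).
Local Notation M := (M k c F).
Local Notation nf := (nf c F).
Local Notation bv := (bv k c F).
Local Notation U := (U c F q dlt).
Local Notation eE := (eE k c F).
Local Notation full := (full_kind c F).
Hypothesis c_cyc : is_cycle c.
Hypothesis F_off : {in F, forall d, off_cycle c d}.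
Hypothesis F_star : {in F, forall d, star d \notin F}.
Variables (eps : dart Q -> bool) (par : V -> dart Q) (sQ : seq (dart Q)).
Variables (dep : V -> nat) (Rho : bool -> End M).
Local Notation AE := (arrowE q dlt eps par sQ dep Rho).
Local Notation XE := (unitE q dlt eps par sQ dep Rho).
Local Notation lvalE := (lval c q dlt eE AE (XE^~ false) Rho).

Definition isKR (l : lett Q) : bool := if l is LU (KR _) _ then true else false.

Hypothesis Act_Lunit' : forall d s, Lunit AE (XE^~ false) d s = XE d s.

(** An arrow of the cycle before a letter of [x] is a pattern. Hence [Phi] and [Psi] fix the words
    involved when an arrow is prepended with normal result. *)
Lemma head_notKC d j w : ~~ off_cycle c d -> nf j (LA d :: w) -> ~~ startKC w.
Proof.
move=> od h; case/and3P: h => _ /andP[/eqP e b] h; case: w e b h => //= -[//|[//|//|v] s] w.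
move=> /= e b _; move: b; rewrite kapE off_star (negbTE od) dtail_star e eqxx //.
Qed.

(** The letters of [rho] are left out because they act through the arbitrary [Rho]. *)
Lemma lvalE_word l j w : ~~ isKR l -> nf j (l :: w) ->
  ap (lvalE l) (bv j w) = bv j (l :: w).
Proof.
case: l => [d|kp s] nR h.
  rewrite [lval _ _ _ _ _ _ _ _]/= /arrowE; case: (boolP (off_cycle c d)) => od.
    case: (boolP (d \in F)) => dF; first exact: AF_cons.
    case: (boolP (star d \in F)) => sF; last exact: A0_cons.
    by rewrite -[in LHS](starK d) starK -{2}[d]starK AS_cons ?starK.
  have nk := head_notKC od h; have h' := nf_behead h.
  case: (fwd c d); rewrite apM; first by rewrite Psi_id // A0_cons.
  by rewrite A0_cons // Phi_id.
have h' := nf_behead h; have e' := nf_st h; rewrite /= in e'.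
have [lk _ _] := and3P h.
rewrite [lval _ _ _ _ _ _ _ _]/= apM; case: kp nR h lk e' => // [d|v] _ h /= lk e'.
  rewrite Act_Lunit' /unitE; have [od dF sF] := and3P lk; rewrite od /off_unit (negbTE dF) scale1r.
  case: (boolP (star d \in F)) sF => sF /= => [ss|_].
    have [_ h2] : s = true /\ nf j (LA (star d) :: w).
      by apply: (nf_FX F_off sF); rewrite starK.
    rewrite ss in h *.
    rewrite [1 + _]addrC addrK apM AF_cons // AS_consX ?starK // eE_bv ?starK //= eqxx //.
  have fk : full (KX d) by rewrite /full_kind /= od dF (negbTE sF).
  by rewrite apB ap1 (U_cons q dlt fk h) /= scale1r addrC addKr eE_bv //= eqxx.
have fk : full (KC v) by rewrite /full_kind /= lk.
have -> : xC c AE (XE^~ false) v s = U (KC v) s.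
  have /existsP[i /eqP iv] := lk.
  by rewrite -iv (xC_c _ _ _ _ c_cyc) Act_Lunit' /unitE off_c fwd_c.
by rewrite apB apZ ap1 (U_cons q dlt fk h) /= addrC addKr eE_bv //= eqxx.
Qed.
End EndWords.

(** * Evaluation of words *)

Section Theta.
Variables (k : fieldType) (Q : quiver) (n : nat) (c : 'I_n -> dart Q).
Variables (F : {set dart Q}) (q : vertex Q -> k) (dlt : k).
Local Notation V := (vertex Q).
Local Notation word := (seq (lett Q)).
Implicit Types (j v : V) (w : word) (s : bool) (d : dart Q) (l : lett Q).
Local Notation M := (M k c F).
Local Notation nf := (nf c F).
Local Notation bv := (bv k c F).
Local Notation U := (U c F q dlt).
Local Notation eE := (eE k c F).
Local Notation tE := (tE k c F).
Local Notation cst := (cst q dlt).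
Local Notation kap := (kap c).
Local Notation full := (full_kind c F).
Local Notation A0 := (A0 c F q dlt).
Local Notation QE := (QE c F q dlt).
Hypothesis c_cyc : is_cycle c.
Hypothesis F_off : {in F, forall d, off_cycle c d}.
Hypothesis F_star : {in F, forall d, star d \notin F}.
Hypothesis F_tail : {in F, forall a, ~~ on_cycle c (dtail a)}.
Hypothesis q_neq0 : forall v, q v != 0.
Variables (eps : dart Q -> bool) (par : V -> dart Q) (sQ : seq (dart Q)).
Variables (dep : V -> nat) (Rho : bool -> End M).
Hypothesis eps_c : forall i, eps (c i) = true.
Hypothesis eps_cs : forall i, eps (star (c i)) = false.
Hypothesis sQ_mem : forall d, (d \in sQ) = off_cycle c d.
Hypothesis sQ_uniq : uniq sQ.
Hypothesis F_par : {in F, forall a, par (dtail a) = a}.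
Hypothesis par_F : forall v, ~~ on_cycle c v -> par v \in F /\ dtail (par v) = v.
Hypothesis F_dep : {in F, forall a, (dep (dhead a) < dep (dtail a))%N}.
Hypothesis RhoK : forall s, Rho s * Rho (~~ s) = 1.
Hypothesis Rho_eE : forall s v, Rho s * eE v = eE v * Rho s.
Hypothesis Rho_tE : forall s, tE * (Rho s - QE s) = Rho s - QE s.

Variables (A : algebra k) (e : V -> A) (a y : dart Q -> A).
Hypothesis H : Lrel e a y.
Local Notation X := (Lunit a y).

Definition rh s : A :=
  if s then \prod_(d <- cycle_order c ++ sQ) X d (eps d)
  else \prod_(d <- rev (cycle_order c ++ sQ)) X d (~~ eps d).

Lemma rh_e s v : rh s * e v = e v * rh s.
Proof. by rewrite /rh; case: s; apply: (prod_X_e H). Qed.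

Lemma rhK s : rh s * rh (~~ s) = 1.
Proof. by rewrite /rh; case: s; [apply: (prod_XK H) | apply: (prod_XKV H)]. Qed.

(* The values of the letters [KR]. In the free product they come from [B], whereas
   [rh] is [q]. *)
Variable rR : bool -> A.
Hypothesis rR_e : forall s v, rR s * e v = e v * rR s.
Hypothesis rRK : forall s, rR s * rR (~~ s) = 1.
Local Notation lval := (lval c q dlt e a y rR).
Local Notation wval := (word_val c q dlt e a y rR).
Local Notation gU := (gU c a y rR).

Lemma X_corner d s : X d s = X d s * e (dtail d) + (1 - e (dtail d)).
Proof.
have -> : 1 - e (dtail d) = \sum_(u | u != dtail d) e u.
  by rewrite -[X in X - _](e_sum H) (bigD1 (dtail d)) //= addrAC subrr add0r.
rewrite -[LHS]mulr1 -[X in _ * X = _](e_sum H) (bigD1 (dtail d)) //= mulrDr mulr_sumr.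
by congr (_ + _); apply: eq_bigr => u ne; exact: (X_off H).
Qed.

Lemma gU_e kp s v : gU kp s * e v = e v * gU kp s.
Proof.
case: kp => [u|d|u] /=; [exact: rR_e | exact: (X_e H) |].
by rewrite /xC; case: pickP => *; rewrite ?(X_e H) ?mul1r ?mulr1.
Qed.

Lemma gUK kp s : gU kp s * gU kp (~~ s) = 1.
Proof.
case: kp => [u|d|u] /=; [exact: rRK | exact: (XK H) |].
by rewrite /xC; case: pickP => *; rewrite ?(XK H) ?mul1r.
Qed.

Lemma e_lval l : e (ltl l) * lval l = lval l.
Proof. by case: l => [d|kp s] /=; rewrite ?(Lrel_tail H) // mulrA (eK H). Qed.

Lemma lval_LU kp s : lval (LU kp s) = (gU kp s - cst kp s *: (1 : A)) * e (kvert kp).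
Proof.
by rewrite /= mulrBl mulrBr gU_e -alg_scalerAl -alg_scalerAr mul1r mulr1.
Qed.

Definition theta_map : M -> A := wlin (fun j w => wval w * e j).

Lemma theta_linear : linear theta_map. Proof. exact: wlin_linear. Qed.

Lemma theta_nil j : theta_map (bv j [::]) = e j.
Proof. by rewrite /theta_map wlin_bv // /word_val big_nil mul1r. Qed.

Lemma theta_cons j l w : nf j (l :: w) -> theta_map (bv j (l :: w)) = lval l * theta_map (bv j w).
Proof.
by move=> h; rewrite /theta_map !wlin_bv ?(nf_behead h) // /word_val big_cons mulrA.
Qed.

Lemma e_theta j w : nf j w -> e (st j w) * theta_map (bv j w) = theta_map (bv j w).
Proof.
case: w => [|l w] h; first by rewrite theta_nil (eK H).
by rewrite theta_cons // mulrA e_lval.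
Qed.

(** Intertwining is closed under linear combinations and products, so it has to be checked on
    generators only. *)
Definition Int (f : End M) (z : A) : Prop := forall m, theta_map (ap f m) = z * theta_map m.

Lemma Int_ext f z : (forall j w, nf j w -> theta_map (ap f (bv j w)) = z * theta_map (bv j w)) ->
  Int f z.
Proof.
move=> h; apply: M_ext h; first exact: linear_comp theta_linear (ap_linear f).
by move=> b m1 m2; rewrite theta_linear mulrDr alg_scalerAr.
Qed.

Lemma Int1 : Int 1 1. Proof. by move=> m; rewrite ap1 mul1r. Qed.
Lemma IntM f g z t : Int f z -> Int g t -> Int (f * g) (z * t).
Proof. by move=> hf hg m; rewrite apM hf hg mulrA. Qed.
Lemma IntD f g z t : Int f z -> Int g t -> Int (f + g) (z + t).
Proof. by move=> hf hg m; rewrite apD (linD theta_linear) hf hg mulrDl. Qed.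
Lemma IntB f g z t : Int f z -> Int g t -> Int (f - g) (z - t).
Proof. by move=> hf hg m; rewrite apB (linB theta_linear) hf hg mulrBl. Qed.
Lemma IntZ b f z : Int f z -> Int (b *: f) (b *: z).
Proof. by move=> hf m; rewrite apZ (linZ theta_linear) hf alg_scalerAl. Qed.
Lemma Int_sum (I : Type) (r : seq I) (P : pred I) (f : I -> End M) (z : I -> A) :
  (forall i, Int (f i) (z i)) -> Int (\sum_(i <- r | P i) f i) (\sum_(i <- r | P i) z i).
Proof.
move=> h; elim/big_rec2: _ => [m|i t g _ hg]; last exact: IntD.
by rewrite ap0 (lin0 theta_linear) mul0r.
Qed.
Lemma Int_prod (I : Type) (r : seq I) (P : pred I) (f : I -> End M) (z : I -> A) :
  (forall i, P i -> Int (f i) (z i)) ->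
  Int (\prod_(i <- r | P i) f i) (\prod_(i <- r | P i) z i).
Proof. by move=> h; elim/big_rec2: _ => [|i t g /h hi hg]; [exact: Int1 | exact: IntM]. Qed.

Lemma Int_eE v : Int (eE v) (e v).
Proof.
apply: Int_ext => j w h; rewrite eE_bv // -(e_theta h).
case: eqP => [<-|/eqP ne]; first by rewrite mulrA (eK H) e_theta.
by rewrite mulrA (e_orth H) 1?eq_sym // mul0r (lin0 theta_linear).
Qed.

Lemma theta_LU kp s j w : full kp -> nf j (LU kp s :: w) ->
  theta_map (bv j (LU kp s :: w)) = (gU kp s - cst kp s *: (1 : A)) * theta_map (bv j w).
Proof.
move=> fk h; rewrite theta_cons // lval_LU -mulrA.
have e' := nf_st h; rewrite /= in e'.
by rewrite -e' e_theta // (nf_behead h).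
Qed.

Lemma Int_U_at kp s : full kp -> Int (U kp s * eE (kvert kp)) (gU kp s * e (kvert kp)).
Proof.
move=> fk; apply: Int_ext => j w h; rewrite apM eE_bv // -mulrA -(Int_eE (kvert kp)) eE_bv //.
case: eqP => [|_]; last by rewrite ap_in0 (lin0 theta_linear) mulr0.
have TH s' w' : nf j (LU kp s' :: w') -> theta_map (bv j (LU kp s' :: w')) =
    gU kp s' * theta_map (bv j w') - cst kp s' *: theta_map (bv j w').
  by move=> h'; rewrite theta_LU // mulrBl -alg_scalerAl mul1r.
elim: w h => [|l w IH] h e'; case: (UP q dlt s fk h) => //.
- move=> _ hn _; rewrite (linD theta_linear) (linZ theta_linear) TH //.
  by rewrite addrC subrK.
- move=> w' ew hw' e1; case: ew h IH hw' e1 e' => -> <- h IH hw' e1 e'.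
  rewrite (linB theta_linear) (linZ theta_linear) IH // TH // mulrBr mulrA gUK mul1r.
  by rewrite alg_scalerAr.
- move=> _ hn _; rewrite (linD theta_linear) (linZ theta_linear) [in LHS]TH //.
  by rewrite addrC subrK.
Qed.

Lemma Int_gunit (f : bool -> End M) (z : bool -> A) v s : gunit f v ->
  (forall u, u != v -> z s * e u = e u) -> Int (f s * eE v) (z s * e v) -> Int (f s) (z s).
Proof.
move=> [_ _ fo] zo h.
have -> : f s = \sum_u f s * eE u by rewrite -mulr_sumr (eE_sum k c F) mulr1.
have -> : z s = \sum_u z s * e u by rewrite -mulr_sumr (e_sum H) mulr1.
apply: Int_sum => u; have [->//|ne] := eqVneq u v.
by rewrite fo // zo //; exact: Int_eE.
Qed.

Lemma Int_UX d s : full (KX d) -> Int (U (KX d) s) (X d s).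
Proof.
move=> fk; apply: (Int_gunit (z := X d)) (Int_U_at s fk); first exact: U_gunit.
by move=> u; apply: (X_off H).
Qed.

Lemma Int_UC i s : Int (U (KC (dtail (c i))) s) (X (c i) s).
Proof.
have fk : full (KC (dtail (c i))) by rewrite /full_kind /= on_c.
apply: (Int_gunit (f := U (KC (dtail (c i)))) (z := X (c i)) (v := dtail (c i))).
- exact: (U_gunit q dlt fk).
- by move=> u; apply: (X_off H).
by have := Int_U_at s fk; rewrite /= xC_c.
Qed.

(** A leading letter of the unit of [star d] is excluded: off the cycle it is removed by induction,
    while on the cycle [A0] alone has the wrong value there and the twists must come in. *)
Lemma theta_A0 d j w : Int (U (kap d) true) (X d true) -> nf j w ->
  (forall s w', w <> LU (kap (star d)) s :: w') ->
  theta_map (ap (A0 d) (bv j w)) = a d * theta_map (bv j w).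
Proof.
move=> hU h ne; case: (A0P q dlt d h) => [ne'|w' ew hw' e'|s w' ew|e' hn _ _].
- by rewrite (lin0 theta_linear) -(e_theta h) mulrA (a_e H) (introF eqP ne') mul0r.
- rewrite ew in h *; rewrite apB ap1 (linB theta_linear) hU theta_cons // mulrA.
  by rewrite (X_aa a y) mulrBl mul1r.
- by case: (ne _ _ ew).
- by rewrite theta_cons.
Qed.

Lemma Int_A0 d : off_cycle c d -> d \notin F -> star d \notin F -> Int (A0 d) (a d).
Proof.
move=> od dF sF; apply: Int_ext => j w h.
have kd : kap d = KX d by rewrite kapE od.
have ks : kap (star d) = KX (star d) by rewrite kapE off_star od.
have fd : full (KX d) by rewrite -kd full_plain.
have fs : full (KX (star d)) by rewrite -ks full_plain ?off_star ?starK.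
have hU : Int (U (kap d) true) (X d true) by rewrite kd; exact: Int_UX.
have A0w j' w' : nf j' w' -> (forall s w1, w' <> LU (KX (star d)) s :: w1) ->
    theta_map (ap (A0 d) (bv j' w')) = a d * theta_map (bv j' w').
  by move=> h' ne; apply: theta_A0 => // s w1; rewrite ks.
elim: w h => [|l w IH] h; first exact: A0w.
case: l h => [b|kp s] h; first exact: A0w.
case: (eqVneq kp (KX (star d))) h => [->|ne] h; last first.
  by apply: A0w => // s' w' [ek]; rewrite ek eqxx in ne.
rewrite -ks in h *; rewrite A0_consU // apB apZ ap1; rewrite ks in h *.
rewrite (linB theta_linear) (linZ theta_linear) kd Int_UX // IH ?(nf_behead h) //.
rewrite theta_LU // [RHS]mulrA mulrBr -alg_scalerAr mulr1 /= (a_X H) mulrBl -mulrA.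
by rewrite alg_scalerAl.
Qed.

Lemma Int_AF b (Y : bool -> End M) : b \in F -> Int (Y true) (X b true) -> Int (AF b Y) (a b).
Proof.
move=> bF hY; apply: Int_ext => j w h.
case: (AFP F_off Y bF h) => [ne|w' ew h' e'|w' ew h' e'|e' h' _ _].
- by rewrite (lin0 theta_linear) -(e_theta h) mulrA (a_e H) (introF eqP ne) mul0r.
- rewrite ew in h *; rewrite apB ap1 (linB theta_linear) hY theta_cons // mulrA.
  by rewrite (X_aa a y) mulrBl mul1r.
- rewrite ew in h *; rewrite apB ap1 (linB theta_linear) hY !theta_cons //= scale1r.
  (* Both sides are evaluations of [b b^* b] in front of the rest of the word. *)
  rewrite -{1}[b]starK -(X_aa a y) starK dtail_star !mulrA (a_e H) eqxx (X_aa a y).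
  by rewrite [1 + _]addrC subrK !mulrBl !mul1r.
- by rewrite theta_cons.
Qed.

Lemma Int_AS b : b \in F -> Int (AS k c F b) (a (star b)).
Proof.
move=> bF; apply: Int_ext => j w h.
case: (ASP k F_off F_star bF h) => [ne|w' ew h'|e' h' _].
- rewrite (lin0 theta_linear) -(e_theta h) mulrA (a_e H) dhead_star.
  by rewrite (introF eqP ne) mul0r.
- rewrite ew in h *; rewrite !theta_cons //= scale1r -(X_aa a y) starK.
  by rewrite [e _ * _]mulrA (e_a H) eqxx mulrA.
- by rewrite theta_cons.
Qed.

Lemma Int_Xoff (Y : V -> bool -> End M) d s : off_cycle c d ->
  (d \in F -> Int (Y (dtail d) s) (X d s)) ->
  (star d \in F -> forall s', Int (Y (dtail (star d)) s') (X (star d) s')) ->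
  Int (off_unit q dlt Y d s) (X d s).
Proof.
move=> od h1 h2; rewrite /off_unit; case: (boolP (d \in F)) => dF; first exact: h1.
case: (boolP (star d \in F)) => sF; last first.
  by apply: Int_UX; have := full_plain od dF sF; rewrite kapE od.
have iA := Int_AF sF (h2 sF true); have iB := Int_AS sF; rewrite starK in iB.
case: s {h1}.
  by rewrite /Lunit; apply: IntD; [exact: Int1 | exact: IntM].
have := X_starF H (star d); rewrite starK => ->; apply: IntB; first exact: Int1.
by apply: IntM => //; apply: IntM => //; exact: h2.
Qed.

Hypothesis Rho_int : forall s, Int (Rho s) (rh s).

Local Notation XX := (XX q dlt eps par sQ dep Rho).
Let Xg := XX_gunit q dlt F_off F_star eps par dep sQ_mem RhoK Rho_eE.

Definition zprod v (ds : seq (dart Q)) (b : bool) : A :=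
  if b then \prod_(d <- ds | dtail d == v) X d (eps d)
  else \prod_(d <- rev ds | dtail d == v) X d (~~ eps d).

Lemma zprodK v ds b : zprod v ds b * zprod v ds (~~ b) = 1.
Proof. by rewrite /zprod; case: b; [apply: (prod_XK H) | apply: (prod_XKV H)]. Qed.

Lemma zprod_e v ds b u : zprod v ds b * e u = e u * zprod v ds b.
Proof. by rewrite /zprod; case: b; apply: (prod_X_e H). Qed.

Let pre v := take (index (par v) sQ) sQ.
Let post v := drop (index (par v) sQ).+1 sQ.

Definition zcore v (b : bool) : A :=
  if b then zprod v (pre v) false * rh true * zprod v (post v) false
  else zprod v (post v) true * rh false * zprod v (pre v) true.

Lemma rh_black v : ~~ on_cycle c v -> rh true * e v = zprod v sQ true * e v.
Proof.
move=> nv; rewrite /rh (prod_X_at H) big_cat /=.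
by rewrite (cycle_order_off c_cyc (fun d => X d (eps d)) nv) mul1r.
Qed.

(** In any [A] the factorization of [rho] at [v] forces the unit of the forest arrow, by the formula
    that served to define its action on [M]. *)
Lemma zcore_par v s : ~~ on_cycle c v ->
  X (par v) s * e v = zcore v (s == eps (par v)) * e v.
Proof.
move=> nv; have [pF pv] := par_F nv.
have E : X (par v) (eps (par v)) * e v = zcore v true * e v.
  rewrite /zcore -!mulrA zprod_e [rh true * _]mulrA rh_black //.
  have -> : zprod v sQ true =
      zprod v (pre v) true * (X (par v) (eps (par v)) * zprod v (post v) true).
    by rewrite {1}(pre_post F_off sQ_mem par_F nv) /zprod big_cat big_cons pv eqxx.
  rewrite -!mulrA -zprod_e (mulrA (zprod v (post v) true)) (zprodK v _ true) mul1r.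
  by rewrite (mulrA (zprod v (pre v) false)) (zprodK v _ false) mul1r.
have CK : zcore v false * zcore v true = 1.
  rewrite /zcore -!mulrA (mulrA (zprod _ (pre v) true)) (zprodK v _ true) mul1r.
  by rewrite (mulrA (rh false)) (rhK false) mul1r (zprodK v _ true).
have [->|ne] := eqVneq s (eps (par v)); first exact: E.
have -> : s = ~~ eps (par v) by case: s (eps _) ne => -[].
have CE : zcore v true * (X (par v) (~~ eps (par v)) * e v) = e v.
  by rewrite (X_e H) mulrA -E -mulrA -(X_e H) mulrA (XK H) mul1r.
by rewrite -[LHS]mul1r -CK -mulrA CE.
Qed.

Lemma Int_XX v s : ~~ on_cycle c v -> Int (XX v s) (X (par v) s).
Proof.
(* Induction from the deepest vertices towards the cycle, as the formula at [v] uses the units of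
   forest arrows ending at [v]. *)
have [m] := ubnP ((\max_v dep v).+1 - dep v); elim: m v s => // m IH v s lt nv.
have [pF pv] := par_F nv.
have IX d s' : d \in pre v ++ post v -> dtail d = v -> Int (off_unit q dlt XX d s') (X d s').
  move=> dp dv; have od : off_cycle c d.
    by rewrite -sQ_mem (pre_post F_off sQ_mem par_F nv) mem_cat inE orbCA -mem_cat dp orbT.
  apply: Int_Xoff => // [dF|sF s1].
    by case: (par_notin F_off sQ_mem sQ_uniq par_F nv dp); rewrite -dv F_par.
  rewrite -{2}(F_par sF); apply: IH; last exact: F_tail.
  have := F_dep sF; rewrite dhead_star dv => ltd.
  have lem : (dep v < (\max_v dep v).+1)%N by rewrite ltnS leq_bigmax.
  by rewrite ltnS in lt; apply: leq_trans lt; rewrite ltn_sub2l.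
have IP ds b : {subset ds <= pre v ++ post v} ->
    Int (Xprod q dlt XX eps v ds b) (zprod v ds b).
  rewrite /Xprod /zprod => sub; case: b; rewrite big_seq_cond [X in Int _ X]big_seq_cond;
    apply: Int_prod => d /andP[dd /eqP dv]; apply: IX => //; apply: sub => //.
  by rewrite mem_rev in dd.
have IPre b : Int (Xprod q dlt XX eps v (pre v) b) (zprod v (pre v) b).
  by apply: IP => d; rewrite mem_cat => ->.
have IPost b : Int (Xprod q dlt XX eps v (post v) b) (zprod v (post v) b).
  by apply: IP => d; rewrite mem_cat => ->; rewrite orbT.
rewrite X_corner pv zcore_par // XX_fix // /Xstep (negbTE nv).
apply: IntD; last by apply: IntB; [exact: Int1 | exact: Int_eE].
apply: IntM; last exact: Int_eE.
by rewrite /Xcore /zcore; case: (_ == _); do 2![apply: IntM => //].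
Qed.

Lemma Int_XE_off d s : off_cycle c d -> Int (off_unit q dlt XX d s) (X d s).
Proof.
move=> od; apply: Int_Xoff => // [dF|sF s'].
  by rewrite -{2}(F_par dF); apply: Int_XX; exact: F_tail.
by rewrite -{2}(F_par sF); apply: Int_XX; exact: F_tail.
Qed.

Local Notation Phi := (Phi q dlt XX eps sQ Rho).
Local Notation Psi := (Psi q dlt XX eps sQ Rho).
Local Notation nn := (nn q dlt XX eps sQ Rho).

Definition zQ b : A :=
  if b then \prod_(d <- sQ) X d (eps d) else \prod_(d <- rev sQ) X d (~~ eps d).

Lemma Int_rhoQ b : Int (rhoQ q dlt XX eps sQ b) (zQ b).
Proof.
rewrite /rhoQ /zQ; case: b; rewrite big_seq [X in Int _ X]big_seq;
  by apply: Int_prod => d ds; apply: Int_XE_off; rewrite -sQ_mem // -mem_rev.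
Qed.

Definition zu : A := zQ true * rh false.

Lemma Int_uu : Int (uu q dlt XX eps sQ Rho) zu.
Proof. by apply: IntM; [exact: Int_rhoQ | exact: Rho_int]. Qed.

Lemma Int_ui : Int (ui q dlt XX eps sQ Rho) (rh true * zQ false).
Proof. by apply: IntM; [exact: Rho_int | exact: Int_rhoQ]. Qed.

Lemma nn_at m v : ap (eE v) m = m ->
  theta_map (ap nn m) = zu * theta_map m - (q v)^-1 *: theta_map m.
Proof.
move=> em; rewrite apB (linB theta_linear) Int_uu -{2}em -apM QE_eE apZ em.
by rewrite (linZ theta_linear).
Qed.

Lemma zQK b : zQ b * zQ (~~ b) = 1.
Proof. by rewrite /zQ; case: b; [apply: (prod_XK H) | apply: (prod_XKV H)]. Qed.

Section AtCycle.
Variable i : 'I_n.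
Let v := dtail (c (ordS i)).
Local Notation x := (X (c (ordS i)) true).
Local Notation xi := (X (c (ordS i)) false).

Lemma rh_white : rh true * e v = x * X (star (c i)) false * zQ true * e v.
Proof.
rewrite /rh (prod_X_at H) big_cat /= -/v (cycle_order_at c_cyc (fun d => X d (eps d))).
rewrite ordSK eps_c eps_cs -!mulrA; congr (_ * (_ * _)).
by rewrite /zQ (prod_X_at H).
Qed.

(** At [v] the cycle contributes [x] and the inverse of [1 + c_i^* c_i] to [rho], which determines
    the second from the first in any [A]. *)
Lemma zu_x : zu * x * e v = X (star (c i)) true * e v.
Proof.
have E1 : X (star (c i)) true * xi * rh true * e v = zQ true * e v.
  rewrite -mulrA rh_white -!mulrA (mulrA xi) (XK H (c (ordS i)) false) mul1r.
  by rewrite (mulrA (X (star _) true)) (XK H (star (c i)) true) mul1r.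
rewrite /zu -mulrA (X_e H) mulrA -(mulrA (zQ true)) rh_e mulrA -E1.
rewrite -(mulrA _ (e v)) -rh_e mulrA -(mulrA _ (rh true)) (rhK true) mulr1.
by rewrite -(mulrA _ (e v)) -(X_e H) mulrA -(mulrA _ xi) (XK H (c (ordS i)) false) mulr1.
Qed.

Lemma xi_zui : xi * (rh true * zQ false) * e v = X (star (c i)) false * e v.
Proof.
have E1 : xi * (rh true * zQ false) * (zu * x) = 1.
  rewrite /zu -!mulrA (mulrA (zQ false)) (zQK false) mul1r (mulrA (rh true)) (rhK true).
  by rewrite mul1r (XK H (c (ordS i)) false).
set p := xi * _ in E1 *.
have E2 : p * (X (star (c i)) true * e v) = e v by rewrite -zu_x mulrA E1 mul1r.
rewrite -[in LHS](mulr1 p) -(XK H (star (c i)) true) !mulrA -(mulrA _ _ (e v)) (X_e H).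
by rewrite mulrA -(mulrA p) E2.
Qed.

Definition zyy s : A := if s then zu * x else xi * (rh true * zQ false).

Lemma zyy_e s : zyy s * e v = X (star (c i)) s * e v.
Proof. by case: s; [exact: zu_x | exact: xi_zui]. Qed.

Let fkv : full (KC v).
Proof. by rewrite /full_kind /= on_c. Qed.

Lemma Int_yy s : Int (yy q dlt XX eps sQ Rho v s) (zyy s).
Proof.
rewrite /yy /zyy; case: s; apply: IntM; try exact: Int_UC.
  exact: Int_uu.
exact: Int_ui.
Qed.

Let hv : dhead (c i) = v. Proof. exact: c_next. Qed.
Let od : off_cycle c (c i) = false. Proof. exact: off_c. Qed.
Let kd : kap (c i) = KC (dtail (c i)). Proof. by rewrite kapE od. Qed.
Let ks : kap (star (c i)) = KC v. Proof. by rewrite kapE off_star od dtail_star hv. Qed.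
Let fd : full (kap (c i)). Proof. by rewrite kd /full_kind /= on_c. Qed.
Let fs : full (kap (star (c i))). Proof. by rewrite ks. Qed.

Let v_theta j w : nf j w -> st j w = v -> e v * theta_map (bv j w) = theta_map (bv j w).
Proof. by move=> h <-; exact: e_theta. Qed.

(** The recursion of [Psi] strips the leading letters of [x]. Apart from units, which [A0] moves to
    its left, it only produces values of [nn]; these have no leading [KC], and on them [A0] is
    correct. *)
Lemma Int_fwd : Int (A0 (c i) * Psi) (a (c i)).
Proof.
have A0n j w : nf j w -> ~~ startKC w -> theta_map (ap (A0 (c i)) (bv j w)) = a (c i) * theta_map (bv j w).
  move=> h nk; apply: theta_A0 => //; first by rewrite kd; exact: Int_UC.
  by move=> s w' ew; rewrite ew ks in nk.
have A0t m : theta_map (ap (A0 (c i)) (ap tE m)) = a (c i) * theta_map (ap tE m).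
  move: m; apply: M_ext => [||j w h].
  - exact: linear_comp theta_linear (linear_comp (ap_linear _) (ap_linear _)).
  - by move=> b m1 m2; rewrite (ap_linear tE) theta_linear mulrDr alg_scalerAr.
  rewrite [ap tE _]lin_bv //; case: ifP => nk; first by rewrite ap_in0 (lin0 theta_linear) mulr0.
  by rewrite A0n // nk.
have nnt : tE * nn = nn := nn_tE F_off F_star F_tail eps Xg sQ_mem Rho_tE.
have A0nn m : theta_map (ap (A0 (c i)) (ap nn m)) = a (c i) * theta_map (ap nn m).
  by rewrite -nnt apM A0t.
have A0U' s m : theta_map (ap (A0 (c i)) (ap (U (KC v) s) m)) = X (c i) s * theta_map (ap (A0 (c i)) m).
  by rewrite -apM -ks A0U // kd apM Int_UC.
have aX s t : a (c i) * (X (star (c i)) s * t) = X (c i) s * (a (c i) * t).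
  by rewrite mulrA (a_X H) mulrA.
apply: Int_ext => j w h; rewrite apM; elim/KC_ind: j w / h => [j w h nk|u s j w h fk eu h' IH].
  by rewrite Psi_id // A0n.
have nf1 := h; have [uv|ne] := eqVneq u v; last first.
  rewrite -(e_theta h) mulrA (a_e H) hv [st _ _]/= (negbTE ne) mul0r.
  have -> : bv j (LU (KC u) s :: w) = ap (eE u) (bv j (LU (KC u) s :: w)).
    by rewrite eE_bv // eqxx.
  rewrite -(apM Psi) (Psi_eE q dlt F_off F_star eps Xg sQ_mem Rho_eE) apM -apM A0_eE hv.
  by rewrite (negbTE ne) ap0 (lin0 theta_linear).
rewrite uv in h fk eu *; set T := theta_map (bv j w) in IH *.
have vT : e v * T = T by exact: v_theta.
have ew : ap (eE v) (bv j w) = bv j w by rewrite eE_bv // eu eqxx.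
have xw : theta_map (ap (U (KC v) true) (bv j w)) = x * T by exact: Int_UC.
rewrite theta_LU // -/T [gU _ _]/= (xC_c _ _ _ _ c_cyc) mulrBl -alg_scalerAl mul1r mulrBr -alg_scalerAr.
case: s h {nf1} => h.
  rewrite Psi_consT // ap_inB !ap_inZ ap_inB (linB theta_linear) !(linZ theta_linear) (linB theta_linear).
  rewrite A0U' IH apM A0nn (nn_at (v := v)); last first.
    by rewrite -(ap_comm _ (U_eE q dlt true v fk)) ew.
  have yT : X (star (c i)) true * T = zu * (x * T).
    by rewrite -{1}vT mulrA -zu_x -!mulrA vT.
  rewrite xw -(aX true) yT -mulrBr subKr -alg_scalerAr scalerA mulfV ?q_neq0 //.
  by rewrite scale1r.
rewrite Psi_consF // ap_inB !ap_inZ (linB theta_linear) !(linZ theta_linear).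
rewrite A0U' ap_inD ap_inZ (linD theta_linear) (linZ theta_linear) IH A0nn (nn_at (v := v) ew) -/T.
congr (_ - _); rewrite mulrBr -alg_scalerAr [_ + (_ - _)]addrC subrK.
have zT : zu * T = X (star (c i)) true * (xi * T).
  have xT : e v * (xi * T) = xi * T by rewrite mulrA -(X_e H) -mulrA vT.
  rewrite -xT mulrA -zu_x -(mulrA _ (e v)) xT -(mulrA zu x) (mulrA x xi).
  by rewrite (XK H (c (ordS i)) true) mul1r.
by rewrite zT aX mulrA (XK H (c i) false) mul1r.
Qed.

(** [A0] moves the letters of [x] at the tail of [c i] to the head, where [Phi] turns them into
    powers of [1 + c_i^* c_i], as the relation [a^* (1 + a a^* ) = (1 + a^* a) a^*] asks. *)
Lemma Int_bwd : Int (Phi * A0 (star (c i))) (a (star (c i))).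
Proof.
have PU s m : ap (eE v) m = m ->
    theta_map (ap Phi (ap (U (KC v) s) m)) = X (star (c i)) s * theta_map (ap Phi m).
  move=> em; have := congr1 (fun f => ap f m)
    (PhiU q dlt F_off F_star eps Xg sQ_mem RhoK fkv s).
  rewrite !apM em => ->; rewrite Int_yy.
  have -> : theta_map (ap Phi m) = e v * theta_map (ap Phi m).
    rewrite -Int_eE -(ap_comm _ (Phi_eE q dlt F_off F_star eps Xg sQ_mem Rho_eE v)) em //.
  by rewrite !mulrA zyy_e.
apply: Int_ext => j w h; rewrite apM.
elim: w h => [|l w IH] h; case: (A0P q dlt (star (c i)) h) => [ne|w' ew h' e'|s w' ew h' e'|e' hn _ _].
- by rewrite ap_in0 (lin0 theta_linear) -(e_theta h) mulrA (a_e H) (introF eqP ne) mul0r.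
- by [].
- by [].
- by rewrite Phi_id // theta_cons.
- by rewrite ap_in0 (lin0 theta_linear) -(e_theta h) mulrA (a_e H) (introF eqP ne) mul0r.
- rewrite starK in ew; case: ew h IH h' e' => -> <- h IH h' e'.
  rewrite dtail_star hv in e'.
  have nk : ~~ startKC w by apply: head_notKC h; rewrite od.
  have em : ap (eE v) (bv j w) = bv j w by rewrite eE_bv // e' eqxx.
  rewrite apB ap1 ap_inB (linB theta_linear) ks PU // Phi_id // theta_cons //.
  rewrite mulrA; have := X_aa a y (star (c i)); rewrite starK => ->.
  by rewrite mulrBl mul1r.
- rewrite starK in ew; case: ew h IH h' e' => -> <- h IH h' e'.
  have em : ap (eE v) (ap (A0 (star (c i))) (bv j w)) = ap (A0 (star (c i))) (bv j w).
    by rewrite -apM eE_A0 ?starK // dtail_star hv eqxx.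
  rewrite apB apZ ap1 ap_inB ap_inZ (linB theta_linear) (linZ theta_linear) ks PU // IH //.
  rewrite theta_LU // kd /= (xC_c _ _ _ _ c_cyc).
  rewrite mulrBl mulrBr -alg_scalerAl mul1r -alg_scalerAr; congr (_ - _).
  have aX := a_X H (star (c i)) s; rewrite starK in aX.
  by rewrite !mulrA aX.
- by rewrite Phi_id // theta_cons.
Qed.
End AtCycle.

Local Notation AE := (arrowE q dlt eps par sQ dep Rho).
Local Notation XE := (unitE q dlt eps par sQ dep Rho).

Lemma Int_AE d : Int (AE d) (a d).
Proof.
rewrite /arrowE; case: (boolP (off_cycle c d)) => od.
  case: (boolP (d \in F)) => dF.
    by apply: Int_AF => //; rewrite -{2}(F_par dF); apply: Int_XX; exact: F_tail.
  case: (boolP (star d \in F)) => sF; last exact: Int_A0.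
  by have := Int_AS sF; rewrite starK.
case: (cyc_dartP od) => -[i ->]; first by rewrite fwd_c; exact: Int_fwd.
by rewrite fwd_cs //; exact: Int_bwd.
Qed.

Lemma Int_XE d : Int (XE d false) (y d).
Proof.
have AEE := AE_AE c_cyc F_off F_star F_tail q_neq0 eps par dep sQ_mem RhoK Rho_eE Rho_tE.
have IT : Int (XE d true) (X d true).
  have -> : XE d true = 1 + AE d * AE (star d) by rewrite AEE addrC subrK.
  by apply: IntD; [exact: Int1 | apply: IntM; exact: Int_AE].
have [XK1 _ _] := XE_gunit c_cyc F_off F_star F_tail q_neq0 eps par dep sQ_mem RhoK Rho_eE Rho_tE d.
move=> m; rewrite -[RHS]mulr1.
have -> : theta_map m = X d true * theta_map (ap (XE d false) m).
  by rewrite -IT -apM (XK1 true) ap1.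
by rewrite mulr1 mulrA (XK H d false) mul1r.
Qed.
End Theta.

(** * Two choices for the action of rho *)

Section RhoInstances.
Variables (k : fieldType) (Q : quiver) (n : nat) (c : 'I_n -> dart Q).
Variables (F : {set dart Q}) (q : vertex Q -> k) (dlt : k).
Local Notation V := (vertex Q).
Local Notation M := (M k c F).
Local Notation bv := (bv k c F).
Local Notation U := (U c F q dlt).
Local Notation eE := (eE k c F).
Local Notation tE := (tE k c F).
Local Notation QE := (QE c F q dlt).
Hypothesis q_neq0 : forall v, q v != 0.

Let fR (v : V) : full_kind c F (KR v). Proof. by []. Qed.

(** [rho] acts by its own letters; this makes [M] the regular module of [L]. With [QE] instead, [r]
    acts by zero and [M] becomes a module over [Lambda^q]. *)
Definition RhoU s : End M := lin (fun j w => ap (U (KR (st j w)) s) (bv j w)).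

Lemma RhoU_at s v : RhoU s * eE v = U (KR v) s * eE v.
Proof.
apply: E_ext => j w h; rewrite !apM eE_bv //; case: eqP => [<-|_].
  by rewrite [LHS]lin_bv.
by rewrite !ap_in0.
Qed.

Lemma RhoU_eE s v : RhoU s * eE v = eE v * RhoU s.
Proof.
apply: eE_ext => u; rewrite -!mulrA RhoU_at.
have [->|ne] := eqVneq u v; first by rewrite eEE RhoU_at U_eE // mulrA eEE.
rewrite eE_orth; last by rewrite eq_sym.
by rewrite mulr0 U_eE // mulrA eE_orth 1?eq_sym // mul0r.
Qed.

Lemma RhoUK s : RhoU s * RhoU (~~ s) = 1.
Proof.
apply: eE_ext => u; rewrite mul1r -mulrA RhoU_at U_eE // mulrA RhoU_at.
by rewrite -mulrA -U_eE // mulrA UK // mul1r.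
Qed.

Lemma RhoU_tE s : tE * (RhoU s - QE s) = RhoU s - QE s.
Proof.
apply: eE_ext => u; rewrite -mulrA mulrBl RhoU_at QE_eE.
have -> : U (KR u) s * eE u - cst q dlt (KR u) s *: eE u =
    (U (KR u) s - cst q dlt (KR u) s *: (1 : End M)) * eE u.
  by rewrite mulrBl -alg_scalerAl mul1r.
apply: (@U_tE k Q n c F q dlt (KR u)) => //=.
by case: s => /=; rewrite ?mulfV ?mulVf ?q_neq0.
Qed.

Lemma QE_comm s v : QE s * eE v = eE v * QE s.
Proof.
apply: eE_ext => u; rewrite -!mulrA QE_eE.
have [->|ne] := eqVneq u v; first by rewrite eEE QE_eE -alg_scalerAr eEE.
rewrite eE_orth; last by rewrite eq_sym.
by rewrite mulr0 -alg_scalerAr eE_orth 1?eq_sym // scaler0.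
Qed.

Lemma QEK s : QE s * QE (~~ s) = 1.
Proof.
apply: eE_ext => u; rewrite mul1r -mulrA QE_eE -alg_scalerAr QE_eE scalerA.
by case: s => /=; rewrite ?mulfV ?mulVf ?q_neq0 // scale1r.
Qed.

Lemma QE_tE s : tE * (QE s - QE s) = QE s - QE s.
Proof. by rewrite subrr mulr0. Qed.

Variables (A : algebra k) (e : V -> A) (a y : dart Q -> A).
Hypothesis H : Lrel e a y.
Variable rR : bool -> A.
Hypothesis rR_e : forall s v, rR s * e v = e v * rR s.
Hypothesis rRK : forall s, rR s * rR (~~ s) = 1.
Local Notation Int := (Int q dlt e a y rR).

Lemma Int_RhoU s : Int (RhoU s) (rR s).
Proof.
have -> : RhoU s = \sum_u RhoU s * eE u by rewrite -mulr_sumr (eE_sum k c F) mulr1.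
have -> : rR s = \sum_u rR s * e u.
  by rewrite -mulr_sumr (e_sum H) mulr1.
by apply: Int_sum => u; rewrite RhoU_at; have := Int_U_at q dlt H rR_e rRK s (fR u).
Qed.

Lemma QE_sum s : QE s = \sum_u cst q dlt (KR u) s *: eE u.
Proof.
rewrite -[LHS]mulr1 -[in LHS](eE_sum k c F) mulr_sumr.
by apply: eq_bigr => u _; rewrite QE_eE.
Qed.
End RhoInstances.

(** * The free product *)

Section LrelHom.
Variables (k : fieldType) (Q : quiver).
Local Notation V := (vertex Q).
Lemma Lrel_hom (B C : algebra k) (f : B -> C) (e' : V -> B) (a' y' : dart Q -> B) :
  alg_hom f -> Lrel e' a' y' ->
  Lrel (fun v => f (e' v)) (fun d => f (a' d)) (fun d => f (y' d)).
Proof.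
move=> hf [[h1 h2 h3] h4 h5 h6 h7]; split; first split.
- by move=> i; rewrite -(homM hf) h1.
- by move=> i j ne; rewrite -(homM hf) h2 // (hom0 hf).
- by rewrite -(hom_sum hf) h3 (hom1 hf).
- by move=> d; rewrite -(homM hf) h4.
- by move=> d; rewrite -(homM hf) h5.
- by move=> d; rewrite -(homM hf) -(hom1 hf) -(homD hf) -(homM hf) h6.
- by move=> d; rewrite -(homM hf) -(hom1 hf) -(homD hf) -(homM hf) h7.
Qed.

End LrelHom.

Section IdempotentScalars.
Variables (k : fieldType) (V : finType) (q : V -> k) (B : algebra k) (e : V -> B).
Hypothesis e_idem : idempotents e.

Lemma scalars_comm v : (\sum_i q i *: e i) * e v = e v * (\sum_i q i *: e i).
Proof.
have [e1 e2 e3] := e_idem.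
rewrite mulr_suml mulr_sumr; apply: eq_bigr => i _.
rewrite -alg_scalerAl -alg_scalerAr; have [->//|ne] := eqVneq i v.
by rewrite !e2 // eq_sym.
Qed.

Lemma shifted_comm t u v : t * e v = e v * t ->
  (\sum_i q i *: e i + t) * u = 1 -> u * (\sum_i q i *: e i + t) = 1 ->
  (\sum_i q i *: e i + t) * e v = e v * (\sum_i q i *: e i + t) /\ u * e v = e v * u.
Proof.
move=> te qu uq.
have E : (\sum_i q i *: e i + t) * e v = e v * (\sum_i q i *: e i + t).
  by rewrite mulrDl mulrDr te scalars_comm.
by split=> //; exact: comm_inv qu uq E.
Qed.
End IdempotentScalars.

Section AlgBFacts.
Variables (k : fieldType) (V : finType) (q : V -> k).

Section Hom.
Variables (B : algebra k) (pr : free_alg k (V + bool)%type -> B).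
Hypothesis hpr : alg_hom pr.
Hypothesis pr0 : forall z, @algB_rel k V q z -> pr z = 0.

Let prB x z : @algB_rel k V q (x - z) -> pr x = pr z.
Proof. by move=> /pr0; rewrite (homB hpr) => /eqP; rewrite subr_eq0 => /eqP. Qed.

Let qtE : pr (\sum_i q i *: free_gen k (inl i) + free_gen k (inr true)) =
  \sum_i q i *: pr (free_gen k (inl i)) + pr (free_gen k (inr true)).
Proof.
rewrite (homD hpr) (hom_sum hpr); congr (_ + _).
by apply: eq_bigr => i _; rewrite (homZ hpr).
Qed.

Lemma algB_hom_facts :
  [/\ idempotents (fun i => pr (free_gen k (inl i))),
    forall v, pr (free_gen k (inr true)) * pr (free_gen k (inl v)) =
              pr (free_gen k (inl v)) * pr (free_gen k (inr true)),
    (\sum_i q i *: pr (free_gen k (inl i)) + pr (free_gen k (inr true)))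
      * pr (free_gen k (inr false)) = 1
  & pr (free_gen k (inr false)) *
    (\sum_i q i *: pr (free_gen k (inl i)) + pr (free_gen k (inr true))) = 1].
Proof.
split; first split.
- move=> i; have := prB (@algB_idem k V q _ (idem_sqr _ i)).
  by rewrite (homM hpr) => E; exact: E.
- move=> i j ne.
  have := @pr0 _ (@algB_idem k V q _ (idem_orth (fun i => free_gen k (inl i)) ne)).
  by rewrite (homM hpr) => E; exact: E.
- have := prB (@algB_idem k V q _ (idem_sum (fun i => free_gen k (inl i)))).
  by rewrite (hom_sum hpr) (hom1 hpr) => E; exact: E.
- move=> v; pose P1 := homM hpr (free_gen k (inr true)) (free_gen k (inl v)).
  pose P2 := homM hpr (free_gen k (inl v)) (free_gen k (inr true)).
  exact (etrans (esym P1) (etrans (prB (algB_comm q v)) P2)).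
- rewrite -qtE -(hom1 hpr).
  exact (etrans (esym (homM hpr _ _)) (prB (algB_invr q))).
- rewrite -qtE -(hom1 hpr).
  exact (etrans (esym (homM hpr _ _)) (prB (algB_invl q))).
Qed.
End Hom.

Lemma algB_facts : let e := @algB_e k V q in let t := algB_t q in
  let u : algB q := presented_gen (@algB_rel k V q) (inr false) in
  [/\ idempotents e, forall v, t * e v = e v * t,
  (\sum_i q i *: e i + t) * u = 1 & u * (\sum_i q i *: e i + t) = 1].
Proof.
have hpr : @alg_hom k _ (algB q) (quo_proj (@algB_rel k V q)) by exact: quo_proj_hom.
have h0 z : @algB_rel k V q z -> (quo_proj (@algB_rel k V q) z : algB q) = 0.
  move=> h; rewrite -(hom0 hpr); apply/quo_projP.
  by rewrite subr0; exact: ideal_gen_in.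
exact (@algB_hom_facts (algB q) _ hpr h0).
Qed.
End AlgBFacts.

Section Core.
Variables (k : fieldType) (Q : quiver) (n : nat) (c : 'I_n -> dart Q).
Variables (F : {set dart Q}) (q : vertex Q -> k) (dlt : k).
Local Notation V := (vertex Q).
Local Notation word := (seq (lett Q)).
Implicit Types (j v : V) (w : word) (s : bool) (d : dart Q) (l : lett Q).
Local Notation M := (M k c F).
Local Notation nf := (nf c F).
Local Notation bv := (bv k c F).
Local Notation U := (U c F q dlt).
Local Notation eE := (eE k c F).
Local Notation tE := (tE k c F).
Local Notation cst := (cst q dlt).
Local Notation QE := (QE c F q dlt).
Local Notation RhoU := (RhoU c F q dlt).
Hypothesis c_cyc : is_cycle c.
Hypothesis F_off : {in F, forall d, off_cycle c d}.
Hypothesis F_star : {in F, forall d, star d \notin F}.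
Hypothesis F_tail : {in F, forall a, ~~ on_cycle c (dtail a)}.
Hypothesis q_neq0 : forall v, q v != 0.
Variables (eps : dart Q -> bool) (par : V -> dart Q) (sQ : seq (dart Q)).
Variable dep : V -> nat.
Hypothesis eps_c : forall i, eps (c i) = true.
Hypothesis eps_cs : forall i, eps (star (c i)) = false.
Hypothesis sQ_mem : forall d, (d \in sQ) = off_cycle c d.
Hypothesis sQ_uniq : uniq sQ.
Hypothesis F_par : {in F, forall a, par (dtail a) = a}.
Hypothesis par_F : forall v, ~~ on_cycle c v -> par v \in F /\ dtail (par v) = v.
Hypothesis F_dep : {in F, forall a, (dep (dhead a) < dep (dtail a))%N}.

(** [A] is meant to be [L], but its generators may be the images of the standard ones under an
    automorphism. In this way arbitrary orders and orientations are covered. *)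
Variables (A : algebra k) (e : V -> A) (a y : dart Q -> A).
Hypothesis H : Lrel e a y.
Local Notation rhA := (rh c eps sQ a y).
Local Notation lv := (lval c q dlt e a y rhA).
Local Notation AE := (arrowE q dlt eps par sQ dep).
Local Notation XE := (unitE q dlt eps par sQ dep).

Section Action.
Variable Rho : bool -> End M.
Hypothesis RhoK : forall s, Rho s * Rho (~~ s) = 1.
Hypothesis Rho_eE : forall s v, Rho s * eE v = eE v * Rho s.
Hypothesis Rho_tE : forall s, tE * (Rho s - QE s) = Rho s - QE s.
Variable f : A -> End M.
Hypothesis hf : alg_hom f.
Hypothesis fe : forall v, f (e v) = eE v.
Hypothesis fa : forall d, f (a d) = AE Rho d.
Hypothesis fy : forall d, f (y d) = XE Rho d false.

Let LU := Act_Lunit c_cyc F_off F_star F_tail q_neq0 eps par dep sQ_mem RhoK Rho_eE Rho_tE.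

Lemma act_Lunit d s : f (Lunit a y d s) = XE Rho d s.
Proof. by rewrite (hom_Lunit hf fa fy) LU. Qed.

Lemma act_rh s : f (rhA s) = Rho s.
Proof.
case: s; rewrite /rh (hom_prod hf).
  rewrite -(Act_rho c_cyc F_off F_star F_tail q_neq0 eps_c eps_cs sQ_mem sQ_uniq
    F_par par_F F_dep RhoK Rho_eE Rho_tE).
  by apply: eq_bigr => d _; exact: act_Lunit.
rewrite -(Act_rhoV c_cyc F_off F_star F_tail q_neq0 eps_c eps_cs sQ_mem sQ_uniq
    F_par par_F F_dep RhoK Rho_eE Rho_tE).
by apply: eq_bigr => d _; exact: act_Lunit.
Qed.

Lemma act_lval l j w : ~~ isKR l -> nf j (l :: w) ->
  ap (f (lv l)) (bv j w) = bv j (l :: w).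
Proof.
move=> nl h; rewrite (hom_lval _ _ _ hf fe fa fy _ act_rh).
exact (lvalE_word c_cyc F_off F_star LU nl h).
Qed.
End Action.

Variable f1 : A -> End M.
Hypothesis hf1 : alg_hom f1.
Hypothesis f1e : forall v, f1 (e v) = eE v.
Hypothesis f1a : forall d, f1 (a d) = AE RhoU d.
Hypothesis f1y : forall d, f1 (y d) = XE RhoU d false.
Hypothesis A_ind : forall P : A -> Prop,
  (forall b x z, P x -> P z -> P (b *: x + z)) -> P 1 ->
  (forall x z, P x -> P z -> P (x * z)) ->
  (forall v, P (e v)) -> (forall d, P (a d)) -> (forall d, P (y d)) ->
  forall z, P z.

Local Notation theta := (@theta_map k Q n c F q dlt A e a y rhA).
Let RUK := RhoUK c F q dlt.
Let RUe := RhoU_eE c F q dlt.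
Let RUt := RhoU_tE c F dlt q_neq0.

Lemma f1_rh s : f1 (rhA s) = RhoU s.
Proof. exact (act_rh RUK RUe RUt hf1 f1a f1y s). Qed.

Lemma f1_lval l j w : nf j (l :: w) -> ap (f1 (lv l)) (bv j w) = bv j (l :: w).
Proof.
move=> h; case: (boolP (isKR l)) => [|nl]; last exact (act_lval RUK RUe RUt hf1 f1e f1a f1y nl h).
case: l h => // -[v|//|//] s h _; have e' := nf_st h; rewrite /= in e'.
have h' := nf_behead h.
rewrite /= (homM hf1) (homB hf1) (homZ hf1) (hom1 hf1) f1e f1_rh.
have RU : ap (RhoU s) (bv j w) = ap (U (KR v) s) (bv j w) by rewrite [LHS]lin_bv // e'.
rewrite apM apB apZ ap1 RU (U_cons q dlt _ h) //.
by rewrite addrC addKr eE_bv //= eqxx.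
Qed.

Let rAe := rh_e c eps sQ H.
Let rAK := rhK c eps sQ H.
Let th_lin := @theta_linear k Q n c F q dlt A e a y rhA.

Lemma theta_f1 z m : theta (ap (f1 z) m) = z * theta m.
Proof.
have R1 := @Int_RhoU k Q n c F q dlt A e a y H rhA rAe rAK.
apply: (A_ind (P := fun z => Int q dlt e a y rhA (f1 z) z)) => {z m}.
- by move=> b x z hx hz; rewrite (hom_lin hf1); apply: IntD => //; exact: IntZ.
- by rewrite (hom1 hf1); exact: Int1.
- by move=> x z hx hz; rewrite (homM hf1); exact: IntM.
- by move=> v; rewrite f1e; exact (Int_eE q dlt H rhA v).
- move=> d; rewrite f1a.
  exact (Int_AE c_cyc F_off F_star F_tail q_neq0 eps_c eps_cs sQ_mem sQ_uniq F_par par_F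
    F_dep RUK RUe RUt H rAe rAK R1 d).
move=> d; rewrite f1y.
exact (Int_XE c_cyc F_off F_star F_tail q_neq0 eps_c eps_cs sQ_mem sQ_uniq F_par par_F
  F_dep RUK RUe RUt H rAe rAK R1 d).
Qed.

Definition unitM : M := \sum_j bv j [::].

Lemma eE_unitM v : ap (eE v) unitM = bv v [::].
Proof.
rewrite /unitM (lin_sum (ap_linear _)) (bigD1 v) //= big1 => [|u ne].
  by rewrite addr0 eE_bv // eqxx.
by rewrite eE_bv //= (negbTE ne).
Qed.

Lemma theta_unitM : theta unitM = 1.
Proof.
rewrite /unitM (lin_sum th_lin) -(e_sum H).
by apply: eq_bigr => j _; exact: theta_nil.
Qed.

(** Under [f1] every letter is prepended, so the value of a word, applied to the empty words, gives
    the word back. *)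
Lemma thetaK : cancel theta (fun z => ap (f1 z) unitM).
Proof.
have L : linear (fun z => ap (f1 z) unitM).
  by move=> b x z; rewrite (hom_lin hf1) apD apZ.
apply: (M_ext (f := fun m => ap (f1 (theta m)) unitM) (g := id)) => //.
  by move=> b x z; rewrite th_lin L.
move=> j; elim=> [|l w IH] h; first by rewrite theta_nil f1e eE_unitM.
by rewrite theta_cons // (homM hf1) apM IH ?(nf_behead h) // f1_lval.
Qed.

Lemma f1K z : theta (ap (f1 z) unitM) = z.
Proof. by rewrite theta_f1 theta_unitM mulr1. Qed.

Variable f0 : A -> End M.
Hypothesis hf0 : alg_hom f0.
Hypothesis f0e : forall v, f0 (e v) = eE v.
Hypothesis f0a : forall d, f0 (a d) = AE QE d.
Hypothesis f0y : forall d, f0 (y d) = XE QE d false.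
Let QK := QEK c F dlt q_neq0.
Let Qe := QE_comm c F q dlt.
Let Qt := QE_tE c F q dlt.

Lemma f0_rh s : f0 (rhA s) = QE s.
Proof. exact (act_rh QK Qe Qt hf0 f0a f0y s). Qed.

Lemma f0_lval l j w : ~~ isKR l -> nf j (l :: w) -> ap (f0 (lv l)) (bv j w) = bv j (l :: w).
Proof. by move=> nl h; exact (act_lval QK Qe Qt hf0 f0e f0a f0y nl h). Qed.

(** Under [f0] the unit [rho] is [q], and its letters are shifted by exactly this scalar or its
    inverse. *)
Lemma f0_KR v s : f0 (lv (LU (KR v) s)) = 0.
Proof.
rewrite /= (homM hf0) (homB hf0) (homZ hf0) (hom1 hf0) f0e f0_rh mulrBr -Qe QE_eE.
by rewrite -alg_scalerAr mulr1 subrr.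
Qed.

Local Notation wv := (word_val c q dlt e a y rhA).

Lemma wv_cons l w : wv (l :: w) = lv l * wv w.
Proof. exact: big_cons. Qed.

Definition startsKR w : bool := if w is l :: _ then isKR l else true.

(** A letter of [rho] in second place forms a pattern only with another one, so a word without such
    letters can be set in front of a word that starts with one. *)
Lemma bad_KR l l' : ~~ isKR l -> isKR l' -> ~~ bad c F l l'.
Proof.
case: l => [d|[v|d|v] s] // _; case: l' => [//|[v'|//|//] s'] _ //=.
by rewrite kapE; case: ifP.
Qed.

Lemma f0_word u j w : all (predC (@isKR Q)) u -> nf j w -> startsKR w -> nf (st j w) u ->
  nf j (u ++ w) /\ ap (f0 (wv u)) (bv j w) = bv j (u ++ w).
Proof.
elim: u => [|l u IH] //=; first by rewrite /word_val big_nil (hom1 hf0).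
case/andP=> nl au hw sw /and3P[lk cp hu].
have [h E] := IH au hw sw hu.
have h' : nf j (l :: u ++ w).
  rewrite /= lk h andbT /=; case: u cp {IH au hu h E} => [|l' u] //= cp.
  move: cp; rewrite /compat andbT => /eqP e1; case: w sw e1 {hw} => [|l' w] /= sw ->.
    by rewrite eqxx.
  by rewrite eqxx /=; exact: bad_KR.
by split=> //; rewrite wv_cons (homM hf0) apM E f0_lval.
Qed.

Lemma theta_cat u j w : nf j (u ++ w) -> theta (bv j (u ++ w)) = wv u * theta (bv j w).
Proof.
elim: u => [|l u IH] h /=; first by rewrite /word_val big_nil mul1r.
by rewrite wv_cons theta_cons // IH ?(nf_behead h) // mulrA.
Qed.

Lemma f0_wvKR u : ~~ all (predC (@isKR Q)) u -> f0 (wv u) = 0.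
Proof.
elim: u => [//|l u IH] /=; rewrite wv_cons (homM hf0) negb_and negbK.
case: l => [d|[v|d|v] s] /=; try by move=> h; rewrite IH // mulr0.
by have := f0_KR v s => /= -> _; rewrite mul0r.
Qed.

Lemma theta_bv j w : nf j w -> theta (bv j w) = wv w * e j.
Proof. by move=> h; rewrite -[w]cats0 theta_cat ?cats0 // theta_nil. Qed.

Variable r : A.
Hypothesis r_def : r = rhA true - \sum_i q i *: e i.
Local Notation Lam := (@quo_by k A r).
Local Notation pi := (@quo_by_proj k A r).

Let piS z : z = r -> f0 z = 0.
Proof.
move=> ->; rewrite r_def (homB hf0) f0_rh (hom_sum hf0) QE_sum.
apply/eqP; rewrite subr_eq0; apply/eqP; apply: eq_bigr => i _.
by rewrite (homZ hf0) f0e.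
Qed.

Definition fbar : Lam -> End M := quo_lift (S := fun z => z = r) f0.

Lemma fbar_hom : alg_hom fbar. Proof. exact: quo_lift_hom hf0 piS. Qed.
Lemma fbar_pi x : fbar (pi x) = f0 x. Proof. exact: quo_lift_proj hf0 piS x. Qed.
Lemma pi_hom : alg_hom pi. Proof. exact: quo_proj_hom. Qed.
Lemma pi_surj (x : Lam) : exists z, pi z = x. Proof. exact: quo_proj_surj. Qed.

Definition fpp_section (x : Lam) : A := theta (ap (fbar x) unitM).
(* Holds for words starting with [KR], hence for the image of [r]. *)
Definition good (m : M) : Prop :=
  forall x, theta (ap (fbar x) m) = fpp_section x * theta m.

Lemma good_lin b m1 m2 : good m1 -> good m2 -> good (b *: m1 + m2).
Proof.
move=> h1 h2 x; rewrite (ap_linear (fbar x)) !th_lin h1 h2.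
by rewrite mulrDr alg_scalerAr.
Qed.

Lemma good0 : good 0.
Proof. by move=> x; rewrite ap_in0 (lin0 th_lin) mulr0. Qed.

(** It suffices to take for [x] the class of a word. If the word contains a letter of [rho] both
    sides vanish; otherwise it acts on [bv j w] and on the empty words by concatenation. *)
Lemma good_bv j w : nf j w -> startsKR w -> good (bv j w).
Proof.
move=> hw sw x; have [z <-] := pi_surj x; rewrite /fpp_section fbar_pi -(f1K z).
have L m : linear (fun z => theta (ap (f0 (theta z)) m)).
  by move=> b z1 z2; rewrite th_lin (hom_lin hf0) apD apZ th_lin.
move: (ap (f1 z) unitM); apply: (M_ext (f := fun m => theta (ap (f0 (theta m)) (bv j w)))
   (g := fun m => theta (ap (f0 (theta m)) unitM) * theta (bv j w))) => [//||i u hu].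
  by move=> b m1 m2; rewrite L mulrDl alg_scalerAl.
rewrite theta_bv // (homM hf0) f0e !apM eE_unitM.
have [au|/f0_wvKR ->] := boolP (all (predC (@isKR Q)) u); last by rewrite !ap0 (lin0 th_lin) mul0r.
have [_ ->] := f0_word (j := i) (w := [::]) au isT isT hu.
rewrite cats0 (theta_bv hu) -mulrA -(e_theta q dlt H rhA hw) eE_bv //.
case: eqP => [ei|/eqP ne]; last first.
  by rewrite ap_in0 (lin0 th_lin) (mulrA (e i)) (e_orth H) 1?eq_sym // mul0r mulr0.
rewrite (mulrA (e i)) ei (eK H) -ei (e_theta q dlt H rhA hw).
rewrite -ei in hu; have [h ->] := f0_word au hw sw hu.
exact: theta_cat.
Qed.

Lemma f1r_bv j w : nf j w ->
  ap (f1 r) (bv j w) = ap (U (KR (st j w)) true) (bv j w) - q (st j w) *: bv j w.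
Proof.
move=> h; rewrite r_def (homB hf1) f1_rh (hom_sum hf1) apB [ap (RhoU _) _]lin_bv //.
congr (_ - _); rewrite ap_sum (bigD1 (st j w)) //= big1 => [|i ne].
  by rewrite addr0 (homZ hf1) f1e apZ eE_bvT.
by rewrite (homZ hf1) f1e apZ eE_bv // eq_sym (negbTE ne) scaler0.
Qed.

(** The image of [r] is spanned by words that start with a letter of [rho]: the only rewriting is [r
    (rho^-1 - q^-1) = - q^-1 r - q (rho^-1 - q^-1)], to which induction applies. *)
Lemma good_f1r m : good (ap (f1 r) m).
Proof.
elim/M_ind: m => [b m1 m2 h1 h2||j w].
- by rewrite (ap_linear (f1 r)); exact: good_lin.
- by rewrite ap_in0; exact: good0.
elim: w => [|l w IH] h; rewrite f1r_bv //; case: (UP q dlt true _ h) => //.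
- by move=> e1 hn _; rewrite addrC addKr; exact: good_bv.
- move=> w' [el <-] h' e1; have := IH h'; rewrite f1r_bv // e1 /=.
  set G := ap (U _ _) _; set m := bv j w; set t := ltl l => g1.
  have gl : good (bv j (l :: w)) by apply: good_bv => //; rewrite /= el.
  have -> : m - (q t)^-1 *: G - q t *: bv j (l :: w) =
      - (q t)^-1 *: (G - q t *: m) + (- q t *: bv j (l :: w) + 0).
    by rewrite scalerBr scalerA mulNr mulVf // scaleN1r opprK addr0 !scaleNr [- _ + m]addrC.
  by do 2?[apply: good_lin => //]; exact: good0.
- by move=> e1 hn _; rewrite addrC addKr; exact: good_bv.
Qed.

Local Notation BB := (algB q).
Local Notation tB := (algB_t q).
Local Notation eB := (@algB_e k V q).
Local Notation uB := (presented_gen (@algB_rel k V q) (inr false)).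
Local Notation B_rel := (@algB_rel k V q).

Let r_e v : r * e v = e v * r.
Proof.
by rewrite r_def mulrBl mulrBr rAe (scalars_comm _ (Lrel_idem H)).
Qed.

Let qr : \sum_i q i *: e i + r = rhA true.
Proof. by rewrite r_def addrC subrK. Qed.

Definition tau_gen (x : V + bool) : A :=
  match x with inl v => e v | inr b => if b then r else rhA false end.

Lemma tau_rel z : B_rel z -> free_lift tau_gen z = 0.
Proof.
have hf := free_lift_hom tau_gen; have gE := free_lift_gen tau_gen.
have qtE : free_lift tau_gen (\sum_i q i *: free_gen k (inl i) + free_gen k (inr true)) =
    rhA true.
  rewrite (homD hf) (hom_sum hf) gE -qr; congr (_ + _).
  by apply: eq_bigr => i _; rewrite (homZ hf) gE.
case=> {z} [z iz|i||].
- by apply: (idempotents_hom (e := e) hf _ (Lrel_idem H) iz) => i; exact: gE.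
- have E1 := homM hf (free_gen k (inr true)) (free_gen k (inl i)).
  have E2 := homM hf (free_gen k (inl i)) (free_gen k (inr true)).
  apply/eqP; rewrite (homB hf) subr_eq0; apply/eqP; apply: (etrans E1).
  by rewrite [RHS]E2 !gE /= r_e.
- by rewrite (homB hf) (homM hf) qtE gE (hom1 hf) /= (rAK true) subrr.
- by rewrite (homB hf) (homM hf) qtE gE (hom1 hf) /= (rAK false) subrr.
Qed.

Definition tau : BB -> A := @plift k _ B_rel A tau_gen.
Lemma tau_hom : alg_hom tau. Proof. exact: plift_hom tau_rel. Qed.
Lemma tau_e v : tau (eB v) = e v. Proof. exact: plift_gen tau_rel _. Qed.
Lemma tau_t : tau tB = r. Proof. exact: plift_gen tau_rel _. Qed.
Lemma tau_u : tau uB = rhA false. Proof. exact: plift_gen tau_rel _. Qed.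

Local Notation eL := (@quo_by_e k V A e r).
Local Notation P := (free_prod eL eB).
Local Notation inL := (@fp_inl k V Lam BB eL eB).
Local Notation inB := (@fp_inr k V Lam BB eL eB).

Lemma fp_facts : [/\ alg_hom inL, alg_hom inB & forall v, inL (eL v) = inB (eB v)].
Proof.
pose R := free_prod_rel eL eB; pose pr := quo_proj R.
have hpr : alg_hom pr by exact: quo_proj_hom.
have prB x z : R (x - z) -> pr x = pr z.
  move=> h; apply/eqP; rewrite -subr_eq0 -(homB hpr) -(hom0 hpr); apply/eqP/quo_projP.
  by rewrite subr0; exact: ideal_gen_in.
split; last by move=> v; apply: prB; exact: fp_base.
  split=> [b x z|]; last split=> [|x z].
  - have := prB _ _ (fp_addA eL eB (b *: x) z); rewrite (homD hpr) => E.
    by have := prB _ _ (fp_scaleA eL eB b x); rewrite (homZ hpr) => E2; rewrite [LHS]E [in LHS]E2.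
  - exact (etrans (prB _ _ (fp_oneA eL eB)) (hom1 hpr)).
  - by have := prB _ _ (fp_mulA eL eB x z); rewrite (homM hpr).
split=> [b x z|]; last split=> [|x z].
- have := prB _ _ (fp_addB eL eB (b *: x) z); rewrite (homD hpr) => E.
  by have := prB _ _ (fp_scaleB eL eB b x); rewrite (homZ hpr) => E2; rewrite [LHS]E [in LHS]E2.
- exact (etrans (prB _ _ (fp_oneB eL eB)) (hom1 hpr)).
- by have := prB _ _ (fp_mulB eL eB x z); rewrite (homM hpr).
Qed.

(** [Lambda^q] acts with [rho] scalar and [B] acts with [rho] free, on the same space. The two
    actions agree on the idempotents, which is all that a free product over [kQ_0] demands. *)
Definition Gam_gen (x : Lam + BB) : End M :=
  match x with inl u => fbar u | inr b => f1 (tau b) end.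

Lemma Gam_rel z : free_prod_rel eL eB z -> free_lift Gam_gen z = 0.
Proof.
have hf := free_lift_hom Gam_gen; have gE := free_lift_gen Gam_gen.
have fh := fbar_hom; have th := tau_hom.
case=> {z} [x z|b x||x z|x z|b x||x z|i]; rewrite (homB hf) gE /=.
- by rewrite (homD hf) !gE /= (homD fh) subrr.
- by rewrite (homZ hf) gE /= (homZ fh) subrr.
- by rewrite (hom1 hf) (hom1 fh) subrr.
- by rewrite (homM hf) !gE /= (homM fh) subrr.
- by rewrite (homD hf) !gE /= (homD th) (homD hf1) subrr.
- by rewrite (homZ hf) gE /= (homZ th) (homZ hf1) subrr.
- by rewrite (hom1 hf) (hom1 th) (hom1 hf1) subrr.
- by rewrite (homM hf) !gE /= (homM th) (homM hf1) subrr.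
- by rewrite gE /= fbar_pi tau_e f0e f1e subrr.
Qed.

Definition Gam : P -> End M := @plift k _ (free_prod_rel eL eB) (End M) Gam_gen.
Lemma Gam_hom : alg_hom Gam. Proof. exact: plift_hom Gam_rel. Qed.
Lemma Gam_L x : Gam (inL x) = fbar x. Proof. exact: plift_gen Gam_rel _. Qed.
Lemma Gam_B b : Gam (inB b) = f1 (tau b). Proof. exact: plift_gen Gam_rel _. Qed.

Lemma pi_rh s : pi (rhA s) = \sum_i cst (KR i) s *: pi (e i).
Proof.
have ph := pi_hom.
have p0 : pi r = 0.
  rewrite -(hom0 ph); apply/quo_projP; rewrite subr0; exact: ideal_gen_in.
have pT : pi (rhA true) = \sum_i q i *: pi (e i).
  rewrite -qr (homD ph) p0 addr0 (hom_sum ph).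
  by apply: eq_bigr => i _; rewrite (homZ ph).
case: s => //=.
have [p1 p2 p3] := Lrel_idem (Lrel_hom ph H).
(* The inverse of [rho] is not among the relations of the quotient, but it must be the inverse of
   [q] there. *)
have E : (\sum_i (q i)^-1 *: pi (e i)) * pi (rhA true) = 1.
  rewrite pT mulr_suml -[RHS]p3; apply: eq_bigr => i _.
  rewrite mulr_sumr (bigD1 i) //= big1 => [|u ne].
    by rewrite addr0 -alg_scalerAl -alg_scalerAr p1 scalerA mulVf // scale1r.
  by rewrite -alg_scalerAl -alg_scalerAr p2 ?scaler0 // eq_sym.
by rewrite -[LHS]mul1r -E -mulrA -(homM ph) (rAK true) (hom1 ph) mulr1.
Qed.

Section AbstractProduct.
Variables (BB : algebra k) (eB : V -> BB) (tB uB : BB).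
Hypothesis eI : idempotents eB.
Hypothesis te : forall v, tB * eB v = eB v * tB.
Hypothesis qu : (\sum_i q i *: eB i + tB) * uB = 1.
Hypothesis uq : uB * (\sum_i q i *: eB i + tB) = 1.
Hypothesis B_ind : forall Pr : BB -> Prop,
  (forall b x z, Pr x -> Pr z -> Pr (b *: x + z)) -> Pr 1 ->
  (forall x z, Pr x -> Pr z -> Pr (x * z)) ->
  (forall v, Pr (eB v)) -> Pr tB -> Pr uB -> forall z, Pr z.
Variable tau : BB -> A.
Hypothesis th : alg_hom tau.
Hypothesis tau_e : forall v, tau (eB v) = e v.
Hypothesis tau_t : tau tB = r.
Hypothesis tau_u : tau uB = rhA false.
(** Any [P] that is generated by compatible images of [Lambda^q] and [B] and acts on [M] through
    both can take the place of the free product. *)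
Variables (P : algebra k) (inL : Lam -> P) (inB : BB -> P).
Hypothesis iL : alg_hom inL.
Hypothesis iB : alg_hom inB.
Hypothesis iE : forall v, inL (pi (e v)) = inB (eB v).
Hypothesis P_ind : forall Pr : P -> Prop,
  (forall b x z, Pr x -> Pr z -> Pr (b *: x + z)) -> Pr 1 ->
  (forall x z, Pr x -> Pr z -> Pr (x * z)) ->
  (forall x, Pr (inL x)) -> (forall b, Pr (inB b)) -> forall z, Pr z.
Variable Gam : P -> End M.
Hypothesis Gh : alg_hom Gam.
Hypothesis Gam_L : forall x, Gam (inL x) = fbar x.
Hypothesis Gam_B : forall b, Gam (inB b) = f1 (tau b).

Definition eP v : P := inL (pi (e v)).
Definition aP d : P := inL (pi (a d)).
Definition yP d : P := inL (pi (y d)).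
Definition rP s : P := inB (if s then \sum_i q i *: eB i + tB else uB).

Let hLP : alg_hom (fun x => inL (pi x)).
Proof. exact: alg_hom_comp iL pi_hom. Qed.

Lemma HP : Lrel eP aP yP. Proof. exact: (Lrel_hom hLP H). Qed.

Lemma rP_e s v : rP s * eP v = eP v * rP s.
Proof.
have [E E'] := shifted_comm eI (te v) qu uq.
rewrite /eP iE.
case: s.
  exact (etrans (esym (homM iB _ _)) (etrans (congr1 inB E) (homM iB _ _))).
exact (etrans (esym (homM iB _ _)) (etrans (congr1 inB E') (homM iB _ _))).
Qed.

Lemma rPK s : rP s * rP (~~ s) = 1.
Proof.
case: s.
  exact (etrans (esym (homM iB _ _)) (etrans (congr1 inB qu) (hom1 iB))).
exact (etrans (esym (homM iB _ _)) (etrans (congr1 inB uq) (hom1 iB))).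
Qed.

Local Notation IntP := (Int q dlt eP aP yP rP).
Local Notation thetaP := (@theta_map k Q n c F q dlt P eP aP yP rP).

Lemma rh_P s : rh c eps sQ aP yP s = inL (pi (rhA s)).
Proof.
have X b g : Lunit aP yP b g = inL (pi (Lunit a y b g)).
  by symmetry; exact: (hom_Lunit hLP).
by case: s; rewrite /rh (hom_prod hLP); apply: eq_bigr => *; exact: X.
Qed.

(** The arrows of [P] come from [Lambda^q], so their product of units is [q], as the scalar action
    requires. The letters of [rho] are evaluated separately, through [B]. *)
Lemma IntP_QE s : IntP (QE s) (rh c eps sQ aP yP s).
Proof.
rewrite rh_P pi_rh (hom_sum iL) QE_sum; apply: Int_sum => i.
by rewrite (homZ iL); apply: IntZ; exact (Int_eE q dlt HP rP i).
Qed.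

Lemma IntP_L x : IntP (f0 x) (inL (pi x)).
Proof.
apply: (A_ind (P := fun x => IntP (f0 x) (inL (pi x)))) => {x}.
- by move=> b x z hx hz; rewrite (hom_lin hf0) (hom_lin hLP); apply: IntD => //; exact: IntZ.
- by rewrite (hom1 hf0) (hom1 hLP); exact: Int1.
- by move=> x z hx hz; rewrite (homM hf0) (homM hLP); exact: IntM.
- by move=> v; rewrite f0e; exact (Int_eE q dlt HP rP v).
- move=> d; rewrite f0a.
  exact (Int_AE c_cyc F_off F_star F_tail q_neq0 eps_c eps_cs sQ_mem sQ_uniq F_par par_F
    F_dep QK Qe Qt HP rP_e rPK IntP_QE d).
move=> d; rewrite f0y.
exact (Int_XE c_cyc F_off F_star F_tail q_neq0 eps_c eps_cs sQ_mem sQ_uniq F_par par_F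
  F_dep QK Qe Qt HP rP_e rPK IntP_QE d).
Qed.

Lemma IntP_B b : IntP (f1 (tau b)) (inB b).
Proof.
have R1 := @Int_RhoU k Q n c F q dlt P eP aP yP HP rP rP_e rPK.
have Ie v : IntP (f1 (tau (eB v))) (inB (eB v)).
  by rewrite tau_e f1e -iE; exact (Int_eE q dlt HP rP v).
elim/B_ind: b => [b x z hx hz||x z hx hz|v||].
- by rewrite (hom_lin th) (hom_lin hf1) (hom_lin iB); apply: IntD => //; exact: IntZ.
- by rewrite (hom1 th) (hom1 hf1) (hom1 iB); exact: Int1.
- by rewrite (homM th) (homM hf1) (homM iB); exact: IntM.
- exact: Ie.
- rewrite tau_t.
  have -> : inB tB = rP true - \sum_i q i *: inB (eB i).
    rewrite /rP (homD iB) (hom_sum iB) addrAC -[LHS]add0r; congr (_ + _).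
    symmetry; apply/eqP; rewrite subr_eq0; apply/eqP; apply: eq_bigr => i _.
    exact: (homZ iB).
  rewrite r_def (homB hf1) (hom_sum hf1); apply: IntB; first by rewrite f1_rh; exact: R1.
  by apply: Int_sum => i; rewrite (homZ hf1) -(tau_e i); exact: IntZ.
- by rewrite tau_u f1_rh; exact: (R1 false).
Qed.

Lemma IntP_Gam g : IntP (Gam g) g.
Proof.
elim/P_ind: g => [b x z hx hz||x z hx hz|x|b].
- by rewrite (hom_lin Gh); apply: IntD => //; exact: IntZ.
- by rewrite (hom1 Gh); exact: Int1.
- by rewrite (homM Gh); exact: IntM.
- have [z <-] := pi_surj x.
  by rewrite Gam_L fbar_pi; exact: IntP_L.
- by rewrite Gam_B; exact: IntP_B.
Qed.

Lemma thetaP_unitM : thetaP unitM = 1.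
Proof.
rewrite /unitM (lin_sum (theta_linear q dlt eP aP yP rP)) -(e_sum HP).
by apply: eq_bigr => j _; exact: theta_nil.
Qed.

(** The letters of [rho] lie in [B] and act by [f1], all others lie in [Lambda^q] and act by [f0];
    in either case the letter is prepended. *)
Lemma Gam_thetaP m : ap (Gam (thetaP m)) unitM = m.
Proof.
apply: (M_ext (f := fun m => ap (Gam (thetaP m)) unitM) (g := id)) => //.
  by move=> b m1 m2; rewrite (theta_linear q dlt eP aP yP rP) (hom_lin Gh) apD apZ.
move=> j; elim=> [|l w IH] h; first by rewrite theta_nil Gam_L fbar_pi f0e eE_unitM.
rewrite theta_cons // (homM Gh) apM IH ?(nf_behead h) // -f1_lval //.
have [nl|] := boolP (~~ isKR l).
  rewrite f1_lval // -f0_lval //.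
  congr ap; rewrite -fbar_pi -Gam_L; congr Gam.
  have E := (hom_lval c q dlt (rh := rhA) (rh' := fun s => inL (pi (rhA s)))
    hLP (e' := eP) (a' := aP) (y' := yP)
    (fun v => erefl) (fun d => erefl) (fun d => erefl) l (fun s => erefl)).
  by rewrite [RHS]E; case: l nl {h E} => // -[].
case: l h => // -[v|//|//] s h _; congr ap => /=.
rewrite (homM Gh) (homB Gh) (homZ Gh) (hom1 Gh) Gam_L fbar_pi f0e Gam_B.
rewrite (homM hf1) (homB hf1) (homZ hf1) (hom1 hf1) f1e; congr (_ * (f1 _ - _)).
case: s {h}; last exact: tau_u.
rewrite (homD th) tau_t (hom_sum th) -qr; congr (_ + _).
by apply: eq_bigr => i _; rewrite (homZ th) tau_e.
Qed.

Definition prod_map (g : P) : A := theta (ap (Gam g) unitM).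

Lemma prod_map_bij : bijective prod_map.
Proof.
exists (fun z => thetaP (ap (f1 z) unitM)) => g; last by rewrite /prod_map Gam_thetaP f1K.
by rewrite /prod_map thetaK IntP_Gam thetaP_unitM mulr1.
Qed.

Lemma prod_map_linear : linear prod_map.
Proof. by move=> b x z; rewrite /prod_map (hom_lin Gh) apD apZ th_lin. Qed.

Lemma prod_map_word a0 (w : seq (BB * Lam)) :
  (forall i, (i < size w)%N -> exists b', (nth (0, 0) w i).1 = tB * b') ->
  prod_map (inL a0 * \prod_(p <- w) (inB p.1 * inL p.2)) =
  fpp_section a0 * \prod_(p <- w) (tau p.1 * fpp_section p.2).
Proof.
move=> bw.
pose G (w : seq (BB * Lam)) := ap (Gam (\prod_(p <- w) (inB p.1 * inL p.2))) unitM.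
(* [good] is the invariant that lets the next section value be split off. It is restored at every
   stage because [b = t b'] acts through [r]. *)
suff [E g] : theta (G w) = \prod_(p <- w) (tau p.1 * fpp_section p.2) /\ good (G w).
  by rewrite /prod_map (homM Gh) Gam_L apM g E.
elim: w bw => [|[b x] w IH] bw; rewrite /G.
  rewrite !big_nil (hom1 Gh) ap1 theta_unitM; split=> // z.
  by rewrite theta_unitM mulr1.
have [E g] := IH (fun i => bw i.+1).
rewrite !big_cons /= (homM Gh) (homM Gh) Gam_B Gam_L !apM theta_f1 g E mulrA.
split=> //; have [b' /= ->] := bw 0%N isT.
by rewrite (homM th) tau_t (homM hf1) apM; exact: good_f1r.
Qed.
End AbstractProduct.

Lemma fpp_section_bimodule : bimodule_section e fpp_section.
Proof.
have fh := fbar_hom; split.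
- by move=> b x z; rewrite /fpp_section (hom_lin fh) apD apZ th_lin.
- move=> i j x; rewrite /fpp_section !(homM fh) !fbar_pi !f0e !apM eE_unitM.
  rewrite (Int_eE q dlt H rhA i) -mulrA; congr (_ * _).
  by rewrite (good_bv (j := j) (w := [::]) isT isT x) theta_nil.
- by rewrite /fpp_section (hom1 fh) ap1 theta_unitM.
move=> x; have [z <-] := pi_surj x; rewrite /fpp_section fbar_pi -{2}(f1K z) -[in LHS](f1K z).
move: (ap (f1 z) unitM).
have pl : linear (fun m => pi (theta m)) by exact: linear_comp (hom_lin pi_hom) th_lin.
apply: (M_ext (f := fun m => pi (theta (ap (f0 (theta m)) unitM)))
   (g := fun m => pi (theta m))) => //.
  move=> b m1 m2; rewrite th_lin (hom_lin hf0) apD apZ.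
  exact: (pl b).
move=> j w h; rewrite theta_bv //.
(* A word with a letter of [rho] vanishes in [Lambda^q], and any other word is fixed already in
   [A]. *)
have [aw|nw] := boolP (all (predC (@isKR Q)) w).
  have [_ E] := f0_word (j := j) (w := [::]) aw isT isT h.
  by rewrite (homM hf0) f0e apM eE_unitM E cats0 theta_bv.
rewrite (homM hf0) f0_wvKR // mul0r ap0 (lin0 th_lin) (hom0 pi_hom).
suff pw : pi (wv w) = 0 by rewrite (homM pi_hom) pw mul0r.
elim: w nw {h} => [//|l w IH] /=; rewrite wv_cons (homM pi_hom) negb_and negbK.
case: l => [d|[v|d|v] s] /=; try by move=> h; rewrite IH // mulr0.
move=> _; have ph := pi_hom; rewrite (homM ph) (homB ph) pi_rh (homZ ph) (hom1 ph).
have [p1 p2 p3] := Lrel_idem (Lrel_hom ph H).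
rewrite mulrBr mulr_sumr (bigD1 v) //= big1 => [|u ne].
  by rewrite addr0 -!alg_scalerAr p1 mulr1 subrr mul0r.
by rewrite -alg_scalerAr p2 ?scaler0 // eq_sym.
Qed.

Lemma fpp_section_fpp : strong_free_product q e fpp_section.
Proof.
have [eI te qu uq] := algB_facts q.
have Bi (Pr : BB -> Prop) (PL : forall b x z, Pr x -> Pr z -> Pr (b *: x + z)) (P1 : Pr 1)
    (PM : forall x z, Pr x -> Pr z -> Pr (x * z)) (Pe : forall v, Pr (eB v)) (Pt : Pr tB)
    (Pu : Pr uB) : forall b, Pr b.
  exact (presented_ind PL P1 PM (fun x => match x with
    inl v => Pe v | inr true => Pt | inr false => Pu end)).
have Pi (Pr : P -> Prop) (PL : forall b x z, Pr x -> Pr z -> Pr (b *: x + z)) (P1 : Pr 1)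
    (PM : forall x z, Pr x -> Pr z -> Pr (x * z)) (PA : forall x, Pr (inL x))
    (PB : forall x, Pr (inB x)) : forall b, Pr b.
  exact (presented_ind PL P1 PM (fun x => match x with inl u => PA u | inr b => PB b end)).
have [iL iB iE] := fp_facts.
exists tau; first by split; [exact: tau_hom | exact: tau_e | exact: tau_t].
exists (prod_map Gam); split.
- exact: (prod_map_linear Gam_hom).
- move=> a0 w bw; apply: (prod_map_word tau_hom tau_t Gam_hom Gam_L Gam_B) => i iw.
  by have [b' E] := bw i iw; exists b'.
- exact (prod_map_bij eI te qu uq Bi tau_hom tau_e tau_t tau_u iL iB iE Pi Gam_hom Gam_L Gam_B).
Qed.
End Core.

(** * Change of order and orientation *)

Section Twists.
Variables (k : fieldType) (Q : quiver) (A : algebra k).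
Variables (e : vertex Q -> A) (a y : dart Q -> A).
Hypothesis H : Lrel e a y.
Local Notation X := (Lunit a y).
Implicit Types (d b : dart Q) (s : bool).

Lemma Lrel_intro (a' : dart Q -> A) (Y : dart Q -> bool -> A) :
  (forall d, e (dtail d) * a' d = a' d) -> (forall d, a' d * e (dhead d) = a' d) ->
  (forall d, 1 + a' d * a' (star d) = Y d true) ->
  (forall d s, Y d s * Y d (~~ s) = 1) ->
  Lrel e a' (Y^~ false) /\ forall d s, Lunit a' (Y^~ false) d s = Y d s.
Proof.
move=> ta ha aa YK; split=> [|d []//]; last by rewrite /Lunit aa.
by split=> //; [exact: Lrel_idem H | move=> d; rewrite aa; exact: (YK d true)
  | move=> d; rewrite aa; exact: (YK d false)].
Qed.

Let XVK d s : X d (~~ s) * X d s = 1.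
Proof. by have := XK H d (~~ s); rewrite negbK. Qed.

Lemma hom_fix_y (f : A -> A) : alg_hom f -> (forall d, f (a d) = a d) ->
  forall d, f (y d) = y d.
Proof.
move=> hf fa d; apply: (X_inv_uniq H).
have fX : f (X d true) = X d true by rewrite /Lunit (homD hf) (hom1 hf) (homM hf) !fa.
by rewrite -{1}fX -(homM hf) (XK H d true) (hom1 hf).
Qed.

Section Flip.
Variable D : pred (dart Q).
Hypothesis D_star : forall d, D (star d) = D d.

(* [a |-> - (1 + a a^* )^-1 a] and [a^* |-> a^*] invert both units. *)
Definition flip_a d : A := if D d && d.2 then - (y d * a d) else a d.
Definition flip_Y d s : A := X d (D d (+) s).

Lemma flip_Lrel : Lrel e flip_a (flip_Y^~ false) /\
  forall d s, Lunit flip_a (flip_Y^~ false) d s = flip_Y d s.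
Proof.
apply: Lrel_intro => d; rewrite /flip_a /flip_Y.
- case: ifP => _; rewrite ?(Lrel_tail H) // mulrN mulrA.
  by have := X_e H d false (dtail d) => /= <-; rewrite -mulrA (Lrel_tail H).
- by case: ifP => _; rewrite ?(Lrel_head H) // mulNr -mulrA (Lrel_head H).
- rewrite D_star; case: (D d) => //=; case d2: d.2 => /=.
    rewrite mulNr -mulrA (X_aa a y) mulrBr mulr1.
    by have /= -> := XK H d false; rewrite opprB addrC subrK.
  rewrite mulrN; have := X_starF H (star d); rewrite starK /= => ->.
  by rewrite mulrA.
by move=> s; case: (D d) s => -[]; exact: (XK H).
Qed.

Lemma flip_flip f d : alg_hom f -> (forall d, f (a d) = flip_a d) ->
  (forall d, f (y d) = flip_Y d false) -> f (flip_a d) = a d.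
Proof.
move=> hf fa fy; rewrite /flip_a; case: ifP => Dd; last by rewrite fa /flip_a Dd.
rewrite (homN hf) (homM hf) fa fy /flip_a /flip_Y Dd mulrN opprK mulrA.
have [-> _] := andP Dd.
by have /= -> := XK H d true; rewrite mul1r.
Qed.
End Flip.

Section Conjugate.
Variables (b d : dart Q).
Hypotheses (bd : b != d) (bds : b != star d).

(* Conjugates the unit of [b] by that of [d], fixing all other units. *)
Definition conj_a s b' : A :=
  if b' == b then X d s * a b else if b' == star b then a (star b) * X d (~~ s) else a b'.
Definition conj_Y s b' t : A := if b' == b then X d s * X b t * X d (~~ s) else X b' t.

Lemma conj_Lrel s : Lrel e (conj_a s) ((conj_Y s)^~ false) /\
  forall d t, Lunit (conj_a s) ((conj_Y s)^~ false) d t = conj_Y s d t.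
Proof.
apply: Lrel_intro => b'; rewrite /conj_a /conj_Y.
- case: eqP => [->|_]; first by rewrite mulrA -(X_e H) -mulrA (Lrel_tail H).
  by case: eqP => [->|_]; rewrite ?(Lrel_tail H) // mulrA (Lrel_tail H).
- case: eqP => [->|_]; first by rewrite -mulrA (Lrel_head H).
  case: eqP => [->|_]; rewrite ?(Lrel_head H) // -mulrA dhead_star (X_e H) mulrA.
  by have := Lrel_head H (star b); rewrite dhead_star => ->.
- rewrite star_eq (inj_eq (inv_inj (@starK Q))).
  have [->|ne] := eqVneq b' b.
    rewrite -[b == star b]star_eq star_neq mulrA -[_ * a b * _]mulrA (X_aa a y).
    by rewrite mulrBr mulr1 mulrBl (XK H) addrC subrK.
  have [->|ne'] := eqVneq b' (star b); last by [].
  rewrite mulrA -[_ * X d (~~ s) * _]mulrA XVK mulr1.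
  by rewrite /Lunit starK.
move=> t; case: ifP => _; last exact: (XK H).
rewrite -!mulrA [X d (~~ s) * (X d s * _)]mulrA XVK mul1r.
by rewrite [X b t * _]mulrA (XK H) mul1r (XK H).
Qed.

Lemma conj_conj f s b' : alg_hom f -> (forall d, f (a d) = conj_a s d) ->
  (forall d, f (y d) = conj_Y s d false) -> f (conj_a (~~ s) b') = a b'.
Proof.
move=> hf fa fy.
have db : (d == b) = false by rewrite eq_sym (negbTE bd).
have dsb : (d == star b) = false by rewrite -star_eq eq_sym (negbTE bds).
have sdb : (star d == b) = false by rewrite eq_sym (negbTE bds).
have sdsb : (star d == star b) = false by rewrite (inj_eq (inv_inj (@starK Q))).
have fX t : f (X d t) = X d t.
  by rewrite (hom_Lunit hf fa fy); have [_ ->] := conj_Lrel s; rewrite /conj_Y db.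
rewrite /conj_a; case: eqP => [->|/eqP ne].
  by rewrite (homM hf) fX fa /conj_a eqxx mulrA XVK mul1r.
case: eqP => [->|/eqP ne']; last by rewrite fa /conj_a (negbTE ne) (negbTE ne').
rewrite (homM hf) fX fa /conj_a star_neq eqxx -mulrA negbK.
by rewrite XVK mulr1.
Qed.
End Conjugate.

Section Exchange.
Variable d : dart Q.
Hypothesis loop : dtail d = dhead d.

(** For a loop, [d] and [d^*] obey the same tail and head conditions and may be interchanged, which
    swaps their units. *)
Definition exch b : dart Q := if (b == d) || (b == star d) then star b else b.

Lemma exch_star b : exch (star b) = star (exch b).
Proof.
rewrite /exch star_eq (inj_eq (inv_inj (@starK Q))) orbC.
by case: ifP => // _; rewrite starK.
Qed.

Lemma exch_tail b : dtail (exch b) = dtail b.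
Proof.
by rewrite /exch; case: ifP => // /orP[]/eqP->; rewrite ?starK ?dtail_star.
Qed.

Lemma exchK : involutive exch.
Proof.
move=> b; rewrite {2}/exch; case: ifP => E; last by rewrite /exch E.
by rewrite exch_star /exch E starK.
Qed.

Lemma exch_Lrel : Lrel e (fun b => a (exch b)) (fun b => X (exch b) false) /\
  forall b t, Lunit (fun b => a (exch b)) (fun b => X (exch b) false) b t = X (exch b) t.
Proof.
apply: (@Lrel_intro _ (fun b s => X (exch b) s)) => b.
- by rewrite -exch_tail (Lrel_tail H).
- by rewrite -[dhead b]dtail_star -exch_tail exch_star dtail_star (Lrel_head H).
- by rewrite exch_star.
by move=> s; exact: (XK H).
Qed.
End Exchange.

Lemma X_comm d b s t : dtail d != dtail b -> X d s * X b t = X b t * X d s.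
Proof.
move=> ne.
have E0 d' b' : dtail d' != dtail b' -> X d' true * X b' true = X d' true + X b' true - 1.
  move=> ne'; rewrite -[X b' true]/(1 + _) mulrDr mulr1 mulrA.
  have -> : X d' true * a b' = a b'.
    by rewrite -(Lrel_tail H b') mulrA (X_off H) // eq_sym.
  by rewrite -[in RHS]addrA [1 + _]addrC addrK.
have E : X d true * X b true = X b true * X d true.
  have ne' : dtail b != dtail d by rewrite eq_sym.
  by rewrite (E0 _ _ ne) (E0 _ _ ne') [Lunit a y b true + _]addrC.
have E1 : X d s * X b true = X b true * X d s.
  by case: s => //; exact: comm_inv (XK H d true) (XK H d false) E.
by case: t => //; symmetry; apply: comm_inv (XK H b true) (XK H b false) _; rewrite E1.
Qed.
End Twists.

Section RhoChange.
Variables (k : fieldType) (Q : quiver).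
Local Notation L := (algL k Q).
Local Notation e := (@Le k Q).
Local Notation La := (@La k Q).
Local Notation Linv := (@Linv k Q).
Local Notation rho := (@rho k Q).
Implicit Types (d b : dart Q) (p u v s : seq (dart Q)) (eps : dart Q -> bool).

Definition auto_equiv (x x' : L) : Prop := exists f g : L -> L,
  [/\ alg_hom f, alg_hom g, cancel f g & cancel g f] /\ (forall i, f (e i) = e i) /\ f x = x'.

Lemma auto_equiv_refl x : auto_equiv x x.
Proof. by exists id, id; split; split. Qed.

Lemma auto_equiv_trans x x' x'' : auto_equiv x x' -> auto_equiv x' x'' -> auto_equiv x x''.
Proof.
move=> [f [g [[hf hg fg gf] [fe E]]]] [f' [g' [[hf' hg' fg' gf'] [fe' E']]]].
exists (fun z => f' (f z)), (fun z => g (g' z)); split; last by split=> [v|]; rewrite ?fe ?E.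
by split; [exact: alg_hom_comp hf' hf | exact: alg_hom_comp hg hg' | |] => z;
  rewrite ?fg' ?gf ?fg ?gf'.
Qed.

Lemma L_hom_id (f : L -> L) : alg_hom f -> (forall i, f (e i) = e i) ->
  (forall d, f (La d) = La d) -> f =1 id.
Proof.
move=> hf fe fa z; elim/L_ind: z => [b x z ex ez||x z ex ez|//|//|d].
- by rewrite (hom_lin hf) ex ez.
- exact: (hom1 hf).
- by rewrite (homM hf) ex ez.
exact (hom_fix_y (L_Lrel k Q) hf fa d).
Qed.

Lemma Llift_equiv (a1 y1 a2 y2 : dart Q -> L) x :
  Lrel e a1 y1 -> Lrel e a2 y2 ->
  (forall d, Llift e a1 y1 (a2 d) = La d) -> (forall d, Llift e a2 y2 (a1 d) = La d) ->
  auto_equiv x (Llift e a1 y1 x).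
Proof.
move=> H1 H2 E1 E2; exists (Llift e a1 y1), (Llift e a2 y2).
have h1 := Llift_hom H1; have h2 := Llift_hom H2.
split; last by split=> // v; exact: (Llift_e H1).
split=> // z.
  apply: (L_hom_id (alg_hom_comp h2 h1)) => [v|d].
    by rewrite (Llift_e H1) (Llift_e H2).
  by rewrite (Llift_a H1).
apply: (L_hom_id (alg_hom_comp h1 h2)) => [v|d].
  by rewrite (Llift_e H2) (Llift_e H1).
by rewrite (Llift_a H2).
Qed.

Lemma Llift_rho (a' : dart Q -> L) (Y : dart Q -> bool -> L) eps s :
  Lrel e a' (Y^~ false) -> (forall d t, Lunit a' (Y^~ false) d t = Y d t) ->
  Llift e a' (Y^~ false) (rho eps s) = \prod_(d <- s) Y d (eps d).
Proof.
move=> H' YE; rewrite /Defs.rho (hom_prod (Llift_hom H')).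
by apply: eq_bigr => d _; rewrite (Llift_x H') YE.
Qed.

Lemma rho_flip eps eps' s : orientation eps -> orientation eps' ->
  auto_equiv (rho eps s) (rho eps' s).
Proof.
move=> oe oe'; pose D d := eps d (+) eps' d.
have Ds d : D (star d) = D d by rewrite /D oe oe' addbN addNb negbK.
have [H' YE] := flip_Lrel (L_Lrel k Q) Ds.
have -> : rho eps' s = Llift e (flip_a La Linv D) ((flip_Y La Linv D)^~ false) (rho eps s).
  by rewrite (Llift_rho _ _ H' YE); apply: eq_bigr => d _; rewrite /flip_Y /D addbC addbA addbb.
have E d : Llift e (flip_a La Linv D) ((flip_Y La Linv D)^~ false) (flip_a La Linv D d) = La d.
  exact (flip_flip (L_Lrel k Q) d (Llift_hom H') (Llift_a H') (Llift_y H')).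
exact (Llift_equiv _ H' H' E E).
Qed.

(** Conjugating the unit of [b] by that of [d] turns the product of the two units into the product
    in the other order. If [b = d^*], the units commute unless [d] is a loop; for a loop the two
    arrows are interchanged, at the price of a change of orientation. *)
Lemma rho_swap eps u v d b : orientation eps -> uniq (u ++ b :: d :: v) ->
  auto_equiv (rho eps (u ++ b :: d :: v)) (rho eps (u ++ d :: b :: v)).
Proof.
move=> oe un.
have [nbd bu bv du dv] : [/\ b != d, b \notin u, b \notin v, d \notin u & d \notin v].
  move: un; rewrite cat_uniq /= inE !negb_or => /and3P[_ /and3P[-> -> _]].
  by case/and3P=> /andP[-> ->] ->.
have HL := L_Lrel k Q.
have congY (Y : dart Q -> bool -> L) w : (forall x, x \in w -> Y x (eps x) = Lx k x (eps x)) ->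
    \prod_(x <- w) Y x (eps x) = rho eps w.
  by move=> h; rewrite /Defs.rho !big_seq; exact: eq_bigr.
have [bE|nbs] := eqVneq b (star d); last first.
  have [H1 YE1] := conj_Lrel HL b d (eps d).
  have [H2 YE2] := conj_Lrel HL b d (~~ eps d).
  have E1 x : Llift e (conj_a La Linv b d (eps d)) ((conj_Y La Linv b d (eps d))^~ false)
      (conj_a La Linv b d (~~ eps d) x) = La x.
    exact (conj_conj HL nbd nbs x (Llift_hom H1) (Llift_a H1) (Llift_y H1)).
  have E2 x : Llift e (conj_a La Linv b d (~~ eps d)) ((conj_Y La Linv b d (~~ eps d))^~ false)
      (conj_a La Linv b d (eps d) x) = La x.
    rewrite -{3}[eps d]negbK.
    exact (conj_conj HL nbd nbs x (Llift_hom H2) (Llift_a H2) (Llift_y H2)).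
  have := Llift_equiv (rho eps (u ++ b :: d :: v)) H1 H2 E1 E2.
  rewrite (Llift_rho _ _ H1 YE1) big_cat !big_cons.
  have Yn w x : b \notin w -> x \in w -> conj_Y La Linv b d (eps d) x (eps x) = Lx k x (eps x).
    by move=> bw xw; rewrite /conj_Y; case: eqP bw => // <-; rewrite xw.
  rewrite (congY _ u) ?(congY _ v) => [|x|x]; try exact: Yn.
  have -> : rho eps (u ++ d :: b :: v) =
      rho eps u * (Lx k d (eps d) * (Lx k b (eps b) * rho eps v)).
    by rewrite /Defs.rho big_cat !big_cons.
  have -> : conj_Y La Linv b d (eps d) b (eps b) =
      Lx k d (eps d) * Lx k b (eps b) * Lx k d (~~ eps d) by rewrite /conj_Y eqxx.
  have -> : conj_Y La Linv b d (eps d) d (eps d) = Lx k d (eps d).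
    by rewrite /conj_Y eq_sym (negbTE nbd).
  move: (rho eps u) (rho eps v) (LxK k d (~~ eps d)).
  rewrite negbK; move: (Lx k d (eps d)) (Lx k d (~~ eps d)) (Lx k b (eps b)) => /= x y z.
  move=> ru rv yx; rewrite -!(mulrA (x * z)) (mulrA y) yx mul1r.
  by rewrite (mulrA x z).
rewrite bE in bu bv *.
have rhoE f x y : rho f (u ++ x :: y :: v) =
    rho f u * (Lx k x (f x) * (Lx k y (f y) * rho f v)).
  by rewrite /Defs.rho big_cat !big_cons.
have [loop|nl] := eqVneq (dtail d) (dhead d); last first.
  have Xc : Lx k (star d) (eps (star d)) * Lx k d (eps d) =
      Lx k d (eps d) * Lx k (star d) (eps (star d)).
    by apply: (X_comm HL); rewrite dtail_star eq_sym.
  rewrite (rhoE _ (star d)) (rhoE _ d) (mulrA (Lx k (star d) _)) Xc -(mulrA (Lx k d _)).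
  exact: auto_equiv_refl.
have sdE : exch d (star d) = d by rewrite /exch eqxx orbT starK.
have dE : exch d d = star d by rewrite /exch eqxx.
have [H1 YE1] := exch_Lrel HL loop.
have E1 x : Llift e (fun b => La (exch d b)) (fun b => Lunit La Linv (exch d b) false)
    (La (exch d x)) = La x by rewrite (Llift_a H1) exchK.
have := Llift_equiv (rho eps (u ++ star d :: d :: v)) H1 H1 E1 E1.
pose eps' x := eps (exch d x).
have oe' : orientation eps' by move=> x; rewrite /eps' exch_star oe.
have -> : Llift e (fun b => La (exch d b)) (fun b => Lunit La Linv (exch d b) false)
    (rho eps (u ++ star d :: d :: v)) = rho eps' (u ++ d :: star d :: v).
  rewrite (@Llift_rho _ (fun b t => Lunit La Linv (exch d b) t) _ _ H1 YE1).
  rewrite rhoE big_cat !big_cons.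
  have fx (w : seq (dart Q)) x : d \notin w -> star d \notin w -> x \in w -> exch d x = x.
    rewrite /exch; case: eqP => [->|_] /negbTE dw sw xw; first by rewrite dw in xw.
    by case: eqP sw => [<-|//]; rewrite xw.
  have fw (w : seq (dart Q)) : d \notin w -> star d \notin w ->
      \prod_(x <- w) Lunit La Linv (exch d x) (eps x) = rho eps' w.
    move=> dw sw; rewrite /Defs.rho !big_seq; apply: eq_bigr => x xw.
    by have E := fx w x dw sw xw; rewrite /eps' E.
  rewrite (fw u du bu) (fw v dv bv) sdE dE; congr (_ * (_ * (_ * _))).
    by rewrite /eps' dE.
  by rewrite /eps' sdE.
move=> E; apply: auto_equiv_trans E _; exact: rho_flip.
Qed.

Lemma rho_move eps p u v d : orientation eps -> uniq (p ++ u ++ d :: v) ->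
  auto_equiv (rho eps (p ++ u ++ d :: v)) (rho eps (p ++ d :: u ++ v)).
Proof.
move=> oe; elim: u p => [|b u IH] p un; first exact: auto_equiv_refl.
apply: (@auto_equiv_trans _ (rho eps (p ++ b :: d :: u ++ v))).
  by have := IH (rcons p b); rewrite !cat_rcons; exact.
apply: rho_swap => //.
have pe : perm_eq (p ++ (b :: u) ++ d :: v) (p ++ b :: d :: u ++ v).
  by rewrite perm_cat2l /= perm_cons -cat1s perm_catCA.
by rewrite -(perm_uniq pe).
Qed.

Lemma rho_perm eps s s' : orientation eps -> uniq s -> perm_eq s s' ->
  auto_equiv (rho eps s) (rho eps s').
Proof.
move=> oe; rewrite -[s]cat0s -[s']cat0s perm_cat2l; move: [::] => p.
elim: s' p s => [|d s' IH] p s un pe.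
  by move/perm_nilP: pe => ->; exact: auto_equiv_refl.
have ds : d \in s by rewrite (perm_mem pe) mem_head.
case/splitPr: ds un pe => u v un pe.
apply: auto_equiv_trans (rho_move oe un) _.
have pe' : perm_eq (u ++ v) s' by rewrite -(perm_cons d) -cat1s perm_catCA.
rewrite -!cat_rcons; apply: IH => //.
have pm : perm_eq (p ++ u ++ d :: v) (rcons p d ++ u ++ v).
  by rewrite cat_rcons perm_cat2l -[d :: v]cat1s perm_catCA.
by rewrite -(perm_uniq pm).
Qed.

Lemma rho_equiv eps eps' s s' : orientation eps -> orientation eps' ->
  total_order s -> total_order s' -> auto_equiv (rho eps s) (rho eps' s').
Proof.
move=> oe oe' ts ts'; apply: auto_equiv_trans (rho_flip s oe oe') _.
apply: rho_perm => //; first by rewrite (perm_uniq ts) enum_uniq.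
by rewrite (perm_trans ts) // perm_sym.
Qed.
End RhoChange.

(** * A forest of shortest paths to the cycle *)

Section DistanceForest.
Variables (Q : quiver) (n : nat) (c : 'I_n -> dart Q).
Local Notation V := (vertex Q).
Implicit Types (v w : V) (d : dart Q).
Hypothesis c_cyc : is_cycle c.
Hypothesis Q_conn : connected Q.
Hypothesis n_gt0 : (0 < n)%N.

Fixpoint reaches m v : bool :=
  if m is m'.+1 then [exists d, (dtail d == v) && reaches m' (dhead d)] else on_cycle c v.

Lemma reaches_ex v : exists m, reaches m v.
Proof.
have /connectP[p pv ev] := Q_conn v (dtail (c (Ordinal n_gt0))).
elim: p v pv ev => [|w p IH] v /=.
  by move=> _ <-; exists 0%N; exact: on_c.
case/andP=> /existsP[d /andP[dv /eqP dw]] pw ew.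
have [m rm] := IH w pw ew; exists m.+1 => /=.
by apply/existsP; exists d; rewrite dv dw.
Qed.

Definition cdist v : nat := ex_minn (reaches_ex v).

(** The default is taken only on the cycle, where the distance is 0 and cannot decrease. *)
Definition cpar v : dart Q :=
  odflt (c (Ordinal n_gt0)) [pick d | (dtail d == v) && (cdist (dhead d) < cdist v)%N].

Lemma cparP v : ~~ on_cycle c v ->
  dtail (cpar v) = v /\ (cdist (dhead (cpar v)) < cdist v)%N.
Proof.
move=> nv; rewrite /cpar; case: pickP => [d /andP[/eqP dv]|] //= no.
have : exists m, cdist v = m.+1 /\ reaches m.+1 v.
  rewrite /cdist; case: ex_minnP => -[|m] rm _; last by exists m.
  by rewrite /= (negbTE nv) in rm.
case=> m [dm /existsP[d /andP[dv rd]]].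
have := no d; rewrite dv /= dm ltnS; suff -> : (cdist (dhead d) <= m)%N by [].
by rewrite /cdist; case: ex_minnP => m' _; exact.
Qed.

(** The free product property mentions no forest; connectedness supplies this one. *)
Definition cforest : {set dart Q} :=
  [set d | ~~ on_cycle c (dtail d) && (cpar (dtail d) == d)].

Lemma cforest_tail : {in cforest, forall d, ~~ on_cycle c (dtail d)}.
Proof. by move=> d; rewrite inE => /andP[]. Qed.

Lemma cforest_par : {in cforest, forall d, cpar (dtail d) = d}.
Proof. by move=> d; rewrite inE => /andP[_ /eqP]. Qed.

Lemma par_cforest v : ~~ on_cycle c v -> cpar v \in cforest /\ dtail (cpar v) = v.
Proof. by move=> nv; have [e _] := cparP nv; rewrite inE e nv eqxx. Qed.

Lemma cforest_dist : {in cforest, forall d, (cdist (dhead d) < cdist (dtail d))%N}.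
Proof.
move=> d dF; have [_] := cparP (cforest_tail dF).
by rewrite (cforest_par dF).
Qed.

Lemma cforest_off : {in cforest, forall d, off_cycle c d}.
Proof. by move=> d /cforest_tail; apply: contraNT; exact: on_cyc_dart. Qed.

Lemma cforest_star : {in cforest, forall d, star d \notin cforest}.
Proof.
move=> d /cforest_dist lt; apply/negP => /cforest_dist.
by rewrite dhead_star dtail_star ltnNge ltnW.
Qed.
End DistanceForest.

Section CycleOrder.
Variables (Q : quiver) (n : nat) (c : 'I_n -> dart Q).
Hypothesis c_cyc : is_cycle c.

Lemma cycle_order_mem d : (d \in cycle_order c) = ~~ off_cycle c d.
Proof.
apply/idP/idP => [|/(cyc_dartP)].
  by rewrite mem_cat => /orP[] /mapP[i _ ->]; rewrite ?off_star off_c.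
by case=> -[i ->]; rewrite mem_cat; apply/orP; [left | right];
  apply/mapP; exists i; rewrite ?mem_enum.
Qed.

Lemma cycle_order_uniq : uniq (cycle_order c).
Proof.
have [_ inj _] := c_cyc.
have inj' : injective c by move=> i i' e; apply: inj; rewrite e.
have u1 := enum_uniq 'I_n.
have sinj : injective (fun i => star (c i)) by move=> i i' /(inv_inj (@starK Q)) /inj'.
rewrite cat_uniq (map_inj_uniq inj') (map_inj_uniq sinj) u1 andbT /=.
apply/hasPn => _ /mapP[i _ ->]; apply/negP => /mapP[i' _ e].
by have := fwd_cs c_cyc i; rewrite e fwd_c.
Qed.

Lemma total_order_cycle s : total_order (cycle_order c ++ s) <->
  uniq s /\ forall d, (d \in s) = off_cycle c d.
Proof.
split=> [ts|[us ms]].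
  have := perm_uniq ts; rewrite enum_uniq cat_uniq => /and3P[_ /hasPn no us].
  split=> // d; have := perm_mem ts d; rewrite mem_enum mem_cat cycle_order_mem.
  case: (boolP (off_cycle c d)) => // od _.
  by apply/negbTE/negP => /no; rewrite /= cycle_order_mem od.
apply: uniq_perm; rewrite ?enum_uniq //.
  rewrite cat_uniq cycle_order_uniq us andbT; apply/hasPn => d ds /=.
  by rewrite cycle_order_mem negbK -ms.
by move=> d; rewrite mem_enum mem_cat cycle_order_mem ms orNb.
Qed.
End CycleOrder.

Section FreeProduct.
Variables (k : fieldType) (Q : quiver) (n : nat) (c : 'I_n -> dart Q) (q : vertex Q -> k).
Local Notation L := (algL k Q).

Lemma fpp_cycle (eps : dart Q -> bool) (s : seq (dart Q)) :
  connected Q -> (0 < n)%N -> is_cycle c -> (forall i, q i != 0) ->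
  orientation eps -> total_order s ->
  exists2 sigma : mult_preproj eps s q -> L,
    bimodule_section (L := L) (r := Lr eps s q) (@Le k Q) sigma
  & strong_free_product (L := L) (r := Lr eps s q) q (@Le k Q) sigma.
Proof.
move=> conn n0 cyc q0 oe ts.
(* The action was built for an order that starts with the cycle and an orientation along it. The
   given [rho] is reached from this one by an automorphism. *)
pose eps0 d := if off_cycle c d then eps d else fwd c d.
pose sQ := [seq d <- enum {: dart Q} | off_cycle c d].
have eps0_c i : eps0 (c i) = true by rewrite /eps0 off_c fwd_c.
have eps0_cs i : eps0 (star (c i)) = false by rewrite /eps0 off_star off_c fwd_cs.
have oe0 : orientation eps0.
  by move=> d; rewrite /eps0 off_star; case: ifP => od; rewrite ?oe // fwd_star ?od.
have sQ_mem d : (d \in sQ) = off_cycle c d by rewrite mem_filter mem_enum andbT.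
have sQ_uniq : uniq sQ by rewrite filter_uniq ?enum_uniq.
have ts0 : total_order (cycle_order c ++ sQ) by apply/(total_order_cycle cyc).
have [g [h [[hg hh gh hK] [ge grho]]]] := rho_equiv k oe0 oe ts0 ts.
(* A second family of generators of [L], whose product of units in the convenient order is the given
   [rho]. *)
pose a d := g (La k d); pose y d := g (Linv k d).
have H : Lrel (@Le k Q) a y.
  have := Lrel_hom hg (L_Lrel k Q); rewrite /a /y.
  by have -> : (fun v => g (Le k v)) = @Le k Q by apply/funext.
have he v : h (Le k v) = Le k v by rewrite -{1}(ge v) gh.
pose F := cforest c conn n0.
have F_off := @cforest_off Q n c cyc conn n0.
have F_star := @cforest_star Q n c conn n0.
have F_tail := @cforest_tail Q n c conn n0.
have F_par := @cforest_par Q n c conn n0.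
have par_F := @par_cforest Q n c conn n0.
have F_dep := @cforest_dist Q n c conn n0.
(* The constant 0 for the letters of [x] is an arbitrary choice here. *)
pose Act Rho := Llift (eE k c F) (arrowE q 0 eps0 (cpar c conn n0) sQ (cdist c conn n0) Rho)
   (fun d => unitE q 0 eps0 (cpar c conn n0) sQ (cdist c conn n0) Rho d false).
have HU := Act_Lrel cyc F_off F_star F_tail q0 eps0 (cpar c conn n0) (cdist c conn n0) sQ_mem
   (RhoUK c F q 0) (RhoU_eE c F q 0) (RhoU_tE c F 0 q0).
have HQ := Act_Lrel cyc F_off F_star F_tail q0 eps0 (cpar c conn n0) (cdist c conn n0) sQ_mem
   (QEK c F 0 q0) (QE_comm c F q 0) (QE_tE c F q 0).
have hU := alg_hom_comp (Llift_hom HU) hh.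
have hQ := alg_hom_comp (Llift_hom HQ) hh.
have Ue v := etrans (congr1 (Act (RhoU c F q 0)) (he v)) (Llift_e HU v).
have Ua d := etrans (congr1 (Act (RhoU c F q 0)) (gh (La k d))) (Llift_a HU d).
have Uy d := etrans (congr1 (Act (RhoU c F q 0)) (gh (Linv k d))) (Llift_y HU d).
have Qe v := etrans (congr1 (Act (QE c F q 0)) (he v)) (Llift_e HQ v).
have Qa d := etrans (congr1 (Act (QE c F q 0)) (gh (La k d))) (Llift_a HQ d).
have Qy d := etrans (congr1 (Act (QE c F q 0)) (gh (Linv k d))) (Llift_y HQ d).
have ind (P : L -> Prop) : (forall b x z, P x -> P z -> P (b *: x + z)) -> P 1 ->
  (forall x z, P x -> P z -> P (x * z)) ->
  (forall v, P (Le k v)) -> (forall d, P (a d)) -> (forall d, P (y d)) -> forall z, P z.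
  move=> PL P1 PM Pe Pa Py z; rewrite -(hK z); move: (h z).
  apply: (L_ind (P := fun z => P (g z))) => [b x1 x2 p1 p2||x1 x2 p1 p2|v|d|d].
  - by rewrite (hom_lin hg); exact: PL.
  - by rewrite (hom1 hg).
  - by rewrite (homM hg); exact: PM.
  - by rewrite ge.
  - exact: Pa.
  - exact: Py.
have r_def : Lr eps s q = rh c eps0 sQ a y true - \sum_i q i *: Le k i.
  rewrite /Lr -grho /rh /rho (hom_prod hg); congr (_ - _).
  by apply: eq_bigr => d _; rewrite (hom_Lunit hg (a' := a) (y' := y)).
have S := fpp_section_fpp cyc F_off F_star F_tail q0 eps0_c eps0_cs sQ_mem sQ_uniq F_par par_F F_dep
  H hU Ue Ua Uy ind hQ Qe Qa Qy r_def.
have B := fpp_section_bimodule cyc F_off F_star F_tail q0 eps0_c eps0_cs sQ_mem sQ_uniq F_par par_F F_dep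
  H hU Ue Ua Uy ind hQ Qe Qa Qy r_def.
exact: ex_intro2 B S.
Qed.
End FreeProduct.

(** * From factors to words *)

Section Flatten.
Variables (k : fieldType) (Q : quiver) (n : nat) (c : 'I_n -> dart Q).
Variables (F : {set dart Q}).
Local Notation V := (vertex Q).
Local Notation word := (seq (lett Q)).
Local Notation factor := (factor Q n).
Implicit Types (j v : V) (u w : word) (s : bool) (d : dart Q) (l : lett Q) (i : 'I_n).
Implicit Types (f g : factor) (m : int) (p : nat) (kp : kind Q).
Local Notation nf := (nf c F).
Hypothesis c_cyc : is_cycle c.
Hypothesis F_off : {in F, forall d, off_cycle c d}.

Definition ltr (l : letter Q) : lett Q :=
  match l with Arr d => LA d | Xbar d s => LU (KX d) s end.

Definition run kp m : word :=
  match m with Posz p => nseq p (LU kp true) | Negz p => nseq p.+1 (LU kp false) end.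

Fixpoint fwd_word p i : word := if p is p'.+1 then LA (c i) :: fwd_word p' (ordS i) else [::].
Fixpoint bwd_word p i : word :=
  if p is p'.+1 then LA (star (c (ord_pred i))) :: bwd_word p' (ord_pred i) else [::].

Definition cpath i (m : int) : word :=
  match m with Posz p => fwd_word p i | Negz p => bwd_word p.+1 i end.

Definition fl f : word :=
  match f with
  | FCyc i m m' => run (KC (dtail (c i))) m ++ cpath i m'
  | FAdm d w => map ltr (d :: w)
  | FR v m => run (KR v) m
  end.

(** Numbered as in [factor_family]; for arrows the boolean [off_cycle] is read as 0 or 1. *)
Definition fam l : nat :=
  match l with
  | LA d => off_cycle c d
  | LU (KR _) _ => 2
  | LU (KX _) _ => 1
  | LU (KC _) _ => 0
  end.

Local Notation ok := (factor_ok c F).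
Local Notation hd := (factor_head c).
Local Notation tl := (factor_tail c).
Local Notation family := (@factor_family Q n).

Lemma run_nil kp m : run kp m = [::] -> m = 0.
Proof. by case: m => -[]. Qed.

Lemma cpath_nil i m : cpath i m = [::] -> m = 0.
Proof. by case: m => -[]. Qed.

Lemma fl_nil f : ok f -> fl f <> [::].
Proof.
case: f => [i m m'|d w|v m] //=; last by move=> h /run_nil.
move=> h; case E: (run _ m) => [|//] /cpath_nil E'; apply: h.
by rewrite E' (run_nil E).
Qed.

Lemma all_run (P : pred (lett Q)) kp m : (forall s, P (LU kp s)) -> all P (run kp m).
Proof. by move=> h; case: m => p; rewrite /run all_nseq h orbT. Qed.

Lemma all_cpath (P : pred (lett Q)) i m :
  (forall i, P (LA (c i))) -> (forall i, P (LA (star (c i)))) -> all P (cpath i m).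
Proof.
by move=> h h'; case: m => [p|p] /=; rewrite ?h' /=; elim: p i => [|p IH] i //=;
  rewrite ?h ?h' IH.
Qed.

Lemma fl_fam f : ok f -> all (fun l => fam l == family f) (fl f).
Proof.
case: f => [i m m'|d w|v m] => [_|[_ al _ _]|_].
- rewrite all_cat all_run // all_cpath // => i'; rewrite /= ?off_star off_c //.
- by rewrite all_map; apply: sub_all al => -[d'|d' s] //= ->.
- exact: all_run.
Qed.

Lemma st_run j kp m w : m <> 0 -> st j (run kp m ++ w) = kvert kp.
Proof. by case: m => -[]. Qed.

Lemma st_cpath j i m : m <> 0 -> st j (cpath i m) = dtail (c i).
Proof.
by case: m => [[|p]|p] //= _; rewrite dtail_star (c_next c_cyc) ord_predK.
Qed.

Lemma fl_st j f : ok f -> st j (fl f) = tl f.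
Proof.
case: f => [i m m'|[d|d s] w|v m] //= h; last by rewrite -[run _ _]cats0 st_run.
have [m0|/eqP m0] := eqVneq m 0; last by rewrite st_run.
by rewrite m0 /= st_cpath // => m'0; apply: h.
Qed.

Definition okc kp : bool :=
  match kp with KR _ => true | KX _ => false | KC v => on_cycle c v end.

Lemma okc_lok kp s : okc kp -> lokU c F kp s /\ kF F kp = false.
Proof. by case: kp. Qed.

Lemma nf_run j kp m w : okc kp -> nf j w -> st j w = kvert kp ->
  (if w is l :: _ then ~~ bad c F (LU kp true) l && ~~ bad c F (LU kp false) l else true) ->
  nf j (run kp m ++ w).
Proof.
move=> okk hw sw bw.
suff R p s : nf j (nseq p (LU kp s) ++ w) by case: m => p; apply: R.
elim: p => [|p IH] //=; have [-> kf] := okc_lok s okk; rewrite IH andbT /=.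
rewrite /compat /=; case: p {IH} => [|p] /=.
  rewrite sw eqxx; case: w bw {hw sw} => [|l w] //= /andP[b1 b2].
  by case: s.
by rewrite !eqxx kf.
Qed.

Lemma nf_cpath i m : nf (dtail (c (cyc_shift i m))) (cpath i m).
Proof.
case: m => p /=.
  elim: p i => [|p IH] i //; rewrite iterSr /= IH andbT /compat.
  case: p {IH} => [|p] /=; first by rewrite (c_next c_cyc) eqxx.
  rewrite (c_next c_cyc) eqxx /=; apply/eqP => e.
  by have := fwd_cs c_cyc i; rewrite -e fwd_c.
rewrite -[_ && _]/(nf _ (bwd_word p.+1 i)) -iterS.
elim: p.+1 i => {p} [|p IH] i //; rewrite iterSr /= IH andbT /compat.
case: p {IH} => [|p] /=; first by rewrite dhead_star eqxx.
rewrite dhead_star dtail_star (c_next c_cyc) ord_predK eqxx starK /=; apply/eqP => e.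
by have := fwd_cs c_cyc (ord_pred (ord_pred i)); rewrite e fwd_c.
Qed.

Lemma bad_forbidden (l l' : letter Q) : off_cycle c (letter_dart l) -> lok c F (ltr l) ->
  bad c F (ltr l) (ltr l') -> forbidden F [:: l; l'].
Proof.
case: l => [d|d s]; case: l' => [d'|d' s'] /= od.
- by move=> _ /eqP ->; exact: forb_aa.
- by rewrite kapE off_star od eq_KX => _ /eqP ->; exact: forb_ax.
- case/and3P=> _ _ Fs /andP[]; rewrite eq_KX => /eqP <- sF; rewrite sF /= in Fs.
  by have := forb_Fxa sF; rewrite starK Fs.
- case/and3P=> _ _ Fs /andP[]; rewrite eq_KX => /eqP <-.
  case: eqP => [->|ne]; last by case: s s' ne {Fs} => -[] // _ _; [exact: (forb_xx F d true) | exact: (forb_xx F d false)].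
  by move=> /= sF; rewrite sF /= in Fs; have := forb_Fxx sF; rewrite starK Fs.
Qed.

Lemma lok_forbidden (l : letter Q) : off_cycle c (letter_dart l) -> ~ forbidden F [:: l] ->
  lok c F (ltr l).
Proof.
case: l => [d|d s] //= od nf1; rewrite od /=; apply/andP; split.
  by apply/negP => dF; apply: nf1; exact: forb_Fx.
apply/implyP; case: s nf1 => // nf1 sF; case: nf1.
by have := forb_Fxinv sF; rewrite starK.
Qed.

(** Forbidden words have length at most two, so admissibility is a condition on single letters and
    on adjacent ones. *)
Lemma adm_nf (d : letter Q) (w : seq (letter Q)) : admissible c F (d :: w) <->
  all (fun b : letter Q => off_cycle c (letter_dart b)) (d :: w) /\
  nf (letter_head (last d w)) (map ltr (d :: w)).
Proof.
split=> [adm|[al h]].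
  have [_ al so no] := adm; split=> //; clear adm; elim: w d al so no => [|b w IH] d /= /andP[od al] so no.
    rewrite !andbT /compat /= andbT; apply/andP; split; last by case: d {al so no od} => [d|d s] /=.
    by apply: lok_forbidden => // h; exact: (no [::] _ [::] _ h).
  case/andP: so => /eqP hb so.
  have ld : lok c F (ltr d).
    by apply: lok_forbidden => // h; exact: (no [::] _ (b :: w) _ h).
  have h := IH b al so (fun (u f v : seq (letter Q)) e => no (d :: u) f v (congr1 (cons d) e)).
  apply/and3P; split=> //; rewrite /compat /=; apply/andP; split.
    by move: hb; case: d {al so no ld od IH h} => [d|d s]; case: b => [d'|d' s'] /= ->.
  by apply/negP => /(bad_forbidden od ld) h'; exact: (no [::] _ w _ h').
split=> //.
  elim: w d al h => [|b w IH] d //= /andP[od al] /and3P[_ /andP[/eqP e _] h].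
  have so := IH b al h; apply/andP; split; last exact: so.
  apply/eqP; move: e.
  by case: d {al od h IH so} => [d|d s]; case: b => [d'|d' s'] /= ->.
move=> u f v e fo; rewrite e in h.
have {}h : nf (letter_head (last d w)) (map ltr (f ++ v)).
  by elim: u {e} h => [|b u IH] //= /and3P[_ _ /IH].
have {}al : all (fun b : letter Q => off_cycle c (letter_dart b)) (f ++ v).
  by move: al; rewrite e all_cat => /andP[].
case: {e u} f / fo h al => [d' s|d'|d' s|d' s dF|d' dF|d' dF|d' dF] /=.
- by case/and3P=> _ /andP[_ /negP[]]; rewrite /= eq_KX eqxx /=; case: s.
- by case/andP=> /andP[_ /negP[]]; rewrite /= eqxx.
- case/andP=> /andP[_ /negP nb] _ /andP[od _]; apply: nb.
  by rewrite /= kapE off_star od eqxx.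
- by case/and3P=> /and3P[_]; rewrite dF.
- by case/and3P=> /and3P[_ _]; rewrite starK dF.
- by case/and3P=> _ /andP[_ /negP[]]; rewrite /= eq_KX starK dF eqxx.
- by case/and3P=> _ /andP[_ /negP[]]; rewrite /= eq_KX starK dF eqxx.
Qed.

Lemma fl_nf f : ok f -> nf (hd f) (fl f).
Proof.
case: f => [i m m'|d w|v m] /= h; last by rewrite -[run _ _]cats0; apply: nf_run.
  have [m'0|/eqP m'0] := eqVneq m' 0.
    by rewrite m'0 /= cats0 -[run _ _]cats0; apply: nf_run => //; exact: on_c.
  have stp : st (dtail (c (cyc_shift i m'))) (cpath i m') = dtail (c i).
    exact: st_cpath.
  apply: nf_run => //; [exact: on_c | exact: nf_cpath |].
  by case: m' {m'0 h stp} => -[].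
by case/adm_nf: h.
Qed.

Lemma run_inj kp : injective (run kp).
Proof.
by move=> [p|p] [p'|p'] /= e; have := congr1 size e; rewrite /= ?size_nseq => e';
  rewrite ?e' //; case: p p' e e' => [|p] [|p'] //= [] // _ [->].
Qed.

Lemma size_fwd_word p i : size (fwd_word p i) = p.
Proof. by elim: p i => //= p IH i; rewrite IH. Qed.
Lemma size_bwd_word p i : size (bwd_word p i) = p.
Proof. by elim: p i => //= p IH i; rewrite IH. Qed.

Lemma cpath_inj i : injective (cpath i).
Proof.
move=> [p|p] [p'|p'] e; have := congr1 size e; rewrite /= ?size_fwd_word ?size_bwd_word.
- by move=> ->.
- case: p e => [|p] //= [e]; have := fwd_cs c_cyc (ord_pred i).
  by rewrite -e fwd_c.
- case: p' e => [|p'] //= [e]; have := fwd_cs c_cyc (ord_pred i).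
  by rewrite e fwd_c.
- by move=> [->].
Qed.

(** A word has only one cut after its longest prefix with property [P]. *)
Lemma cat_all_inj (T : Type) (P : pred T) (u1 u2 w1 w2 : seq T) :
  all P u1 -> all P u2 -> (if w1 is x :: _ then ~~ P x else true) ->
  (if w2 is x :: _ then ~~ P x else true) -> u1 ++ w1 = u2 ++ w2 -> u1 = u2 /\ w1 = w2.
Proof.
elim: u1 u2 => [|x u1 IH] [|x2 u2] //=.
- by move=> _ /andP[Px _] + _; move=> h e; rewrite e Px in h.
- by move=> /andP[Px _] _ _ h e; rewrite -e Px in h.
move=> /andP[_ P1] /andP[_ P2] h1 h2 [-> e].
by have [-> ->] := IH u2 P1 P2 h1 h2 e.
Qed.

Lemma ltr_inj : injective ltr.
Proof. by move=> [d|d s] [d'|d' s'] //= []; move=> *; subst. Qed.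

Definition isLU l := if l is LU _ _ then true else false.

Lemma fl_inj f1 f2 : ok f1 -> ok f2 -> fl f1 = fl f2 -> f1 = f2.
Proof.
move=> ok1 ok2 e.
have fe : family f1 = family f2.
  have := fl_fam ok1; have := fl_fam ok2; rewrite -e.
  by case: (fl f1) (fl_nil ok1) => // l w _ /andP[/eqP <- _] /andP[/eqP <-].
have te : tl f1 = tl f2 by rewrite -(fl_st (tl f1) ok1) -(fl_st (tl f1) ok2) e.
case: f1 f2 ok1 ok2 e fe te => [i1 m1 m1'|d1 w1|v1 m1] [i2 m2 m2'|d2 w2|v2 m2] //= ok1 ok2.
- move=> + _ /(c_inj c_cyc) ii; rewrite ii => e.
  have A i m : is_true (if cpath i m is l :: _ then ~~ isLU l else true) by case: m => -[].
  have R m : all isLU (run (KC (dtail (c i2))) m) by exact: all_run.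
  have [/run_inj -> /cpath_inj -> //] := cat_all_inj (R _) (R _) (A _ _) (A _ _) e.
- by move=> [/ltr_inj -> /(inj_map ltr_inj) ->].
- by move=> + _ vv; rewrite vv => /run_inj ->.
Qed.

Lemma single l : lok c F l -> exists f, [/\ ok f, fl f = [:: l] & hd f = lhd l].
Proof.
have A (b : letter Q) : off_cycle c (letter_dart b) -> lok c F (ltr b) -> ok (FAdm n b [::]).
  move=> ob lb; apply/adm_nf; split; first by rewrite /= ob.
  by apply/and3P; split=> //; rewrite /compat andbT; case: b {ob lb} => [d|d s] /=.
case: l => [d|[v|d|v] s] /= lk.
- case: (boolP (off_cycle c d)) => od; first by exists (FAdm n (Arr d) [::]); split=> //; exact: A.
  case: (cyc_dartP od) => -[i ->].
    exists (FCyc Q i 0 1); split=> //=; first by case.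
    by rewrite (c_next c_cyc).
  exists (FCyc Q (ordS i) 0 (Negz 0)); split=> //=; first by case.
    by rewrite ordSK.
  by rewrite ordSK dhead_star.
- by case: s lk => _; [exists (FR n v 1) | exists (FR n v (Negz 0))].
- by exists (FAdm n (Xbar d s) [::]); split=> //; apply: A => //; case/and3P: lk.
have /existsP[i /eqP <-] := lk.
by case: s lk => _; [exists (FCyc Q i 1 0) | exists (FCyc Q i (Negz 0) 0)]; split=> // -[].
Qed.

(** The induction step in cutting a normal word into factors: a letter of the same family is
    absorbed. On the cycle this works because in a normal word no letter of [x] follows an arrow and
    a path does not turn back. *)
Lemma merge l f : ok f -> nf (hd f) (l :: fl f) -> fam l = family f ->
  exists g, [/\ ok g, fl g = l :: fl f & hd g = hd f].
Proof.
move=> okf h fe; have [lk /andP[/eqP st_l nb] _] := and3P h; rewrite fl_st // in st_l.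
case: f okf h fe st_l nb => [i m m'|d w|v m] okf h fe st_l nb.
- case: l lk h fe st_l nb => [d|[v|d|v] s] //= lk h.
    case: (boolP (off_cycle c d)) => // od _ st_l nb.
    have kd : kap c (star d) = KC (dtail (c i)).
      by rewrite kapE off_star (negbTE od) dtail_star st_l.
    have m0 : m = 0.
      by case: m nb {okf h} => [[|p]|p] //=; rewrite kd eqxx.
    rewrite m0 /= in okf nb *.
    case: (cyc_dartP od) st_l nb => -[i0 ->].
      rewrite (c_next c_cyc) => /(c_inj c_cyc) <-.
      case: m' {h kd okf} => [p|p] /= nb; last by rewrite ordSK eqxx in nb.
      exists (FCyc Q i0 0 (Posz p.+1)); split=> //=; first by case.
      by rewrite -iterS iterSr.
    rewrite dhead_star => /(c_inj c_cyc) ->.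
    case: m' {h kd} okf => [[|p]|p] /= okf nb; first by case: okf.
      by rewrite starK eqxx in nb.
    exists (FCyc Q (ordS i) 0 (Negz p.+1)); split=> //=; first by case.
      by rewrite ordSK.
    by rewrite -!iterS iterSr ordSK.
  move=> _ ->; case: m okf {h} => [[|p]|p] okf nb.
  + by case: s {nb}; [exists (FCyc Q i 1 m') | exists (FCyc Q i (Negz 0) m')]; split=> // -[].
  + exists (FCyc Q i (Posz p.+2) m'); split=> //; first by case.
    by move: nb; rewrite /= eqxx orbF /=; case: s.
  + exists (FCyc Q i (Negz p.+1) m'); split=> //; first by case.
    by move: nb; rewrite /= eqxx orbF /=; case: s.
- have [b [lb ob]] : exists b : letter Q, ltr b = l /\ off_cycle c (letter_dart b).
    case: l lk fe {h st_l nb} => [d'|[v|d'|v] s] //= lk fe.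
      by exists (Arr d'); split=> //; case: (off_cycle c d') fe.
    by exists (Xbar d' s); case/and3P: lk.
  exists (FAdm n b (d :: w)); split=> //; last by rewrite -lb.
  have [al _] := (adm_nf d w).1 okf.
  by apply/adm_nf; split; [rewrite /= ob; exact: al | rewrite [map _ _]/= lb].
case: l lk fe st_l nb {h} => [d|[v'|d|v'] s] //= _; first by case: (off_cycle c d).
move=> _ ->; case: m okf => [[|p]|p] //= _; rewrite eqxx orbF /= => nb.
  by exists (FR n v (Posz p.+2)); split=> //; case: s nb.
by exists (FR n v (Negz p.+1)); split=> //; case: s nb.
Qed.

(** No pattern mixes two families, so factors of different families can be joined whenever their end
    points match. *)
Lemma bad_fam l l' : fam l != fam l' -> ~~ bad c F l l'.
Proof.
case: l => [d|kp s]; case: l' => [d'|kp' s'] /=; apply: contraNN.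
- by move/eqP=> ->; rewrite off_star.
- by move/eqP=> ->; rewrite kapE off_star; case: ifP.
- by case/andP=> /eqP -> /= sF; rewrite -off_star (F_off sF).
- by case/andP=> /eqP ->.
Qed.

Lemma nf_cat a j u w : all (fun l => fam l == a) u -> (if w is l :: _ then fam l != a else true) ->
  nf (st j w) u -> nf j w -> nf j (u ++ w).
Proof.
move=> + hw; elim: u => [|l u IH] //= /andP[/eqP fl_a al] /and3P[lk cp hu] hnw.
rewrite lk (IH al hu hnw) andbT /=.
case: u cp {IH al hu} => [|l' u] //= cp.
move: cp; rewrite /compat andbT => /eqP e; case: w hw e {hnw} => [|l' w] /= hw ->.
  by rewrite eqxx.
by rewrite eqxx bad_fam // fl_a eq_sym.
Qed.

Lemma nf_catl j u w : nf j (u ++ w) -> nf (st j w) u.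
Proof.
elim: u => [|l u IH] //= /and3P[lk cp /IH ->]; rewrite lk andbT /=.
by case: u cp {IH} => [|l' u] //; rewrite /compat andbT => /andP[].
Qed.

Fixpoint alt (w : seq factor) : Prop :=
  if w is f :: w' then
    [/\ ok f, if w' is g :: _ then hd f = tl g /\ family f <> family g else True & alt w']
  else True.

Definition flat (w : seq factor) : word := flatten (map fl w).
Definition endpoint v (w : seq factor) : V := last v (map hd w).

Lemma st_flat v (w : seq factor) : alt w -> st (endpoint v w) (flat w) = if w is f :: _ then tl f else v.
Proof.
case: w => [|f w] // [okf _ _]; rewrite /flat /=.
have := fl_st (endpoint v (f :: w)) okf; have := fl_nil okf.
by case: (fl f).
Qed.

Lemma fam_flat (w : seq factor) : alt w ->
  if flat w is l :: _ then if w is f :: _ then fam l = family f else False else w = [::].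
Proof.
case: w => [|f w] // [okf _ _]; rewrite /flat /=.
by have := fl_nil okf; have := fl_fam okf; case: (fl f) => // l u /andP[/eqP].
Qed.

Lemma alt_boundary f (w : seq factor) : alt (f :: w) -> if flat w is l :: _ then fam l != family f else true.
Proof.
case=> _ b aw; have := fam_flat aw; case: (flat w) => // l _.
case: w b {aw} => // g w [_ ne] ->; rewrite eq_sym; exact/eqP.
Qed.

Lemma alt_nf v (w : seq factor) : alt w -> nf (endpoint v w) (flat w).
Proof.
elim: w v => [|f w IH] v // aw; have [okf b aw'] := aw; rewrite /flat /=.
apply: (@nf_cat (family f)) (fl_fam okf) (alt_boundary aw) _ (IH (hd f) aw').
rewrite -/(endpoint (hd f) w) st_flat //.
by case: w b {aw aw' IH} => [_|g w [<- _]]; exact: fl_nf.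
Qed.

(** The factors are recovered by cutting the word at the places where the family changes. *)
Lemma alt_inj (w1 w2 : seq factor) : alt w1 -> alt w2 -> flat w1 = flat w2 -> w1 = w2.
Proof.
elim: w1 w2 => [|f1 w1 IH] w2 a1 a2 e.
  by have := fam_flat a2; rewrite -e.
have F1 := fam_flat a1; have F2 := fam_flat a2.
case: w2 a2 e F2 => [|f2 w2] a2 e F2; first by rewrite e in F1.
have fe : family f1 = family f2.
  by rewrite -e in F2; case: (flat _) F1 F2 => // l _ <-.
have [ok1 _ a1'] := a1; have [ok2 _ a2'] := a2.
have al2 := fl_fam ok2; rewrite -fe in al2.
have b2 := alt_boundary a2; rewrite -fe in b2.
have [E1 E2] := cat_all_inj (fl_fam ok1) al2 (alt_boundary a1) b2 e.
by rewrite (fl_inj ok1 ok2 E1) (IH w2 a1' a2' E2).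
Qed.

Lemma alt_surj j u : nf j u -> u <> [::] ->
  exists w : seq factor, [/\ alt w, flat w = u & forall v, endpoint v w = j].
Proof.
elim: u => [|l u IH] // h _; have [lk /andP[/eqP lj nb] hu] := and3P h.
have [g [okg gl gh]] := single lk.
have [u0|/eqP un] := eqVneq u [::].
  exists [:: g]; split=> [//||v]; first by rewrite /flat /= cats0 gl u0.
  by rewrite /endpoint /= gh lj u0.
have [w [aw fw ew]] := IH hu un.
have stw : st j u = st (endpoint j w) (flat w) by rewrite fw ew.
rewrite st_flat // in stw.
case: w aw fw ew stw => [|f w] aw fw ew stw; first by case: un.
have [okf b aw'] := aw.
have [fe|ne] := eqVneq (fam l) (family f); last first.
  exists (g :: f :: w); split=> [|//|v].
  - split=> //; split; first by rewrite gh lj.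
    by move=> e; case/negP: ne; have := fl_fam okg; rewrite gl /= andbT e.
  - by rewrite /flat /= gl -fw.
  - by rewrite -(ew (hd g)).
have hf : nf (hd f) (l :: fl f).
  have := h; rewrite -fw -cat_cons => /nf_catl.
  rewrite -(ew j) -/(flat w) [endpoint _ _]/(endpoint (hd f) w) st_flat //.
  by case: w b {aw aw' fw ew stw h hu un IH} => [|f' w] // [<-].
have [f' [okf' fl' hd']] := merge okf hf fe.
exists (f' :: w); split=> [||v].
- split=> //; case: w b {aw aw' fw ew} => // f'' w; rewrite hd'.
  have := fl_fam okf'; rewrite fl' /= => /andP[/eqP <- _].
  by rewrite fe.
- by rewrite /flat /= fl' -fw.
- by rewrite /endpoint /= hd'; exact: (ew v).
Qed.
End Flatten.

(** * The values of factors as values of words *)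

Section FactorValues.
Variables (k : fieldType) (Q : quiver) (n : nat) (c : 'I_n -> dart Q) (F : {set dart Q}).
Variables (q : vertex Q -> k) (dlt : k).
Local Notation V := (vertex Q).
Local Notation word := (seq (lett Q)).
Local Notation factor := (factor Q n).
Implicit Types (v : V) (u : word) (s : bool) (d : dart Q) (l : lett Q) (i : 'I_n).
Implicit Types (f g : factor) (m : int) (p : nat) (kp : kind Q) (w : seq factor).
Hypothesis c_cyc : is_cycle c.
Variables (A : algebra k) (e : V -> A) (a y : dart Q -> A).
Hypothesis H : Lrel e a y.
Variable rR : bool -> A.
Hypothesis rR_e : forall s v, rR s * e v = e v * rR s.
Local Notation X := (Lunit a y).
Local Notation lv := (lval c q dlt e a y rR).
Local Notation wv := (word_val c q dlt e a y rR).

Lemma wval_cat u1 u2 : wv (u1 ++ u2) = wv u1 * wv u2.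
Proof. exact: big_cat. Qed.

Lemma wval_cons l u : wv (l :: u) = lv l * wv u.
Proof. exact: big_cons. Qed.

Lemma wval_nil : wv [::] = 1.
Proof. exact: big_nil. Qed.

(** Every letter carries its own idempotent, the power only one; as the idempotent stands on either
    side of a letter, it can be passed along. *)
Lemma power_run v kp s z p : kvert kp = v -> e v * z = lv (LU kp s) ->
  e v * z ^+ p = wv (nseq p (LU kp s)) * e v.
Proof.
move=> kv ez; elim: p => [|p IH]; first by rewrite expr0 wval_nil mulr1 mul1r.
rewrite exprS mulrA ez [nseq _ _]/= wval_cons -mulrA -IH mulrA.
congr (_ * _); rewrite (lval_LU c q dlt H rR_e) kv -mulrA (eK H) //.
Qed.

Lemma e_scalars (b : V -> k) v : e v * (\sum_i b i *: e i) = b v *: e v.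
Proof.
rewrite mulr_sumr (bigD1 v) //= big1 => [|u ne].
  by rewrite addr0 -alg_scalerAr (eK H).
by rewrite -alg_scalerAr (e_orth H) ?scaler0 // eq_sym.
Qed.

Lemma e_r s v :
  e v * (rR s - \sum_i cst q dlt (KR i) s *: e i) = lv (LU (KR v) s).
Proof. by rewrite /= !mulrBr e_scalars -alg_scalerAr mulr1. Qed.

Let aC := \sum_i a (c i).
Let bC := \sum_i a (star (c i)).
Let eW := \sum_i e (dtail (c i)).
Let xW := eW + aC * bC.
Let xV := \sum_i e (dtail (c i)) * y (c i).

Let cE i i' : (dtail (c i) == dtail (c i')) = (i == i').
Proof. by apply/eqP/eqP => [/(c_inj c_cyc)|->]. Qed.

Lemma e_aC i : e (dtail (c i)) * aC = a (c i).
Proof.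
rewrite mulr_sumr (bigD1 i) //= big1 => [|i' ne]; first by rewrite addr0 (Lrel_tail H).
by rewrite (e_a H) cE eq_sym (negbTE ne).
Qed.

Lemma e_bC i : e (dtail (c i)) * bC = a (star (c (ord_pred i))).
Proof.
have t i' : dtail (star (c i')) = dtail (c (ordS i')) by rewrite dtail_star (c_next c_cyc).
rewrite mulr_sumr (bigD1 (ord_pred i)) //= big1 => [|i' ne].
  by rewrite addr0 (e_a H) t ord_predK eqxx.
rewrite (e_a H) t cE; case: eqP => // E.
by rewrite E ordSK eqxx in ne.
Qed.

Lemma e_eW i : e (dtail (c i)) * eW = e (dtail (c i)).
Proof.
rewrite mulr_sumr (bigD1 i) //= big1 => [|i' ne]; first by rewrite addr0 (eK H).
by rewrite (e_orth H) // cE eq_sym.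
Qed.

Lemma e_xW i : e (dtail (c i)) * xW = e (dtail (c i)) * X (c i) true.
Proof.
rewrite /xW /Lunit !mulrDr e_eW mulr1; congr (_ + _).
rewrite !mulrA e_aC (Lrel_tail H) -(Lrel_head H (c i)) -mulrA (c_next c_cyc) e_bC ordSK.
by rewrite -{1}(c_next c_cyc) (Lrel_head H).
Qed.

Lemma e_xV i : e (dtail (c i)) * xV = e (dtail (c i)) * X (c i) false.
Proof.
rewrite mulr_sumr (bigD1 i) //= big1 => [|i' ne]; first by rewrite addr0 mulrA (eK H).
by rewrite mulrA (e_orth H) ?mul0r // cE eq_sym.
Qed.

Definition shifted_pow (x1 x2 : A) m : A :=
  match m with Posz p => x1 ^+ p | Negz p => x2 ^+ p.+1 end.

(** Treats both bases together: [dlt] is 0 for the powers of [x] and 1 for those of [x - 1] and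
    [x^-1 - 1]. *)
Lemma e_pow i m :
  e (dtail (c i)) * shifted_pow (xW - dlt *: eW) (xV - dlt *: eW) m =
  wv (run (KC (dtail (c i))) m) * e (dtail (c i)).
Proof.
have lvE s : lv (LU (KC (dtail (c i))) s) =
    e (dtail (c i)) * X (c i) s - dlt *: e (dtail (c i)).
  by rewrite /= (xC_c _ _ _ _ c_cyc) mulrBr -alg_scalerAr mulr1.
by case: m => p; apply: power_run => //; rewrite lvE mulrBr -alg_scalerAr e_eW ?e_xW ?e_xV.
Qed.

Lemma e_cpath i m :
  e (dtail (c i)) * match m with Posz p => aC ^+ p | Negz p => bC ^+ p.+1 end =
  wv (cpath c i m) * e (dtail (c (cyc_shift i m))).
Proof.
case: m => p; rewrite [cpath _ _ _]/= [cyc_shift _ _]/=.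
  elim: p i => [|p IH] i; first by rewrite expr0 wval_nil mul1r mulr1.
  rewrite iterSr exprS mulrA e_aC -(Lrel_head H) -mulrA (c_next c_cyc) IH.
  by rewrite [fwd_word _ _ _]/= wval_cons mulrA.
rewrite -[_ :: _]/(bwd_word c p.+1 i) -iterS; elim: p.+1 i => {p} [|p IH] i.
  by rewrite expr0 wval_nil mul1r mulr1.
rewrite iterSr exprS mulrA e_bC -(Lrel_head H) dhead_star -mulrA IH.
by rewrite [bwd_word _ _ _]/= wval_cons mulrA.
Qed.

Variable xp : int -> A.
Hypothesis xpE : forall i m,
  e (dtail (c i)) * xp m = wv (run (KC (dtail (c i))) m) * e (dtail (c i)).
Variables (r r' : A).
Hypothesis rE : r = rR true - \sum_i q i *: e i.
Hypothesis r'E : r' = rR false - \sum_i (q i)^-1 *: e i.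

Definition fval f : A :=
  match f with
  | FCyc i m l => e (dtail (c i)) * xp m *
      match l with Posz p => aC ^+ p | Negz p => bC ^+ p.+1 end
  | FAdm d w => wv (map (@ltr Q) (d :: w))
  | FR v (Posz p) => e v * r ^+ p
  | FR v (Negz p) => e v * r' ^+ p.+1
  end.

Lemma lval_ltr (b : letter Q) : lv (ltr b) =
  match b with Arr d => a d | Xbar d s => e (dtail d) * (X d s - 1) end.
Proof. by case: b => [d|d s] //=; rewrite scale1r. Qed.

Lemma lval_head l : lv l * e (lhd l) = lv l.
Proof.
case: l => [d|kp s]; first exact: (Lrel_head H).
by rewrite (lval_LU c q dlt H rR_e) -mulrA (eK H).
Qed.

Lemma fval_fl f : fval f = wv (fl c f) * e (factor_head c f).
Proof.
case: f => [i m m'|d w|v m].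
- by rewrite /fval xpE -mulrA e_cpath mulrA -wval_cat.
- rewrite /fval /fl [factor_head _ _]/=.
  elim: w d => [|b w IH] d; rewrite [map _ _]/= wval_cons.
    by rewrite wval_nil mulr1 -[in LHS]lval_head; case: d.
  by rewrite -[_ :: _]/(map (@ltr Q) (b :: w)) {1}IH mulrA.
case: m => p; [apply: (@power_run v (KR v) true) | apply: (@power_run v (KR v) false)] => //.
  by rewrite rE; exact: (e_r true).
by rewrite r'E; exact: (e_r false).
Qed.

Lemma e_wval l u : e (ltl l) * wv (l :: u) = wv (l :: u).
Proof. by rewrite wval_cons mulrA (e_lval c q dlt H). Qed.

Lemma fval_flat v w : alt c F w -> w <> [::] ->
  \prod_(f <- w) fval f = wv (flat c w) * e (endpoint c v w).
Proof.
elim: w v => [|f w IH] v // [okf b aw] _; rewrite big_cons fval_fl.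
case: w IH b aw => [|g w] IH b aw.
  by rewrite big_nil mulr1 /flat /= cats0.
rewrite (IH (factor_head c f)) // -mulrA [flat c (f :: _)]/flat [map _ _]/= [flatten _]/=.
rewrite wval_cat -mulrA; congr (_ * _); rewrite mulrA; congr (_ * _).
rewrite -[_ ++ _]/(flat c (g :: w)).
have {}aw : alt c F (g :: w) := aw.
have [hg _] := b; have := st_flat c_cyc v aw; have := fam_flat aw; rewrite hg.
by case: (flat c (g :: w)) => [//|l u] _ /= <-; exact: e_wval.
Qed.
Lemma theta_flat v w : {in F, forall d, off_cycle c d} -> alt c F w -> w <> [::] ->
  \prod_(f <- w) fval f = theta_map q dlt e a y rR (bv k c F (endpoint c v w) (flat c w)).
Proof.
move=> F_off aw wn; rewrite /theta_map wlin_bv; last exact: (alt_nf c_cyc F_off v aw).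
exact: fval_flat aw wn.
Qed.
End FactorValues.

(** * Parents and depths in a given spanning forest *)

Section ForestPaths.
Variables (Q : quiver) (n : nat) (c : 'I_n -> dart Q) (F : {set dart Q}).
Implicit Types (d : dart Q) (v : vertex Q) (p : seq (dart Q)).
Hypothesis F_forest : spanning_forest c F.

Let to_cycle v p := all (mem F) p /\ exists2 w, on_cycle c w & path_from_to v p w.

Definition root_path v : seq (dart Q) :=
  projT1 (cid (let: conj _ h := F_forest in h v)).

Lemma root_pathP v : to_cycle v (root_path v) /\ forall p, to_cycle v p -> root_path v = p.
Proof. by rewrite /root_path; case: (cid _) => p []. Qed.

Lemma root_path_on v : on_cycle c v -> root_path v = [::].
Proof.
move=> ov; have [_ uniq] := root_pathP v; apply: uniq; split=> //.
by exists v; rewrite //= eqxx.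
Qed.

Lemma root_path_cons d : d \in F -> root_path (dtail d) = d :: root_path (dhead d).
Proof.
move=> dF; have [_ uniq] := root_pathP (dtail d); apply: uniq.
have [[aF [w ow pw]] _] := root_pathP (dhead d).
split; first by rewrite /= aF andbT.
exists w => //; case: (root_path _) pw => [|b p] /=; first by rewrite eqxx.
by case/and3P=> /eqP -> -> ->; rewrite !eqxx.
Qed.

Lemma forest_off : {in F, forall d, off_cycle c d}.
Proof. by case: F_forest. Qed.

Lemma forest_tail : {in F, forall d, ~~ on_cycle c (dtail d)}.
Proof. by move=> d dF; apply/negP => /root_path_on; rewrite root_path_cons. Qed.

(** Otherwise the unique path from the tail of [d] would run along [d] and back again, and be longer
    than itself by two arrows. *)
Lemma forest_star : {in F, forall d, star d \notin F}.
Proof.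
move=> d dF; apply/negP => sF; have := root_path_cons sF.
rewrite dtail_star dhead_star (root_path_cons dF) => /(congr1 size) /= e.
by move/eqP: e; rewrite -[X in X == _]addn0 -addn2 eqn_add2l.
Qed.

Variable d0 : dart Q.
Definition forest_par v : dart Q := head d0 (root_path v).
Definition forest_dep v : nat := size (root_path v).

Lemma forest_parE : {in F, forall d, forest_par (dtail d) = d}.
Proof. by move=> d dF; rewrite /forest_par root_path_cons. Qed.

Lemma forest_par_tail v : ~~ on_cycle c v ->
  forest_par v \in F /\ dtail (forest_par v) = v.
Proof.
move=> nv; rewrite /forest_par; have [[aF [w ow pw]] _] := root_pathP v.
case: (root_path v) aF pw => [|d p] /=; first by move=> _ /eqP e; rewrite e ow in nv.
by case/andP=> dF _ /and3P[/eqP -> _ _].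
Qed.

Lemma forest_depE : {in F, forall d, (forest_dep (dhead d) < forest_dep (dtail d))%N}.
Proof. by move=> d dF; rewrite /forest_dep (root_path_cons dF). Qed.
End ForestPaths.

(** * The basis of alternating products *)

Section WordBasis.
Variables (k : fieldType) (Q : quiver) (n : nat) (c : 'I_n -> dart Q) (F : {set dart Q}).
Local Notation V := (vertex Q).
Local Notation M := (M k c F).
Local Notation bv := (bv k c F).
Variables (A : lmodType k) (th : M -> A) (ht : A -> M).
Hypotheses (th_lin : linear th) (thK : cancel th ht) (htK : cancel ht th).
Variables (I : Type) (P : I -> Prop) (val : I -> A) (Phi : I -> V * seq (lett Q)).
Hypothesis Phi_nf : forall b, P b -> nf c F (Phi b).1 (Phi b).2.
Hypothesis Phi_inj : forall b b', P b -> P b' -> Phi b = Phi b' -> b = b'.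
Hypothesis Phi_surj : forall j w, nf c F j w -> exists2 b, P b & Phi b = (j, w).
Hypothesis val_Phi : forall b, P b -> val b = th (bv (Phi b).1 (Phi b).2).

Lemma word_basis : is_basis P val.
Proof.
split=> [x|m f a f_inj fP e0 j0].
  rewrite -(htK x); move: (ht x) => {x}; elim/M_ind => [b x z||j w h].
  - case=> [m1 [f1 [a1 [p1 e1]]]] [m2 [f2 [a2 [p2 e2]]]].
    exists (m1 + m2)%N, (fun j => match split j with inl i => f1 i | inr i => f2 i end),
      (fun j => match split j with inl i => b * a1 i | inr i => a2 i end).
    split; first by move=> j; case: split.
    rewrite big_split_ord /= th_lin e1 e2 scaler_sumr; congr (_ + _); apply: eq_bigr => i _.
      by rewrite (unsplitK (inl i : 'I_m1 + 'I_m2)) scalerA.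
    by rewrite (unsplitK (inr i : 'I_m1 + 'I_m2)).
  - exists 0%N, (fun j : 'I_0 => False_rect I (not_false_is_true (ltn_ord j))), (fun _ => 0).
    by split=> [[]//|]; rewrite big_ord0 (lin0 th_lin).
  - have [b pb Eb] := Phi_surj h; exists 1%N, (fun _ => b), (fun _ => 1).
    by split=> //; rewrite big_ord1 scale1r val_Phi // Eb.
have e1 : \sum_j a j *: bv (Phi (f j)).1 (Phi (f j)).2 = 0.
  rewrite -[LHS]thK -[RHS]thK (lin0 th_lin) -e0 (lin_sum th_lin); congr ht.
  by apply: eq_bigr => j _; rewrite (linZ th_lin) val_Phi.
(* The linear form that reads off the coefficient of the normal word belonging to [f j0]. *)
pose coord : M -> k^o := wlin (fun j w => ((j, w) == Phi (f j0))%:R : k^o).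
have cl : linear coord by exact: wlin_linear.
have := congr1 coord e1; rewrite (lin0 cl) (lin_sum cl) (bigD1 j0) //= big1 => [|j ne].
  by rewrite addr0 (linZ cl) /coord wlin_bv ?Phi_nf // -surjective_pairing eqxx => /eqP;
    rewrite scaler_eq0 oner_eq0 orbF => /eqP.
rewrite (linZ cl) /coord wlin_bv ?Phi_nf // -surjective_pairing.
case: eqP => [/(Phi_inj (fP j) (fP j0)) /f_inj e|]; last by rewrite scaler0.
by rewrite e eqxx in ne.
Qed.
End WordBasis.

Section CycleBasis.
Variables (k : fieldType) (Q : quiver) (n : nat) (c : 'I_n -> dart Q) (q : vertex Q -> k).
Variables (eps : dart Q -> bool) (s : seq (dart Q)) (F : {set dart Q}).
Hypothesis n_gt0 : (0 < n)%N.
Hypothesis c_cyc : is_cycle c.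
Hypothesis q_neq0 : forall i, q i != 0.
Hypothesis eps_or : orientation eps.
Hypothesis eps_c : forall i, eps (c i).
Hypothesis s_order : total_order (cycle_order c ++ s).
Hypothesis F_forest : spanning_forest c F.
Local Notation L := (algL k Q).
Let r : L := Lr eps (cycle_order c ++ s) q.
Let r' : L := Lr' eps (cycle_order c ++ s) q.

Lemma basis_word_alt (w : seq (factor Q n)) :
  basis_word_ok c F (Alt w) <-> w <> [::] /\ alt c F w.
Proof.
split=> [[wn okw so1 so2]|[wn aw]].
  split=> //; elim: w {wn} okw so1 so2 => [|f w IH] //= okw so1 so2.
  split.
  - exact: (okw [::] f w).
  - by case: w so1 so2 {IH okw} => //= g w /andP[/eqP -> _] /andP[/eqP ne _].
  apply: IH.
  - by move=> u g v e; apply: (okw (f :: u) g v); rewrite e.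
  - by move: so1; case: (w) => //= g w' /andP[].
  - by move: so2; case: (w) => //= g w' /andP[].
split=> //.
- elim: w aw {wn} => [_ [] //|f w IH [okf _ aw]] [|f' u] g v /= [].
    by move=> <-.
  by move=> _; exact: IH.
- elim: w aw {wn} => [//|f w IH [_ b aw]]; case: w b aw IH => [//|g w] [b _] aw IH.
  by apply/andP; split; [rewrite b | exact: IH].
- elim: w aw {wn} => [//|f w IH [_ b aw]]; case: w b aw IH => [//|g w] [_ b] aw IH.
  by apply/andP; split; [exact/eqP | exact: IH].
Qed.

Let v0 := dtail (c (Ordinal n_gt0)).
Definition word_of (b : basis_word Q n) : vertex Q * seq (lett Q) :=
  match b with Idem v => (v, [::]) | Alt w => (endpoint c v0 w, flat c w) end.

Lemma flat_nil w : alt c F w -> flat c w = [::] -> w = [::].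
Proof. by move=> aw e; have := fam_flat aw; rewrite e. Qed.

Lemma word_of_inj b b' : basis_word_ok c F b -> basis_word_ok c F b' ->
  word_of b = word_of b' -> b = b'.
Proof.
case: b b' => [v|w] [v'|w'] okb okb' [].
- by move=> ->.
- have [wn aw] := (basis_word_alt _).1 okb'.
  by move=> _ e; case: wn; apply: flat_nil.
- have [wn aw] := (basis_word_alt _).1 okb.
  by move=> _ e; case: wn; apply: flat_nil.
have [_ aw] := (basis_word_alt _).1 okb; have [_ aw'] := (basis_word_alt _).1 okb'.
by move=> _ /(alt_inj c_cyc aw aw') ->.
Qed.

Lemma word_of_nf b : basis_word_ok c F b -> nf c F (word_of b).1 (word_of b).2.
Proof.
case: b => [v|w] // /(basis_word_alt _)[_ aw]; apply: alt_nf => //.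
exact: forest_off F_forest.
Qed.

Lemma word_of_surj j w : nf c F j w -> exists2 b, basis_word_ok c F b & word_of b = (j, w).
Proof.
have [->|/eqP wn] := eqVneq w [::]; first by exists (Idem n j).
move=> h; have [u [au fu eu]] := alt_surj c_cyc h wn.
rewrite -fu in wn *.
exists (Alt u); last by rewrite /= eu.
by apply/basis_word_alt; split=> // u0; apply: wn; rewrite u0.
Qed.

Local Notation e := (@Le k Q).
Local Notation La := (@La k Q).
Local Notation Linv := (@Linv k Q).

Let sQ_facts : uniq s /\ forall d, (d \in s) = off_cycle c d.
Proof. exact/(total_order_cycle c_cyc). Qed.

Variables (dlt : k) (xp : int -> L).
Hypothesis xpE : forall i m, e (dtail (c i)) * xp m =
  word_val c q dlt e La Linv (rh c eps s La Linv) (run (KC (dtail (c i))) m) * e (dtail (c i)).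

Lemma cycle_basis : is_basis (basis_word_ok c F) (basis_word_val c xp r r').
Proof.
have [s_uniq s_mem] := sQ_facts.
have eps_cs i : eps (star (c i)) = false by rewrite eps_or eps_c.
have F_off := forest_off F_forest.
have F_star := forest_star F_forest.
have F_tail := forest_tail F_forest.
pose d0 := c (Ordinal n_gt0); pose par := forest_par F_forest d0.
have F_par := forest_parE F_forest d0.
have par_F := forest_par_tail F_forest d0.
have F_dep := forest_depE F_forest.
have HL := L_Lrel k Q.
have HU := Act_Lrel c_cyc F_off F_star F_tail q_neq0 eps par (forest_dep F_forest) s_mem
   (RhoUK c F q dlt) (RhoU_eE c F q dlt) (RhoU_tE c F dlt q_neq0).
have hU := Llift_hom HU.
have L_ind' := @L_ind k Q.
have thK := thetaK c_cyc F_off F_star F_tail q_neq0 eps_c eps_cs s_mem s_uniq F_par par_F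
  F_dep hU (Llift_e HU) (Llift_a HU) (Llift_y HU).
have htK := f1K c_cyc F_off F_star F_tail q_neq0 eps_c eps_cs s_mem s_uniq F_par par_F
  F_dep HL hU (Llift_e HU) (Llift_a HU) (Llift_y HU) L_ind'.
have th_lin := @theta_linear k Q n c F q dlt L e La Linv (rh c eps s La Linv).
apply: (word_basis th_lin thK htK (Phi := word_of) word_of_nf word_of_inj word_of_surj) => b okb.
case: b okb => [v|w]; first by move=> _; exact (esym (@theta_nil k Q n c F q dlt L e La Linv _ v)).
case/basis_word_alt=> wn aw.
have r'E : r' = rh c eps s La Linv false - \sum_i (q i)^-1 *: e i.
  by rewrite /r' /Lr' /rho_inv /rh.
refine (etrans _ (theta_flat (q := q) (dlt := dlt) (xp := xp) (r := r) (r' := r')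
   c_cyc HL (rh_e c eps s HL) xpE erefl r'E v0 F_off aw wn)).
apply: eq_bigr => f _; case: f => [i m m'|d u|v [m|m]] //.
have lvE (b : letter Q) :
    letter_val k b = lval c q dlt e La Linv (rh c eps s La Linv) (ltr b).
  by apply: (etrans _ (esym (lval_ltr c q dlt e La Linv _ b))); case: b => [d'|d' []].
exact (etrans (eq_bigr _ (fun b _ => lvE b)) (esym
  (big_map (@ltr Q) xpredT (lval c q dlt e La Linv (rh c eps s La Linv))))).
Qed.
End CycleBasis.

Theorem proposition7p11 (k : fieldType) (Q : quiver) (n : nat)
    (c : 'I_n -> dart Q) (q : vertex Q -> k) :
  connected Q -> (0 < n)%N -> is_cycle c -> (forall i, q i != 0) ->
  (forall (eps : dart Q -> bool) (s : seq (dart Q)),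
     orientation eps -> total_order s ->
     exists2 sigma : mult_preproj eps s q -> algL k Q,
       bimodule_section (L := algL k Q) (r := Lr eps s q) (@Le k Q) sigma
     & strong_free_product (L := algL k Q) (r := Lr eps s q) q (@Le k Q) sigma)
  /\
  (forall (eps : dart Q -> bool) (s : seq (dart Q)) (F : {set dart Q}),
     orientation eps -> (forall i, eps (c i)) ->
     total_order (cycle_order c ++ s) ->
     spanning_forest c F -> {in F, forall d, eps d} ->
     let r := Lr eps (cycle_order c ++ s) q in
     let r' := Lr' eps (cycle_order c ++ s) q in
     is_basis (basis_word_ok c F) (basis_word_val c (xpow k c) r r')
     /\ is_basis (basis_word_ok c F) (basis_word_val c (xpow' k c) r r')).
Proof.
move=> conn n0 cyc q0; split=> [eps s oe ts|eps s F oe ec ts sf _ r r'].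
  exact: (fpp_cycle conn n0 cyc).
have HL := L_Lrel k Q; have rhe := rh_e c eps s HL.
split; [apply: (@cycle_basis _ _ _ _ _ _ _ _ n0 cyc q0 oe ec ts sf 0)
  | apply: (@cycle_basis _ _ _ _ _ _ _ _ n0 cyc q0 oe ec ts sf 1)] => i m.
  by rewrite -(e_pow q 0 cyc HL rhe) !scale0r !subr0.
by rewrite -(e_pow q 1 cyc HL rhe) !scale1r.
Qed.
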